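(* Let $\varphi$ be an Orlicz function and $w$ a decreasing positive weight function on $I=(0,a)$, $0<a\le\infty$, such that $W(t)=\int_0^t w\,dm<\infty$ for all $t\in I$. Let $\varphi_*$ be the complementary function to $\varphi$. Then the Köthe dual spaces of the Orlicz-Lorentz spaces $(\Lambda_{\varphi,w},\|\cdot\|_{\Lambda_{\varphi,w}})$ and $(\Lambda_{\varphi,w},\|\cdot\|^0_{\Lambda_{\varphi,w}})$ are $$(\Lambda_{\varphi,w},\|\cdot\|_{\Lambda_{\varphi,w}})'=(\mathcal M_{\varphi_*,w},\|\cdot\|^0_{\mathcal M_{\varphi_*,w}}),\qquad (\Lambda_{\varphi,w},\|\cdot\|^0_{\Lambda_{\varphi,w}})'=(\mathcal M_{\varphi_*,w},\|\cdot\|_{\mathcal M_{\varphi_*,w}})$$ (with equality of norms), where for $f\in\mathcal M_{\varphi_*,w}$ the norms are given by $$\|f\|_{\mathcal M_{\varphi_*,w}}=\inf\{\|f\|_{\mathrm M_v}: v\prec w,\ v>0,\ v\text{ decreasing}\}=\inf\{\|g\|_{\mathrm M}: f\prec g\}=\|f^0\|_{\mathrm M},$$ $$\|f\|^0_{\mathcal M_{\varphi_*,w}}=\inf\{\|f\|^0_{\mathrm M_v}: v\prec w,\ v>0,\ v\text{ decreasing}\}=\inf\{\|g\|^0_{\mathrm M}: f\prec g\}=\|f^0\|^0_{\mathrm M},$$ with $\mathrm M_v(f)=\int_I\varphi_*\left(\frac{f^*}{v}\right)v\,dm$, $\mathrm M=\mathrm M_w$, and $f^0$ the level function of $f$ with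 respect to $w$.
   Context: $m$ is Lebesgue measure; functions are identified when equal a.e.; ''decreasing'' means non-increasing. $L^0(I)$ is the space of real Lebesgue measurable functions on $I$. $f^*$ is the decreasing rearrangement of $f\in L^0(I)$ with respect to $m$. $f\prec g$ means $\int_0^x f^*\,dm\le\int_0^x g^*\,dm$ for all $x\in I$. An Orlicz function is a convex $\varphi:[0,\infty)\to[0,\infty)$ with $\varphi(0)=0$ and $\varphi>0$ on $(0,\infty)$; its complementary function is $\varphi_*(t)=\sup_{s\ge0}\{st-\varphi(s)\}$, $t\ge0$ (which may take the value $\infty$). For a functional $\rho:L^0(I)\to[0,\infty]$, $\|f\|_\rho=\inf\{\lambda>0:\rho(f/\lambda)\le1\}$ (Luxemburg) and $\|f\|_\rho^0=\inf_{t>0}t(1+\rho(f/t))$ (Orlicz/Amemiya). The Orlicz-Lorentz space $\Lambda_{\varphi,w}$ is the set of $f\in L^0(I)$ with $\Phi(\lambda f)<\infty$ for some $\lambda>0$, where $\Phi(f)=\int_I\varphi(f^* )w\,dm$; its norms are $\|\cdot\|_{\Lambda_{\varphi,w}}=\|\cdot\|_\Phi$ and $\|\cdot\|^0_{\Lambda_{\varphi,w}}=\|\cdot\|^0_\Phi$. The Köthe dual $X'$ of a Banach function space $X\subset L^0(I)$ is the set of $f\in L^0(I)$ with $\|f\|_{X'}=\sup\{\int_I|fg|\,dm:\|g\|_X\le1\}<\infty$. With $\mathrm M_v$ as in the claim (built from $\varphi_*$), let $M_{L_{\varphi_*},v}$ be the class of $f\in L^0(I)$ with $\mathrm M_v(\lambda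 f)<\infty$ for some $\lambda>0$. $\mathcal M_{\varphi_*,w}$ is the set of $f\in L^0(I)$ with $f\prec g$ for some $g\in M_{L_{\varphi_*},w}$; equivalently, it is the union of the classes $M_{L_{\varphi_*},v}$ over positive decreasing weights $v\prec w$. Level function (Halperin). For $f\in L^0(I)$ with $f^*$ finite and integrable on the finite intervals $(0,t)$, $t\in I$, and $0\le\alpha<\beta<\infty$, $(\alpha,\beta)\subset I$, put $W(\alpha,\beta)=\int_\alpha^\beta w\,dm$, $F(\alpha,\beta)=\int_\alpha^\beta f^*\,dm$, $R(\alpha,\beta)=F(\alpha,\beta)/W(\alpha,\beta)$, and, if $a=\infty$, $R(\alpha,\infty)=\limsup_{t\to\infty}R(\alpha,t)$. An interval $(\alpha,\beta)\subset I$ ($\beta\le\infty$) is a level interval if $R(\alpha,\beta)>0$ and $R(\alpha,t)\le R(\alpha,\beta)$ for each $t\in(\alpha,\beta)$; it is a maximal level interval if not contained in a larger level interval. Maximal level intervals are pairwise disjoint, hence at most countably many. The level function is $f^0(t)=R(\alpha,\beta)w(t)$ if $t$ belongs to a maximal level interval $(\alpha,\beta)$, and $f^0(t)=f^*(t)$ otherwise. *)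

(* Defs.v *)
(* Orlicz-Lorentz spaces on (0, a), their Koethe duals and level functions.

   A function on (0, a) is given by a total function on R of which only the
   restriction to (0, a) is used.  Functionals take extended-real-valued
   functions, since decreasing rearrangements and level functions may be
   infinite; a function f : R -> R is passed to them as EFin \o f. *)
From HB Require Import structures.
From mathcomp Require Import all_boot all_order all_algebra.
From mathcomp Require Import all_classical all_reals all_analysis.

Set Implicit Arguments.
Unset Strict Implicit.
Unset Printing Implicit Defensive.

Import Order.TTheory GRing.Theory Num.Theory.
Import numFieldNormedType.Exports.

Local Open Scope classical_set_scope.
Local Open Scope ring_scope.
Local Open Scope ereal_scope.

(* R with the Lebesgue (i.e. Caratheodory) sigma-algebra, which is larger than
   the Borel one carried by lebesgue_measure. *)
Notation lebesgue_type R := (caratheodory_type (wlength (@idfun R))^*%mu).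
Notation leb := completed_lebesgue_measure.

Section orlicz_lorentz.
Context {R : realType}.
Implicit Types (a b : \bar R) (phi w v : R -> R).

Definition itv0 a : set R := [set x : R | (0 < x)%R /\ x%:E < a].

Definition L0 a : set (R -> R) :=
  [set f | measurable_fun (itv0 a : set (lebesgue_type R))
                          (f : lebesgue_type R -> R)].

Definition decreasing_on a v :=
  {in itv0 a &, forall x y : R, (x <= y)%R -> (v y <= v x)%R}.

Definition positive_on a v := {in itv0 a, forall x : R, (0 < v x)%R}.

Definition distribution a (f : R -> \bar R) (s : R) : \bar R :=
  leb [set x | itv0 a x /\ s%:E < `|f x|].

Definition rearr a (f : R -> \bar R) (t : R) : \bar R :=
  ereal_inf [set s%:E | s in [set s : R | (0 <= s)%R /\
                                          distribution a f s <= t%:E]].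

Definition submaj a (f g : R -> \bar R) :=
  forall x : R, itv0 a x ->
    \int[leb]_(t in `]0%R, x[) rearr a f t <=
    \int[leb]_(t in `]0%R, x[) rearr a g t.

Definition orlicz_function phi :=
  [/\ convex_function ([set t : R | (0 <= t)%R]) phi,
      phi 0%R = 0%R &
      forall t : R, (0 < t)%R -> (0 < phi t)%R].

(* The complementary function; it takes the value +oo at +oo. *)
Definition complementary phi (t : \bar R) : \bar R :=
  ereal_sup [set s%:E * t - (phi s)%:E | s in [set s : R | (0 <= s)%R]].

Definition escale (c : R) (f : R -> \bar R) : R -> \bar R :=
  fun x => c%:E * f x.

Definition luxemburg (rho : (R -> \bar R) -> \bar R) (f : R -> \bar R) :=
  ereal_inf [set l%:E | l in [set l : R | (0 < l)%R /\
                                          rho (escale l^-1%R f) <= 1]].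

Definition amemiya (rho : (R -> \bar R) -> \bar R) (f : R -> \bar R) :=
  ereal_inf [set t%:E * (1 + rho (escale t^-1%R f))
            | t in [set t : R | (0 < t)%R]].

(* The class of f such that rho (l f) is finite for some l > 0. *)
Definition modular_class a (rho : (R -> \bar R) -> \bar R) : set (R -> R) :=
  [set f | L0 a f /\
           exists2 l : R, (0 < l)%R & rho (escale l (EFin \o f)) < +oo].

Definition kothe_norm a (X : set (R -> R)) (N : (R -> \bar R) -> \bar R)
    (f : R -> R) : \bar R :=
  ereal_sup [set \int[leb]_(x in itv0 a) (`|f x * g x|%R)%:E
            | g in [set g | X g /\ N (EFin \o g) <= 1]].

Definition kothe_dual a (X : set (R -> R)) (N : (R -> \bar R) -> \bar R) :
    set (R -> R) :=
  [set f | L0 a f /\ kothe_norm a X N f < +oo].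

(* er_map extends phi by phi (+oo) = +oo. *)
Definition Phi a phi w (f : R -> \bar R) : \bar R :=
  \int[leb]_(x in itv0 a) (er_map phi (rearr a f x) * (w x)%:E).

Definition Lambda a phi w : set (R -> R) := modular_class a (Phi a phi w).

Definition Lambda_norm a phi w := luxemburg (Phi a phi w).

Definition Lambda_norm0 a phi w := amemiya (Phi a phi w).

Definition Mmod a phi v (f : R -> \bar R) : \bar R :=
  \int[leb]_(x in itv0 a)
    (complementary phi (rearr a f x / (v x)%:E) * (v x)%:E).

Definition Mspace a phi w : set (R -> R) :=
  [set f | L0 a f /\ exists2 g, modular_class a (Mmod a phi w) g &
                                submaj a (EFin \o f) (EFin \o g)].

Definition admissible_weight a w v :=
  [/\ submaj a (EFin \o v) (EFin \o w), positive_on a v & decreasing_on a v].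

Definition Mspace_norm a phi w (f : R -> \bar R) : \bar R :=
  ereal_inf [set luxemburg (Mmod a phi v) f | v in admissible_weight a w].

Definition Mspace_norm0 a phi w (f : R -> \bar R) : \bar R :=
  ereal_inf [set amemiya (Mmod a phi v) f | v in admissible_weight a w].

Definition avg_fin a w (f : R -> \bar R) (alpha t : R) : \bar R :=
  (\int[leb]_(x in `]alpha, t[) rearr a f x) /
  (\int[leb]_(x in `]alpha, t[) (w x)%:E).

(* The value for b = -oo is irrelevant: level intervals have alpha < b. *)
Definition avg a w (f : R -> \bar R) (alpha : R) b : \bar R :=
  match b with
  | t%:E => avg_fin a w f alpha t
  | +oo => limf_esup (avg_fin a w f alpha) (pinfty_nbhs R)
  | -oo => 0
  end.

Definition level_interval a w (f : R -> \bar R) (alpha : R) b :=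
  [/\ (0 <= alpha)%R, alpha%:E < b, b <= a, 0 < avg a w f alpha b &
      forall t : R, (alpha < t)%R -> t%:E < b ->
        avg a w f alpha t%:E <= avg a w f alpha b].

Definition maximal_level_interval a w (f : R -> \bar R) (alpha : R) b :=
  level_interval a w f alpha b /\
  forall (alpha' : R) (b' : \bar R), level_interval a w f alpha' b' ->
    (alpha' <= alpha)%R -> b <= b' -> alpha' = alpha /\ b' = b.

(* Maximal level intervals are pairwise disjoint, so that the chosen p is the
   only one. *)
Definition level_function a w (f : R -> \bar R) (t : R) : \bar R :=
  match pselect (exists p : R * \bar R,
           [/\ maximal_level_interval a w f p.1 p.2,
               (p.1 < t)%R & t%:E < p.2]) with
  | left ex => let p := projT1 (cid ex) in avg a w f p.1 p.2 * (w t)%:E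
  | right _ => rearr a f t
  end.

End orlicz_lorentz.

(* Main.v *)
(* Let F and W be the primitives of f^* and w, and u = f^0 / w the slope of the
   level function, which is decreasing.  On each maximal level interval with
   average c put v = f^* / c, and v = w elsewhere; then v is an admissible weight
   with f^* / v = u, and M_v(f / t) <= M(f^0 / t) since v is submajorized by w
   and phi_*(u / t) decreases.  The Koethe norms are bounded by all the other
   quantities by the inequalities of Young, Hardy and Hardy-Littlewood, so
   everything reduces to bounding f^0 by the Koethe norm of f.

   Every g in the unit ball may be replaced by a decreasing test function h:
   sup { int |f g| : g^* <= h } = int f^* h, where g is built from f after
   perturbing f so that its level sets become null.  The dual norm then gives
   int f^* h <= t (int phi(h) w + B) for all h; the Luxemburg case needs a
   Lagrange multiplier t.  Approximate phi_*(u / t) from below by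
   sum_i (d u / t - (phi((i + 1) d) - phi(i d)))^+.  Integrating each term
   against w gives at most a multiple of sup_b (F(b) - c_i W(b)), and testing
   with h = sum_i d 1_{(0, b_i)}, where phi(h) <= sum_i (phi((i + 1) d) - phi(i d)) 1_{(0, b_i)}
   by convexity, bounds the sum of these suprema by B. *)
Require Import Defs.
From mathcomp Require Import all_boot all_order all_algebra.
From mathcomp Require Import all_classical all_reals all_analysis.
From mathcomp Require Import measurable_realfun ring lra.

Set Implicit Arguments.
Unset Strict Implicit.
Unset Printing Implicit Defensive.

Import Order.TTheory GRing.Theory Num.Theory.
Import numFieldNormedType.Exports.

Local Open Scope classical_set_scope.
Local Open Scope ring_scope.

(** * Level intervals of a pair of primitives *)

(** A finite Koethe norm also provides the standing assumptions on f: testing with the indicator of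
    (0, t) gives F(t) <= C (1 + W(t)), so that F is finite and the averages stay bounded when a =
    +oo. The norm identities are therefore proved for finite Koethe norm, and the upper bounds show
    that this norm is finite on the dual space. Averages over level intervals, with a limsup when
    the right end is +oo, are replaced by comparisons of values of F - c W. This avoids divisions
    and treats finite and infinite right ends alike. In the plane of (W, F), points outside all
    level intervals lie on the least concave majorant of the curve. The obstacle to monotonicity of
    the slope is that f^* may jump. The slope is shown to decrease only outside the countable set of
    jumps, which is carried along as a null set. Integral inequalities are reduced to superlevel
    sets by finite sums of indicators and Fatou's lemma. Equality in the Hardy-Littlewood inequality
    then means that certain sets are nested, and sets of prescribed measure nested with the
    superlevel sets of f exist only after ties are broken. *)

Definition cont_on {R : realType} (D : set R) (f : R -> R) :=
  forall x, D x -> forall e, 0 < e -> exists2 d, 0 < d &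
    forall y, D y -> `|y - x| < d -> `|f y - f x| < e.

Lemma left_ball {R : realType} (b d t : R) :
  b - d < t -> t < b -> `|t - b| < d.
Proof.
by move=> bdt tb; rewrite distrC ger0_norm ?subr_ge0 ?(ltW tb)// ltrBlDr -ltrBlDl.
Qed.

(** The point is the supremum of the points of [[s, t]] where [g] is at least [m]; continuity
    relative to [D] excludes both strict inequalities there. With its mirror image [cont_first_ge]
    it supplies the ends of a level interval around a dip of [tilt c]. *)
Lemma cont_last_ge {R : realType} (D : set R) (g : R -> R) s t m :
  cont_on D g -> (forall x, s <= x -> x <= t -> D x) ->
  m <= g s -> g t < m -> s <= t ->
  exists2 x, s <= x < t & g x = m /\ forall y, x < y -> y <= t -> g y < m.
Proof.
move=> cg Dst gs gt st.
pose E := [set x | [/\ s <= x, x <= t & m <= g x]].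
have Es : E s by split.
have hE : has_sup E by split; [exists s|exists t => x []].
pose x := sup E.
have sx : s <= x by exact: sup_upper_bound.
have xt : x <= t by apply: ge_sup; [exists s|move=> y []].
have Dx := Dst _ sx xt.
have gx : m <= g x.
  rewrite leNgt; apply/negP; rewrite -subr_gt0 => e0.
  have [d d0 Hd] := cg _ Dx _ e0.
  have [y [sy yt gy] xdy] := sup_adherent d0 hE.
  have yx : y <= x by exact: sup_upper_bound.
  have yxd : `|y - x| < d by rewrite distrC ger0_norm ?subr_ge0// ltrBlDr -ltrBlDl.
  have := Hd _ (Dst _ sy yt) yxd; rewrite ltr_norml => /andP[_].
  by rewrite ltrD2r ltNge gy.
have {}xt : x < t by rewrite lt_neqAle xt andbT; apply: contraTneq gt => <-; rewrite -leNgt.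
have gy y : x < y -> y <= t -> g y < m.
  move=> xy yt; rewrite ltNge; apply/negP => gy.
  have : y <= x by apply: sup_upper_bound => //; split => //; exact: le_trans (ltW xy).
  by rewrite leNgt xy.
exists x; first by rewrite sx.
split=> //; apply/eqP; rewrite eq_le gx andbT leNgt; apply/negP.
rewrite -subr_gt0 => e0; have [d d0 Hd] := cg _ Dx _ e0.
pose y := Num.min t (x + d / 2).
have xy : x < y by rewrite lt_min xt ltrDl divr_gt0.
have yt : y <= t by rewrite ge_min lexx.
have yxd : `|y - x| < d.
  rewrite ger0_norm ?subr_ge0 ?(ltW xy)// ltrBlDl gt_min ltrD2l.
  by rewrite ltr_pdivrMr// ltr_pMr// ltr1n orbT.
have := Hd _ (Dst _ (le_trans sx (ltW xy)) yt) yxd.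
rewrite ltr_norml => /andP[+ _]; have := gy _ xy yt; lra.
Qed.

Lemma cont_first_ge {R : realType} (D : set R) (g : R -> R) t r m :
  cont_on D g -> (forall x, t <= x -> x <= r -> D x) ->
  g t < m -> m <= g r -> t <= r ->
  exists2 x, t < x <= r & g x = m /\ forall y, t <= y -> y < x -> g y < m.
Proof.
move=> cg Dtr gt gr tr.
have cg' : cont_on [set x | D (- x)] (g \o -%R).
  move=> x Dx e e0; have [d d0 Hd] := cg _ Dx _ e0; exists d => // y Dy yx.
  by apply: Hd => //; rewrite -opprD normrN.
have [||||x /andP[rx xt] [gx gy]] := @cont_last_ge _ _ _ (- r) (- t) m cg'.
- by move=> x rx xt /=; apply: Dtr; [rewrite lerNr|rewrite lerNl].
- by rewrite /= opprK.
- by rewrite /= opprK.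
- by rewrite lerN2.
exists (- x); first by rewrite ltrNr xt lerNl.
by split=> // y ty yx; rewrite -(opprK y); apply: gy; [rewrite ltrNr|rewrite lerN2].
Qed.

Section level_intervals.
Context {R : realType} (a : \bar R) (F W : R -> R) (C : R).

(** The interval with its finite ends added: a level interval may start at 0 and may end at a finite
    [a], so the primitives are evaluated there too. *)
Definition cdom : set R := [set t | 0 <= t /\ (t%:E <= a)%E].

Hypothesis F_nd : forall s t, cdom s -> cdom t -> s <= t -> F s <= F t.
Hypothesis W_inc : forall s t, cdom s -> cdom t -> s < t -> W s < W t.
Hypothesis F_cont : cont_on cdom F.
Hypothesis W_cont : cont_on cdom W.
Hypothesis F0 : F 0 = 0.
Hypothesis W0 : W 0 = 0.
Hypothesis C_ge0 : 0 <= C.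
Hypothesis growth : forall t, cdom t -> F t <= C * (1 + W t).

(** A chord of the curve [(W, F)] has slope at least [c] exactly when [tilt c] does not decrease
    from its left to its right end. *)
Definition tilt (c t : R) := F t - c * W t.

Lemma W_nd s t : cdom s -> cdom t -> s <= t -> W s <= W t.
Proof.
move=> Ds Dt; rewrite le_eqVlt => /predU1P[->//|st].
exact/ltW/W_inc.
Qed.

Lemma tilt_cont c : cont_on cdom (tilt c).
Proof.
move=> x Dx e e0.
have e1 : 0 < e / 2 by rewrite divr_gt0.
have e2 : 0 < e / (2 * (`|c| + 1)) by rewrite divr_gt0// mulr_gt0// ltr_wpDl.
have [d1 d10 H1] := F_cont Dx e1.
have [d2 d20 H2] := W_cont Dx e2.
exists (Num.min d1 d2); first by rewrite lt_min d10.
move=> y Dy; rewrite lt_min => /andP[/(H1 _ Dy) {}H1 /(H2 _ Dy) {}H2].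
rewrite /tilt (_ : _ - _ - _ = (F y - F x) - c * (W y - W x)); last by ring.
rewrite (le_lt_trans (ler_normB _ _))// [ltRHS]splitr ltr_leD//.
rewrite normrM (le_trans (ler_wpM2l _ (ltW H2)))//.
have c1 : 0 < `|c| + 1 by rewrite ltr_wpDl.
rewrite (_ : `|c| * _ = (e / 2) * (`|c| / (`|c| + 1))); last by field; rewrite gt_eqF.
by rewrite ler_piMr ?(ltW e1)// ler_pdivrMr// mul1r lerDl.
Qed.

Lemma tilt_le c c' s t : cdom s -> cdom t -> s <= t -> c' <= c ->
  tilt c s <= tilt c t -> tilt c' s <= tilt c' t.
Proof.
rewrite /tilt => Ds Dt st cc.
have : 0 <= (c - c') * (W t - W s) by rewrite mulr_ge0// subr_ge0// W_nd.
lra.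
Qed.

Lemma tilt_lt c c' s t : cdom s -> cdom t -> s < t -> c' < c ->
  tilt c s <= tilt c t -> tilt c' s < tilt c' t.
Proof.
rewrite /tilt => Ds Dt st cc.
have : 0 < (c - c') * (W t - W s) by rewrite mulr_gt0// subr_gt0// W_inc.
lra.
Qed.

(* The last condition says that the slopes of chords from [t] have upper limit at
   least [c] at the end [b], which covers [b = +oo] and finite [b] alike. *)
Definition is_level (al : R) (b : \bar R) (c : R) :=
  [/\ 0 <= al, (al%:E < b)%E, (b <= a)%E & 0 < c] /\
  (forall t, al < t -> (t%:E < b)%E -> tilt c t <= tilt c al) /\
  (forall t c' T, al <= t -> (t%:E < b)%E -> c' < c -> (T%:E < b)%E ->
     exists t', [/\ t < t', T < t', (t'%:E < b)%E & tilt c' t <= tilt c' t']).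

Lemma lt_cdom al (b : \bar R) t : 0 <= al -> al <= t -> (t%:E < b)%E ->
  (b <= a)%E -> cdom t.
Proof.
by move=> al0 alt tb ba; split; [exact: le_trans alt|exact/ltW/(lt_le_trans tb)].
Qed.

Lemma between_EFin (al : R) (b : \bar R) : (al%:E < b)%E ->
  exists2 t : R, al < t & (t%:E < b)%E.
Proof.
case: b => [b||]//.
  rewrite lte_fin => ab; exists ((al + b) / 2); first by rewrite midf_lt.
  by rewrite lte_fin midf_lt.
by move=> _; exists (al + 1); rewrite ?ltrDl// ltry.
Qed.

Lemma EFin_between (x y : R) (b : \bar R) : (x%:E < b)%E -> (b <= y%:E)%E ->
  exists b' : R, b = b'%:E.
Proof. by case: b => [b||]//; exists b. Qed.

Lemma max_lt_EFin (s t : R) (b : \bar R) :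
  (s%:E < b)%E -> (t%:E < b)%E -> ((Num.max s t)%:E < b)%E.
Proof. by rewrite /Num.max; case: ifP. Qed.

(* The slope of a level interval is the supremum of the slopes of the chords
   from its left end. *)
Lemma is_level_criterion al (b : \bar R) :
  0 <= al -> (al%:E < b)%E -> (b <= a)%E ->
  (exists t, [/\ al < t, (t%:E < b)%E & F al < F t]) ->
  (forall t c T, al < t -> (t%:E < b)%E -> tilt c al < tilt c t ->
     (T%:E < b)%E ->
     exists t', [/\ t < t', T < t', (t'%:E < b)%E & tilt c t <= tilt c t']) ->
  exists c, is_level al b c.
Proof.
move=> al0 alb ba [t0 [alt0 t0b Ft0]] Q.
have Dal : cdom al by exact: (lt_cdom al0 _ alb).
have D t : al < t -> (t%:E < b)%E -> cdom t.
  by move=> alt tb; apply: (lt_cdom al0 (ltW alt) tb).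
pose E := [set c | exists t, [/\ al < t, (t%:E < b)%E & tilt c al < tilt c t]].
have Wt0 : W al < W t0 by apply: W_inc => //; exact: D.
pose c0 := (F t0 - F al) / (W t0 - W al) / 2.
have c0_gt0 : 0 < c0 by rewrite !divr_gt0// subr_gt0.
have Ec0 : E c0.
  exists t0; split => //; rewrite /tilt.
  have : c0 * (W t0 - W al) = (F t0 - F al) / 2.
    by rewrite /c0; field; rewrite gt_eqF// subr_gt0.
  lra.
have hE : has_sup E.
  split; first by exists c0.
  (* No chord slope exceeds this bound: by [Q] the rise at rate [c] is still present at some [t']
     past the fixed point [t0], and there it contradicts [growth] as soon as
     [(c - C) * (W t0 - W al)] exceeds [C * (1 + W al)]. *)
  exists (C + C * (1 + W al) / (W t0 - W al)) => c [t [alt tb ct]].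
  have [t' [tt' t0t' t'b ct']] := Q t c t0 alt tb ct t0b.
  rewrite leNgt; apply/negP => cbig.
  have Dt' : cdom t' by apply: D => //; exact: lt_trans tt'.
  have Wt' : W t0 - W al < W t' - W al by rewrite ltrD2r W_inc//; exact: D.
  have WD : 0 < W t0 - W al by rewrite subr_gt0.
  have D0 : cdom 0.
    by split => //; rewrite (le_trans _ (ltW (lt_le_trans alb ba)))// lee_fin.
  have Fal : 0 <= F al by rewrite -F0 F_nd.
  have Wal : 0 <= C * (1 + W al).
    by rewrite mulr_ge0// addr_ge0// -W0 W_nd.
  move: cbig; rewrite -ltrBrDl ltr_pdivrMr// => cbig.
  have cC : 0 < c - C.
    by rewrite -(pmulr_lgt0 _ WD) (le_lt_trans Wal).
  have : (c - C) * (W t0 - W al) <= (c - C) * (W t' - W al).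
    by rewrite ler_wpM2l// ltW.
  move: ct ct' cbig (growth Dt'); rewrite /tilt; lra.
pose c := sup E.
have cub c' : E c' -> c' <= c by move=> Ec'; apply: sup_upper_bound.
exists c; split; [split => //|split].
- exact: lt_le_trans (cub _ Ec0).
- move=> t alt tb; rewrite leNgt; apply/negP => ct.
  have Dt := D _ alt tb.
  have Wt : 0 < W t - W al by rewrite subr_gt0 W_inc.
  (* Half of the excess slope, so that the chord to [t] still rises at the rate [c + e]. *)
  pose e := (tilt c t - tilt c al) / (2 * (W t - W al)).
  have e0 : 0 < e by rewrite divr_gt0 ?subr_gt0// mulr_gt0.
  have : E (c + e).
    exists t; split => //; rewrite /tilt.
    have : e * (W t - W al) = (tilt c t - tilt c al) / 2.
      by rewrite /e; field; rewrite gt_eqF.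
    move: ct; rewrite /tilt; lra.
  by move/cub; rewrite gerDl leNgt e0.
- move=> t c' T alt tb cc' Tb.
  have [c'' [s [als sb cs]] cc''] : exists2 c'', E c'' & c' < c''.
    have /sup_adherent-/(_ _ hE)[c'' Ec'' +] : 0 < c - c' by rewrite subr_gt0.
    by rewrite subKr; exists c''.
  have Dt : cdom t by apply: (lt_cdom al0 alt tb).
  have [t' [tt' Tt' t'b ct']] : exists t',
      [/\ t < t', T < t', (t'%:E < b)%E & tilt c'' t <= tilt c'' t'].
    have [ct|ct] := ltP (tilt c'' al) (tilt c'' t).
      apply: Q => //; rewrite lt_neqAle alt andbT.
      by apply: contraTneq ct => ->; rewrite ltxx.
    have [t' [st' + t'b ct']] := Q _ _ _ als sb cs (max_lt_EFin tb Tb).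
    rewrite gt_max => /andP[tt' Tt']; exists t'; split => //.
    by rewrite (le_trans ct)// (le_trans (ltW cs)).
  exists t'; split => //; apply: tilt_le ct' => //; [|exact: ltW..].
  by apply: D => //; exact: le_lt_trans tt'.
Qed.

(** Necessarily [c1 <= c2]: otherwise the first interval would contain a chord from [al2] steeper
    than [c2], which the second one forbids. A rise from [al1] is therefore continued inside the
    first interval past [al2], and from there inside the second. *)
Lemma is_level_overlap al1 b1 c1 al2 b2 c2 :
  is_level al1 b1 c1 -> is_level al2 b2 c2 -> al1 <= al2 -> (al2%:E < b1)%E ->
  (b1 <= b2)%E -> exists c, is_level al1 b2 c.
Proof.
move=> [[al10 alb1 b1a c10] [U1 L1]] [[al20 alb2 b2a c20] [U2 L2]] al12 al2b1 b12.
have D1 t : al1 <= t -> (t%:E < b2)%E -> cdom t.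
  by move=> alt tb; exact: (lt_cdom al10 alt tb).
have D1' t : al1 <= t -> (t%:E < b1)%E -> cdom t.
  by move=> alt tb; apply: D1 => //; exact: lt_le_trans b12.
have c12 : c1 <= c2.
  rewrite leNgt; apply/negP => c21.
  have [c /andP[c2c cc1]] : exists c, c2 < c < c1.
    by exists ((c2 + c1) / 2); rewrite !midf_lt.
  have [t' [al2t' _ t'b ct']] := L1 _ _ _ al12 al2b1 cc1 al2b1.
  have Dt' : cdom t' by apply: D1' => //; exact: le_trans (ltW al2t').
  have := tilt_lt (D1' _ al12 al2b1) Dt' al2t' c2c ct'.
  by rewrite ltNge U2// (lt_le_trans t'b).
apply: is_level_criterion => //.
- exact: lt_le_trans b12.
- have c12' : c1 / 2 < c1 by rewrite ltr_pdivrMr// ltr_pMr// ltr1n.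
  have [t' [al1t' _ t'b ct']] := L1 _ _ _ (lexx _) alb1 c12' alb1.
  exists t'; split => //; first exact: lt_le_trans b12.
  have : 0 < c1 / 2 * (W t' - W al1).
    by rewrite mulr_gt0 ?divr_gt0// subr_gt0 W_inc//; apply: D1' => //; exact: ltW.
  by move: ct'; rewrite /tilt; lra.
- move=> t c T alt tb ct Tb.
  have [tb1|tb1] := ltP (t%:E) b1.
    have cc1 : c < c1.
      rewrite ltNge; apply/negP => c1c.
      have := U1 _ alt tb1; rewrite leNgt => /negP; apply.
      have Dt := D1 _ (ltW alt) tb; have Dal := D1' _ (lexx _) alb1.
      have : 0 <= (c - c1) * (W t - W al1).
        by rewrite mulr_ge0// subr_ge0// W_nd// ltW.
      by move: ct; rewrite /tilt; lra.
    have [t1 [tt1 al2t1 t1b ct1]] := L1 _ _ _ (ltW alt) tb1 cc1 al2b1.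
    have [t' [t1t' Tt' t'b ct']] := L2 _ _ _ (ltW al2t1) (lt_le_trans t1b b12)
      (lt_le_trans cc1 c12) Tb.
    exists t'; split => //; first exact: lt_trans t1t'.
    exact: le_trans ct'.
  have al2t : al2 < t by rewrite -lte_fin (lt_le_trans al2b1).
  have cc2 : c < c2.
    rewrite ltNge; apply/negP => c2c.
    have Dt := D1 _ (ltW alt) tb; have Dal := D1' _ (lexx _) alb1.
    have Dal2 := D1' _ al12 al2b1.
    have := U2 _ al2t tb.
    have : 0 <= (c - c2) * (W t - W al2).
      by rewrite mulr_ge0// ?subr_ge0// W_nd// ltW.
    have : tilt c1 al2 <= tilt c1 al1.
      by move: al12; rewrite le_eqVlt => /predU1P[->//|al12]; exact: U1.
    have : 0 <= (c - c1) * (W al2 - W al1).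
      by rewrite mulr_ge0// ?subr_ge0 ?(le_trans c12)// W_nd.
    by move: ct; rewrite /tilt; lra.
  exact: L2 (ltW al2t) tb cc2 Tb.
Qed.

(** At a finite end the limsup clause comes from continuity: for [c' < c] the value of [tilt c'] at
    [b] strictly exceeds that at [t], hence so do its values just before [b]. *)
Lemma is_level_point al (b : R) c : 0 <= al -> al < b -> (b%:E <= a)%E ->
  0 < c -> tilt c b = tilt c al ->
  (forall t, al < t -> t < b -> tilt c t <= tilt c al) -> is_level al b%:E c.
Proof.
move=> al0 alb ba c0 cb U.
have Db : cdom b by split => //; exact: (le_trans al0 (ltW alb)).
have D t : al <= t -> t < b -> cdom t.
  by move=> alt tb; apply: (lt_cdom al0 alt _ ba).
split; [by rewrite lte_fin|split => //].
move=> t c' T alt; rewrite !lte_fin => tb cc' Tb.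
have ct : tilt c t <= tilt c b.
  by rewrite cb; move: alt; rewrite le_eqVlt => /predU1P[->//|alt]; exact: U.
have := tilt_lt (D _ alt tb) Db tb cc' ct; rewrite -subr_gt0 => e0.
have [d d0 Hd] := tilt_cont c' Db e0.
have [t' + t'b] : exists2 t', Num.max (Num.max t T) (b - d) < t' & t' < b.
  exists ((Num.max (Num.max t T) (b - d) + b) / 2); rewrite midf_lt//.
    by rewrite !gt_max tb Tb ltrBlDr ltrDl.
  by rewrite !gt_max tb Tb ltrBlDr ltrDl.
rewrite !gt_max => /andP[/andP[tt' Tt'] bdt'].
exists t'; split => //.
have /Hd/(_ (left_ball bdt' t'b)) : cdom t'.
  by apply: D => //; exact: (le_trans alt (ltW tt')).
by rewrite ltr_norml => /andP[+ _]; lra.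
Qed.

(** Converse of [is_level_point] at the right end: each of the two clauses of [is_level] gives one
    inequality in the limit at [b]. *)
Lemma is_level_tilt al (b : R) c : is_level al b%:E c -> tilt c b = tilt c al.
Proof.
move=> [[al0 alb ba c0] [U L]]; rewrite lte_fin in alb.
have Db : cdom b by split => //; exact: (le_trans al0 (ltW alb)).
have D t : al <= t -> t < b -> cdom t.
  by move=> alt tb; apply: (lt_cdom al0 alt _ ba).
apply/eqP; rewrite eq_le; apply/andP; split; apply/ler_addgt0Pr => e e0.
  have [d d0 Hd] := tilt_cont c Db e0.
  pose t' := Num.max ((al + b) / 2) (b - d / 2).
  have t'b : t' < b by rewrite gt_max midf_lt//= ltrBlDr ltrDl divr_gt0.
  have alt' : al < t' by rewrite lt_max midf_lt.
  have bdt' : b - d < t'.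
    by rewrite lt_max ltrD2l ltrN2 ltr_pdivrMr// ltr_pMr// ltr1n orbT.
  have /Hd/(_ (left_ball bdt' t'b)) : cdom t' by apply: D => //; exact: ltW.
  have := U _ alt' t'b.
  by rewrite ltr_norml => + /andP[+ _]; lra.
have Dal := D _ (lexx _) alb.
have WD : 0 < W b - W al by rewrite subr_gt0 W_inc.
(* Lowering the slope by this amount costs [e / 2] over the whole interval; continuity of [tilt c]
   at [b] uses the other half. *)
pose c' := c - e / (2 * (W b - W al)).
have cc' : c' < c by rewrite ltrBlDr ltrDl divr_gt0// mulr_gt0.
have e2 : 0 < e / 2 by rewrite divr_gt0.
have [d d0 Hd] := tilt_cont c Db e2.
have [|t' [alt' bdt' t'b ct']] := L al c' (b - d) (lexx _) alb cc' _.
  by rewrite lte_fin ltrBlDr ltrDl.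
rewrite lte_fin in t'b.
have Dt' : cdom t' by apply: D => //; exact: (ltW alt').
have := Hd _ Dt' (left_ball bdt' t'b).
have : (c - c') * (W b - W al) = e / 2.
  by rewrite /c'; field; rewrite gt_eqF.
have : 0 <= (c - c') * (W b - W t').
  by rewrite mulr_ge0// subr_ge0 ?W_nd// ltW.
rewrite ltr_norml => + + /andP[_].
by move: ct'; rewrite /tilt; lra.
Unshelve. all: by [].
Qed.

Lemma is_level_uniq al b c c' : is_level al b c -> is_level al b c' -> c = c'.
Proof.
wlog cc' : c c' / c' < c.
  move=> H Hc Hc'; have [cc'|cc'|//] := ltgtP c c'; last exact: H.
  by apply/esym/H.
move=> [[al0 alb ba _] [_ L]] [_ [U _]]; exfalso.
have [c'' /andP[cc'' c''c]] : exists c'', c' < c'' < c.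
  by exists ((c' + c) / 2); rewrite !midf_lt.
have [t [alt _ tb ct]] := L _ _ _ (lexx _) alb c''c alb.
have Dt := lt_cdom al0 (ltW alt) tb ba.
have := tilt_lt (lt_cdom al0 (lexx _) alb ba) Dt alt cc'' ct.
by rewrite ltNge U.
Qed.

(** * Maximal level intervals and uncovered points *)

Definition max_level al b c := is_level al b c /\
  forall al' b' c', is_level al' b' c' -> al' <= al -> (b <= b')%E ->
    al' = al /\ b' = b.

Lemma is_level_join t al1 b1 c1 al2 b2 c2 :
  is_level al1 b1 c1 -> al1 < t -> (t%:E < b1)%E ->
  is_level al2 b2 c2 -> al2 < t -> (t%:E < b2)%E ->
  exists c, is_level (Num.min al1 al2) (maxe b1 b2) c.
Proof.
move=> l1 alt1 tb1 l2 alt2 tb2.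
have [al12|al21] := leP al1 al2; have [b12|b21] := leP b1 b2.
- apply: is_level_overlap l1 l2 al12 _ b12.
  by rewrite (lt_trans _ tb1)// lte_fin.
- by exists c1.
- by exists c2.
- apply: is_level_overlap l2 l1 (ltW al21) _ (ltW b21).
  by rewrite (lt_trans _ tb2)// lte_fin.
Qed.

(** The candidate is the union of all level intervals containing [t]. Its ends are an infimum and a
    supremum that need not be attained, so the criterion is verified for it: by continuity a rise
    from [al0] to [s] is also a rise from the left end of an actual level interval, close to [al0],
    whose right end lies beyond [s] and [T]. *)
Lemma max_level_exists t al b c : is_level al b c -> al < t -> (t%:E < b)%E ->
  exists al' b' c', [/\ max_level al' b' c', al' < t & (t%:E < b')%E].
Proof.
move=> l alt tb.
pose A := [set x | exists b c, [/\ is_level x b c, x < t & (t%:E < b)%E]].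
pose B := [set y | exists x c, [/\ is_level x y c, x < t & (t%:E < y)%E]].
have Aal : A al by exists b, c.
have Bb : B b by exists al, c.
have hA : has_inf A by split; [exists al|exists 0 => x [? [? [[[]]]]]].
pose al0 := inf A; pose b0 := ereal_sup B.
have al0al : al0 <= al by exact: ge_inf hA.2 _ Aal.
have al0_ge0 : 0 <= al0.
  by apply: lb_le_inf; [exists al|move=> x [? [? [[[]]]]]].
have bb0 : (b <= b0)%E by exact: ereal_sup_ubound.
have tb0 : (t%:E < b0)%E by exact: lt_le_trans bb0.
have al0t : al0 < t by exact: le_lt_trans alt.
have b0a : (b0 <= a)%E by apply: ge_ereal_sup => y [? [? [[[]]]]].
have al0b0 : (al0%:E < b0)%E by rewrite (lt_trans _ tb0)// lte_fin.
have AB x y : A x -> (y < b0)%E -> exists x' b' c',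
    [/\ is_level x' b' c', x' <= x, (y < b')%E, al0 <= x' & (b' <= b0)%E].
  move=> [bx [cx [lx xt tbx]]] /ereal_sup_gt[y' [xy [cy [ly xyt ty']]] yy'].
  have [c' lc'] := is_level_join lx xt tbx ly xyt ty'.
  have xm : Num.min x xy < t by rewrite gt_min xt.
  have tm : (t%:E < maxe bx y')%E by rewrite lt_max tbx.
  exists (Num.min x xy), (maxe bx y'), c'; split => //.
  - by rewrite ge_min lexx.
  - by rewrite lt_max yy' orbT.
  - by apply: ge_inf hA.2 _ _; exists (maxe bx y'), c'.
  - by apply: ereal_sup_ubound; exists (Num.min x xy), c'.
have [c0 l0] : exists c0, is_level al0 b0 c0.
  apply: is_level_criterion => //.
    have [[al_ge0 alb ba c0] [_ L]] := l.
    have c2 : c / 2 < c by rewrite ltr_pdivrMr// ltr_pMr// ltr1n.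
    have [t' [alt' _ t'b ct']] := L _ _ _ (lexx _) alb c2 alb.
    exists t'; split; [exact: le_lt_trans alt'|exact: lt_le_trans bb0|].
    have Dal := lt_cdom al_ge0 (lexx _) alb ba.
    have Dt' := lt_cdom al_ge0 (ltW alt') t'b ba.
    have : F al0 <= F al.
      by apply: F_nd => //; exact: lt_cdom al0_ge0 (lexx _) al0b0 b0a.
    have : 0 < c / 2 * (W t' - W al).
      by rewrite mulr_gt0 ?divr_gt0// subr_gt0 W_inc.
    by move: ct'; rewrite /tilt; lra.
  move=> s c' T al0s sb0 c's Tb0.
  have Dal0 : cdom al0 by exact: lt_cdom al0_ge0 (lexx _) al0b0 b0a.
  have : 0 < tilt c' s - tilt c' al0 by rewrite subr_gt0.
  move=> /(tilt_cont c' Dal0)[d d0 Hd].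
  have [x Ax] : exists2 x, A x & x < Num.min s (al0 + d).
    by apply: inf_lt; [exact: hA.1|rewrite -/al0 lt_min al0s ltrDl].
  rewrite lt_min => /andP[xs xd].
  have [x' [b' [c'' [l' x'x mb' al0x' b'b0]]]] :=
    AB x (Num.max s T)%:E Ax (max_lt_EFin sb0 Tb0).
  have [sb' Tb'] : (s%:E < b')%E /\ (T%:E < b')%E.
    by split; rewrite (le_lt_trans _ mb')// lee_fin le_max lexx ?orbT.
  have x's : x' < s by exact: le_lt_trans xs.
  have [[x'0 x'b' b'a c''0] [U L]] := l'.
  have Dx' := lt_cdom x'0 (lexx _) x'b' b'a.
  have Ds := lt_cdom x'0 (ltW x's) sb' b'a.
  have x'd : `|x' - al0| < d.
    by rewrite ger0_norm ?subr_ge0// ltrBlDl (le_lt_trans x'x).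
  have := Hd _ Dx' x'd; rewrite ltr_norml => /andP[_]; rewrite ltrD2r => c'x's.
  have c'c'' : c' < c''.
    rewrite ltNge; apply/negP => c''c'.
    have : 0 <= (c' - c'') * (W s - W x').
      by rewrite mulr_ge0// subr_ge0// W_nd// ltW.
    by have := U _ x's sb'; move: c'x's; rewrite /tilt; lra.
  have [t' [st' Tt' t'b' ct']] := L _ _ _ (ltW x's) sb' c'c'' Tb'.
  by exists t'; split => //; exact: lt_le_trans b'b0.
exists al0, b0, c0; split => //; split => // al' b' c' l' al'0 b0b'.
have al't : al' < t by exact: le_lt_trans al0t.
have tb' : (t%:E < b')%E by exact: lt_le_trans b0b'.
split; apply/eqP; rewrite eq_le ?al'0 ?b0b' ?andbT/=.
  by apply: ge_inf hA.2 _ _; exists b', c'.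
by apply: ereal_sup_ubound; exists al', c'.
Qed.

Definition covers (p : R * \bar R * R) (t : R) :=
  [/\ max_level p.1.1 p.1.2 p.2, p.1.1 < t & (t%:E < p.1.2)%E].

Definition uncovered t := forall p, ~ covers p t.

Lemma covers_uniq p q t : covers p t -> covers q t -> p = q.
Proof.
move: p q => [[al b] c] [[al' b'] c'] [/= [l m] alt tb] [/= [l' m'] al't tb'].
have [cj lj] := is_level_join l alt tb l' al't tb'.
have [] := m _ _ _ lj; [by rewrite ge_min lexx|by rewrite le_max lexx|].
have [] := m' _ _ _ lj; [by rewrite ge_min lexx orbT|by rewrite le_max lexx orbT|].
move=> -> -> e1 e2; rewrite e1 e2 in l' *.
by rewrite (is_level_uniq l l').
Qed.

(** A level interval containing the left end would overlap this one, and their union would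
    contradict maximality. *)
Lemma max_level_left p t : covers p t -> uncovered p.1.1.
Proof.
move: p => [[al b] c] [/= [l m] alt tb] [[al' b'] c'] [/= [l' m'] al'al alb'].
have [[al0 alb ba _] _] := l; have [[al'0 al'b' b'a _] _] := l'.
have [b'b|bb'] := leP b' b.
  have [c'' l''] := is_level_overlap l' l (ltW al'al) alb' b'b.
  by have [e _] := m _ _ _ l'' (ltW al'al) (lexx _); rewrite e ltxx in al'al.
by have [e _] := m _ _ _ l' (ltW al'al) (ltW bb'); rewrite e ltxx in al'al.
Qed.

Lemma max_level_right al b c t : covers (al, b%:E, c) t -> uncovered b.
Proof.
move=> [/= [l m] alt tb] [[al' b'] c'] [/= [l' m'] al'b bb'].
have [alal'|al'al] := leP al al'.
  have [c'' l''] := is_level_overlap l l' alal' al'b (ltW bb').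
  by have [_ e] := m _ _ _ l'' (lexx _) (ltW bb'); rewrite e ltxx in bb'.
by have [_ e] := m _ _ _ l' (ltW al'al) (ltW bb'); rewrite e ltxx in bb'.
Qed.

(** An uncovered point lies below no chord of the curve [(W, F)]. If [tilt c] had a strict dip at
    [t], the last point before [t] and the first point after [t] where it equals the smaller of its
    values at [s] and [r] would bound a level interval around [t]. *)
Lemma uncovered_tilt t s r c : uncovered t -> cdom s -> cdom r ->
  s < t -> t < r -> tilt c s <= tilt c t \/ tilt c r <= tilt c t.
Proof.
move=> Ut Ds Dr st tr; apply/orP; rewrite -[_ || _]negbK negb_or -!ltNge.
apply/negP => /andP[cs cr].
have D x : s <= x -> x <= r -> cdom x.
  move=> sx xr; split; first exact: le_trans Ds.1 sx.
  by rewrite (le_trans _ Dr.2)// lee_fin.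
have c0 : 0 < c.
  rewrite ltNge; apply/negP => c0.
  have Dt : cdom t by apply: D; exact: ltW.
  have : 0 <= - c * (W t - W s) by rewrite mulr_ge0 ?oppr_ge0// subr_ge0 W_nd// ltW.
  by have := F_nd Ds Dt (ltW st); move: cs; rewrite /tilt; lra.
pose m := Num.min (tilt c s) (tilt c r).
have tm : tilt c t < m by rewrite lt_min cs.
have [||||al /andP[sal alt] [mal Hal]] := @cont_last_ge _ _ _ s t m (tilt_cont c).
- by move=> x sx xt; apply: D => //; exact: le_trans (ltW tr).
- by rewrite ge_min lexx.
- exact: tm.
- exact: ltW.
have [||||be /andP[tbe ber] [mbe Hbe]] := @cont_first_ge _ _ _ t r m (tilt_cont c).
- by move=> x tx xr; apply: D => //; exact: le_trans (ltW st) tx.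
- exact: tm.
- by rewrite ge_min lexx orbT.
- exact: ltW.
have l : is_level al be%:E c.
  apply: is_level_point => //.
  - exact: le_trans Ds.1 sal.
  - exact: lt_trans tbe.
  - by rewrite (le_trans _ Dr.2)// lee_fin.
  - by rewrite mal.
  - move=> x alx xbe; rewrite mal ltW//.
    by have [xt|tx] := leP x t; [exact: Hal|apply: Hbe => //; exact: ltW].
have [al' [b' [c' [ml al't tb']]]] := max_level_exists l alt tbe.
by apply: (Ut (al', b', c')).
Qed.

(** Concavity along uncovered points: if a line of slope [c] through the curve at [x] dominates it
    to the right, so does the parallel line through any later uncovered point. *)
Lemma uncovered_tilt_right p x c r : uncovered p -> cdom x -> cdom r ->
  x <= p -> p < r -> (forall y, cdom y -> x < y -> tilt c y <= tilt c x) ->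
  tilt c r <= tilt c p.
Proof.
move=> Up Dx Dr; rewrite le_eqVlt => /predU1P[<- xr H|xp pr H]; first exact: H.
have [xp'|//] := uncovered_tilt c Up Dx Dr xp pr.
by apply: le_trans xp'; apply: H => //; exact: lt_trans pr.
Qed.

(** The left side is [F^0 - c W] at [T], where [F^0] is the primitive of the level function. It does
    not decrease towards [b] because [c <= cc], and near [b] the curve of [F] returns arbitrarily
    close to the line of slope [cc], where [B] bounds it. *)
Lemma level_tilt_bound al b cc c T B : is_level al b cc -> al <= T ->
  (T%:E < b)%E -> c <= cc ->
  (forall t, 0 <= t -> (t%:E < a)%E -> tilt c t <= B) ->
  F al + cc * (W T - W al) - c * W T <= B.
Proof.
move=> [[al0 alb ba cc0] [U L]] alT Tb ccc HB.
have [cE|cneq] := eqVneq c cc.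
  rewrite cE in HB *.
  rewrite (_ : _ + _ - _ = tilt cc al); last by rewrite /tilt; ring.
  by apply: HB => //; exact: lt_le_trans ba.
have {cneq} ccc' : c < cc by rewrite lt_neqAle cneq.
have DT := lt_cdom al0 alT Tb ba; have Dal := lt_cdom al0 (lexx _) alb ba.
apply/ler_addgt0Pr => e e0.
have WT : 0 <= W T - W al by rewrite subr_ge0 W_nd.
(* Close enough to [cc] that replacing [cc] by [c'] costs at most [e] up to [T]; the summand 1
   avoids a zero denominator when [T = al]. *)
pose c' := Num.max c (cc - e / (W T - W al + 1)).
have D0 : 0 < W T - W al + 1 by rewrite ltr_wpDl.
have c'cc : c' < cc by rewrite gt_max ccc' ltrBlDr ltrDl divr_gt0.
have [t' [alt' Tt' t'b ct']] := L _ _ _ (lexx _) alb c'cc Tb.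
have Dt' := lt_cdom al0 (ltW alt') t'b ba.
have /HB-/(_ (lt_le_trans t'b ba)) : 0 <= t' by exact: Dt'.1.
have : 0 <= (c' - c) * (W t' - W T).
  by rewrite mulr_ge0// subr_ge0 ?le_max ?lexx// W_nd// ltW.
have : (cc - c') * (W T - W al) <= e.
  rewrite (@le_trans _ _ (e / (W T - W al + 1) * (W T - W al)))//.
    by rewrite ler_wpM2r// lerBlDl -lerBlDr le_max lexx orbT.
  by rewrite mulrAC ler_pdivrMr// ler_wpM2l ?(ltW e0)// lerDl.
by move: ct'; rewrite /tilt; lra.
Qed.

(** * Decreasing densities: slope and weight of the level function *)

Section densities.
Variables (fr wr : R -> R).
Hypothesis fr_ge0 : forall t, itv0 a t -> 0 <= fr t.
Hypothesis fr_anti : decreasing_on a fr.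
Hypothesis wr_gt0 : positive_on a wr.
Hypothesis wr_anti : decreasing_on a wr.
Hypothesis F_lo : forall s t, 0 <= s -> s < t -> itv0 a t ->
  fr t * (t - s) <= F t - F s.
Hypothesis F_hi : forall s t, itv0 a s -> s < t -> cdom t ->
  F t - F s <= fr s * (t - s).
Hypothesis W_lo : forall s t, 0 <= s -> s < t -> itv0 a t ->
  wr t * (t - s) <= W t - W s.
Hypothesis W_hi : forall s t, itv0 a s -> s < t -> cdom t ->
  W t - W s <= wr s * (t - s).

Lemma itv0_cdom t : itv0 a t -> cdom t.
Proof. by move=> [t0 ta]; split; exact: ltW. Qed.

Lemma fr_gt0_covered p t : covers p t -> 0 < fr t.
Proof.
move: p => [[al b] c] [/= [[[al0 alb ba c0] [U L]] _] alt tb].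
have c2 : c / 2 < c by rewrite ltr_pdivrMr// ltr_pMr// ltr1n.
have [t' [tt' _ t'b ct']] := L _ _ _ (ltW alt) tb c2 tb.
have It : itv0 a t by split; [exact: le_lt_trans alt|exact: lt_le_trans ba].
have Dt' := lt_cdom al0 (ltW (lt_trans alt tt')) t'b ba.
rewrite -(@pmulr_lgt0 _ (t' - t)) ?subr_gt0//.
apply: lt_le_trans (F_hi It tt' Dt').
have : 0 < c / 2 * (W t' - W t).
  by rewrite mulr_gt0 ?divr_gt0// subr_gt0 W_inc//; exact: itv0_cdom.
by move: ct'; rewrite /tilt; lra.
Qed.

Definition level_slope (t : R) : R :=
  match pselect (exists p, covers p t) with
  | left ex => (projT1 (cid ex)).2
  | right _ => fr t / wr t
  end.

Definition level_weight (t : R) : R :=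
  match pselect (exists p, covers p t) with
  | left ex => fr t / (projT1 (cid ex)).2
  | right _ => wr t
  end.

Lemma level_slope_covered p t : covers p t -> level_slope t = p.2.
Proof.
rewrite /level_slope; case: pselect => [ex pt|nex pt]; last by case: nex; exists p.
by case: cid => q qt /=; rewrite (covers_uniq qt pt).
Qed.

Lemma level_slope_uncovered t : uncovered t -> level_slope t = fr t / wr t.
Proof. by rewrite /level_slope; case: pselect => // -[p pt] /(_ p). Qed.

Lemma level_weight_covered p t : covers p t -> level_weight t = fr t / p.2.
Proof.
rewrite /level_weight; case: pselect => [ex pt|nex pt]; last by case: nex; exists p.
by case: cid => q qt /=; rewrite (covers_uniq qt pt).
Qed.

Lemma level_weight_uncovered t : uncovered t -> level_weight t = wr t.
Proof. by rewrite /level_weight; case: pselect => // -[p pt] /(_ p). Qed.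

Lemma covered_or t : (exists p, covers p t) \/ uncovered t.
Proof.
by have [|H] := pselect (exists p, covers p t); [left|right=> p pt; apply: H; exists p].
Qed.

Lemma level_slope_ge0 t : itv0 a t -> 0 <= level_slope t.
Proof.
move=> It; have [[p pt]|Ut] := covered_or t.
  rewrite (level_slope_covered pt).
  by move: p pt => [[al b] c] [/= [[[_ _ _ /ltW]]]].
by rewrite level_slope_uncovered// divr_ge0 ?fr_ge0// ltW// wr_gt0// inE.
Qed.

Lemma level_weight_gt0 : positive_on a level_weight.
Proof.
move=> t; rewrite inE => It; have [[p pt]|Ut] := covered_or t.
  rewrite (level_weight_covered pt) divr_gt0//; first exact: fr_gt0_covered pt.
  by move: p pt => [[al b] c] [/= [[[_ _ _]]]].
by rewrite level_weight_uncovered// wr_gt0// inE.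
Qed.

Lemma level_slopeM t : itv0 a t -> level_slope t * level_weight t = fr t.
Proof.
move=> It; have [[p pt]|Ut] := covered_or t.
  rewrite (level_slope_covered pt) (level_weight_covered pt) mulrC divfK// gt_eqF//.
  by move: p pt => [[al b] c] [/= [[[_ _ _]]]].
rewrite level_slope_uncovered// level_weight_uncovered// divfK// gt_eqF//.
by rewrite wr_gt0// inE.
Qed.

(** Since [tilt c] at [t] is at most its common value at [al] and [b], from [t] to [b] the gain of
    [F] is at least [c] times the gain of [W]; [F_hi] and [W_lo] turn this into
    [c * wr b <= fr t]. *)
Lemma level_weight_ge p t x : covers p t -> itv0 a x -> (p.1.2 <= x%:E)%E ->
  wr x <= level_weight t.
Proof.
move=> pt Ix bx; rewrite (level_weight_covered pt).
move: p pt bx => [[al b] c] [/= [l _] alt tb] /= bx.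
have [[al0 alb ba c0] [U L]] := l.
have It : itv0 a t by split; [exact: le_lt_trans alt|exact: lt_le_trans ba].
have [b' ?] := EFin_between tb bx; subst b; rename b' into b.
rewrite lte_fin in tb; rewrite lee_fin in bx.
have Ib : itv0 a b.
  split; first exact: (lt_trans It.1).
  by apply: le_lt_trans Ix.2; rewrite lee_fin.
rewrite ler_pdivlMr// (@le_trans _ _ (wr b * c))//.
  by rewrite ler_wpM2r ?(ltW c0)// wr_anti ?inE.
have := U _ alt; rewrite lte_fin => /(_ tb); rewrite -(is_level_tilt l).
have : c * (wr b * (b - t)) <= c * (W b - W t).
  by rewrite ler_wpM2l ?(ltW c0)// W_lo// ltW// It.1.
have := F_hi It tb (itv0_cdom Ib); rewrite /tilt => h1 h2 h3.
rewrite -(@ler_pM2r _ (b - t)) ?subr_gt0//; lra.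
Qed.

(** The mirror image at the left end: from [al] to [t] the gain of [F] is at most [c] times the gain
    of [W]. *)
Lemma level_weight_le p t x : covers p t -> itv0 a x -> x <= p.1.1 ->
  level_weight t <= wr x.
Proof.
move=> pt Ix xal; rewrite (level_weight_covered pt).
move: p pt xal => [[al b] c] [/= [l _] alt tb] /= xal.
have [[al0 alb ba c0] [U L]] := l.
have It : itv0 a t by split; [exact: le_lt_trans alt|exact: lt_le_trans ba].
have Ial : itv0 a al.
  by split; [exact: lt_le_trans Ix.1 xal|exact: lt_le_trans ba].
rewrite ler_pdivrMr// (@le_trans _ _ (wr al * c))//; last first.
  by rewrite ler_wpM2r ?(ltW c0)// wr_anti ?inE.
have := U _ alt tb.
have : c * (W t - W al) <= c * (wr al * (t - al)).
  by rewrite ler_wpM2l ?(ltW c0)// W_hi//; exact: itv0_cdom.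
have := F_lo al0 alt It; rewrite /tilt => h1 h2 h3.
rewrite -(@ler_pM2r _ (t - al)) ?subr_gt0//; lra.
Qed.

(** Inside one level interval the weight is a multiple of [fr]. Points of two different level
    intervals are compared through [wr] at the right end of the first, which is uncovered. *)
Lemma level_weight_anti : decreasing_on a level_weight.
Proof.
move=> t t'; rewrite !inE => It It'; rewrite le_eqVlt => /predU1P[->//|tt'].
have [[p pt]|Ut] := covered_or t; last first.
  have [[q qt']|Ut'] := covered_or t'; last first.
    by rewrite !level_weight_uncovered// wr_anti ?inE// ltW.
  rewrite [leRHS]level_weight_uncovered//; apply: (level_weight_le qt' It).
  rewrite leNgt; apply/negP => qt; apply: (Ut q).
  by case: qt' => ml _ t'q; split => //; rewrite (lt_trans _ t'q)// lte_fin.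
have [pt'|t'p] := leP (p.1.2) (t'%:E); last first.
  have pt' : covers p t'.
    by case: pt => ml pt _; split => //; exact: lt_trans tt'.
  rewrite (level_weight_covered pt) (level_weight_covered pt') ler_wpM2r//.
    rewrite invr_ge0; move: p pt {t'p pt'} => [[al b] c] [/= [[[_ _ _ /ltW]]]]//.
  by rewrite fr_anti ?inE// ltW.
have [[q qt']|Ut'] := covered_or t'; last first.
  by rewrite [leLHS]level_weight_uncovered//; exact: level_weight_ge pt It' _.
have [ml pt1 tp] := pt.
have [b E] := EFin_between tp pt'.
move: pt' tp; rewrite E lee_fin lte_fin => bt' tb.
have Ib : itv0 a b.
  split; first exact: lt_trans It.1 tb.
  by apply: le_lt_trans It'.2; rewrite lee_fin.
have qb : b <= q.1.1.
  rewrite leNgt; apply/negP => qb.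
  have Ub : uncovered b.
    by move: p pt E {ml pt1} => [[al b'] c] /= pt E; rewrite E in pt; exact: max_level_right pt.
  by apply: (Ub q); case: qt' => mq _ t'q; split => //; apply: le_lt_trans t'q; rewrite lee_fin.
apply: le_trans (level_weight_le qt' Ib qb) _.
by apply: level_weight_ge pt Ib _; rewrite E.
Qed.

(** For a decreasing [fr] this is continuity at [t]. [F_hi] and [F_lo] bound increments by values of
    [fr] at neighbouring points, and this condition brings them back to the value at [t]. *)
Definition fr_cont_at (t : R) := forall e, 0 < e ->
  (exists s, [/\ itv0 a s, s < t & fr s < fr t + e]) /\
  (exists r, [/\ itv0 a r, t < r & fr t - e < fr r]).

(** The tangent at an uncovered point dominates the curve to its right: if [r] were above it,
    [uncovered_tilt] with a slightly larger slope would apply to every [s < t], and would force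
    [fr s >= fr t + e * wr t] arbitrarily close to [t]. *)
Lemma tilt_right_uncovered t r : itv0 a t -> fr_cont_at t -> uncovered t ->
  cdom r -> t < r -> tilt (fr t / wr t) r <= tilt (fr t / wr t) t.
Proof.
move=> It ct Ut Dr tr; set c := fr t / wr t.
have wt : 0 < wr t by rewrite wr_gt0 ?inE.
have Dt := itv0_cdom It.
have WD : 0 < W r - W t by rewrite subr_gt0 W_inc.
rewrite leNgt; apply/negP => ctr.
pose e := (tilt c r - tilt c t) / (2 * (W r - W t)).
have e0 : 0 < e by rewrite divr_gt0 ?subr_gt0// mulr_gt0.
have ctr1 : tilt (c + e) t < tilt (c + e) r.
  rewrite /tilt.
  have : e * (W r - W t) = (tilt c r - tilt c t) / 2.
    by rewrite /e; field; rewrite gt_eqF.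
  by move: ctr; rewrite /tilt; lra.
have [[s [Is st fs]] _] := ct (e * wr t) (mulr_gt0 e0 wt).
have Ds := itv0_cdom Is.
have [st1|] := uncovered_tilt (c + e) Ut Ds Dr st tr; last by rewrite leNgt ctr1.
have c_ge0 : 0 <= c + e by rewrite addr_ge0 ?(ltW e0)// divr_ge0 ?fr_ge0// ltW.
have : (c + e) * (wr t * (t - s)) <= (c + e) * (W t - W s).
  by rewrite ler_wpM2l// W_lo// ltW// Is.1.
have := F_hi Is st Dt; move: st1; rewrite /tilt => h1 h2 h3.
have : (c + e) * wr t <= fr s.
  by rewrite -(@ler_pM2r _ (t - s)) ?subr_gt0//; lra.
by rewrite mulrDl /c divfK ?gt_eqF// leNgt fs.
Qed.

Lemma tilt_right_slope t p r : itv0 a t -> fr_cont_at t -> uncovered p ->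
  t <= p -> cdom r -> p < r ->
  tilt (level_slope t) r <= tilt (level_slope t) p.
Proof.
move=> It ct Up tp Dr pr.
have [[[[al b] c] qt]|Ut] := covered_or t; last first.
  rewrite level_slope_uncovered//.
  apply: (uncovered_tilt_right Up (itv0_cdom It)) => // y Dy ty.
  exact: tilt_right_uncovered.
rewrite (level_slope_covered qt)/=.
have [/= [l _] alt tb] := qt.
have bp : (b <= p%:E)%E.
  rewrite leNgt; apply/negP => pb; apply: (Up (al, b, c)).
  by case: qt => ml _ _; split => //=; exact: lt_le_trans tp.
have [b' ?] := EFin_between tb bp; subst b; rename b' into b.
rewrite lte_fin in tb; rewrite lee_fin in bp.
have Ub := max_level_right qt.
have [[al0 alb ba c0] _] := l; rewrite lte_fin in alb.
have Dal : cdom al by apply: lt_cdom al0 (lexx _) _ ba; rewrite lte_fin.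
have Db : cdom b by split => //; rewrite (le_trans al0)// ltW.
apply: (uncovered_tilt_right Up Db) => // y Dy by_.
rewrite leNgt; apply/negP => cby.
have WD : 0 < W y - W b by rewrite subr_gt0 W_inc.
pose e := (tilt c y - tilt c b) / (2 * (W y - W b)).
have e0 : 0 < e by rewrite divr_gt0 ?subr_gt0// mulr_gt0.
have [|] := uncovered_tilt (c + e) Ub Dal Dy alb by_.
  have : 0 < e * (W b - W al) by rewrite mulr_gt0// subr_gt0 W_inc.
  by have := is_level_tilt l; rewrite /tilt; lra.
have : e * (W y - W b) = (tilt c y - tilt c b) / 2.
  by rewrite /e; field; rewrite gt_eqF.
by move: cby; rewrite /tilt; lra.
Qed.

(** A level interval steeper than [c] would contain a chord from its left end rising faster than
    [c], against the line at that end, which is uncovered. At an uncovered point, [fr] is compared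
    with a chord to a point just to the right. *)
Lemma level_slope_le p t c : uncovered p -> cdom p -> p <= t -> itv0 a t ->
  fr_cont_at t -> 0 <= c ->
  (forall r, cdom r -> p < r -> tilt c r <= tilt c p) -> level_slope t <= c.
Proof.
move=> Up Dp pt It ct c0 Hc.
have [[[[al b] c'] qt]|Ut] := covered_or t.
  rewrite (level_slope_covered qt)/= leNgt; apply/negP => cc'.
  have [/= [l _] alt tb] := qt; have [[al0 alb ba c'0] [U L]] := l.
  have pal : p <= al.
    rewrite leNgt; apply/negP => alp; apply: (Up (al, b, c')).
    by case: qt => ml _ _; split => //=; rewrite (le_lt_trans _ tb)// lee_fin.
  have Dal := lt_cdom al0 (lexx _) alb ba.
  have [c1 /andP[cc1 c1c']] : exists c1, c < c1 < c'.
    by exists ((c + c') / 2); rewrite !midf_lt.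
  have [r [alr _ rb cr]] := L _ _ _ (lexx _) alb c1c' alb.
  have Dr := lt_cdom al0 (ltW alr) rb ba.
  have := tilt_lt Dal Dr alr cc1 cr; rewrite ltNge => /negP; apply.
  exact: (uncovered_tilt_right (max_level_left qt) Dp Dr pal alr).
rewrite level_slope_uncovered//.
have wt : 0 < wr t by rewrite wr_gt0 ?inE.
rewrite ler_pdivrMr//; apply/ler_addgt0Pr => e e0.
have [_ [r [Ir tr fr']]] := ct e e0.
have Dr := itv0_cdom Ir.
have := uncovered_tilt_right Ut Dp Dr pt tr Hc.
have : c * (W r - W t) <= c * (wr t * (r - t)).
  by rewrite ler_wpM2l// W_hi.
have := F_lo (ltW It.1) tr Ir; rewrite /tilt => h1 h2 h3.
have : fr r <= c * wr t.
  by rewrite -(@ler_pM2r _ (r - t)) ?subr_gt0//; lra.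
by move: fr'; lra.
Qed.

(** Unless both points lie in one level interval, an uncovered [p] separates them: [t] itself or the
    right end of the interval covering [t]. The line of slope [level_slope t] at [p] dominates what
    follows. *)
Lemma level_slope_anti t t' : itv0 a t -> itv0 a t' -> fr_cont_at t ->
  fr_cont_at t' -> t <= t' -> level_slope t' <= level_slope t.
Proof.
move=> It It' ct ct'; rewrite le_eqVlt => /predU1P[->//|tt'].
have [[p [Up Dp tp pt']]|] : (exists p, [/\ uncovered p, cdom p, t <= p & p <= t']) \/
    level_slope t' = level_slope t; last by move=> ->.
  have [[q qt]|Ut] := covered_or t; last first.
    by left; exists t; split => //; [exact: itv0_cdom|exact: ltW].
  have [qt'|t'q] := leP (q.1.2) (t'%:E); last first.
    right; rewrite (level_slope_covered qt) (@level_slope_covered q)//.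
    by case: qt => ml qt _; split => //; exact: lt_trans tt'.
  left; move: q qt qt' => [[al b] c] qt /= bt'.
  have [/= [[[al0 alb ba _] _] _] alt tb] := qt.
  have [b' ?] := EFin_between tb bt'; subst b; rename b' into b.
  exists b; rewrite lte_fin in tb; rewrite lte_fin in alb.
  split => //; [exact: max_level_right qt| |exact: ltW].
  by split => //; rewrite (le_trans al0)// ltW.
apply: (level_slope_le Up Dp pt' It' ct' (level_slope_ge0 It)) => r Dr pr.
exact: tilt_right_slope.
Qed.

End densities.
End level_intervals.

Local Open Scope ereal_scope.
Local Notation distribution := Defs.distribution.

(** * Lebesgue measure on intervals *)

Section lebesgue_basics.
Context {R : realType}.
Local Notation T := (lebesgue_type R).
Implicit Types (a b : \bar R) (A B D : set R).

Lemma measurable_leb A : measurable (A : set (measurableTypeR R)) ->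
  measurable (A : set T).
Proof. exact: sub_caratheodory. Qed.

Lemma lebE A : leb (A : set T) = lebesgue_measure (A : set R).
Proof. by []. Qed.

Lemma measurable_itv_leb (i : interval R) : measurable ([set` i] : set T).
Proof. by apply: measurable_leb; exact: measurable_itv. Qed.

Lemma measurable_is_interval A : is_interval A -> measurable (A : set T).
Proof. by move=> iA; apply: measurable_leb; exact: is_interval_measurable. Qed.

Lemma is_interval_itv0 a : is_interval (itv0 a).
Proof.
move=> x y [x0 xa] [y0 ya] z /andP[xz zy]; split; first exact: lt_le_trans xz.
by apply: le_lt_trans ya; rewrite lee_fin.
Qed.

Lemma measurable_itv0 a : measurable (itv0 a : set T).
Proof. exact/measurable_is_interval/is_interval_itv0. Qed.

Lemma leb_itvoo (x y : R) : (x <= y)%R -> leb (`]x, y[%classic : set T) = (y - x)%:E.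
Proof.
rewrite le_eqVlt lebE lebesgue_measure_itv/= => /predU1P[->|xy].
  by rewrite lte_fin ltxx subrr.
by rewrite lte_fin xy.
Qed.

Lemma itv0_fin (x : R) : itv0 x%:E = `]0%R, x[%classic.
Proof.
apply/seteqP; split=> y; rewrite /itv0/= in_itv/= lte_fin; first by case=> -> ->.
by move=> /andP[].
Qed.

Lemma itv0_pinfty : itv0 +oo = `]0%R, +oo[%classic :> set R.
Proof.
apply/seteqP; split=> y; rewrite /itv0/= in_itv/= ltry; first by case=> ->.
by move=> /andP[]; split.
Qed.

Lemma leb_itv0 a : 0 <= a -> leb (itv0 a : set T) = a.
Proof.
case: a => [x||]//; rewrite ?lee_fin => x0.
  by rewrite itv0_fin leb_itvoo// subr0.
by rewrite itv0_pinfty lebE lebesgue_measure_itv/= ltry.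
Qed.

Lemma leb_set1 (x : R) : leb ([set x] : set T) = 0.
Proof. by rewrite lebE lebesgue_measure_set1. Qed.

Lemma leb_countable A : countable A -> leb (A : set T) = 0.
Proof. by move=> cA; rewrite lebE countable_lebesgue_measure0. Qed.

Lemma measurable_countable A : countable A -> measurable (A : set T).
Proof. by move=> cA; apply: measurable_leb; exact: countable_measurable. Qed.

Lemma le_leb A B : A `<=` B -> leb (A : set T) <= leb (B : set T).
Proof. by move=> AB; rewrite !lebE; exact: le_outer_measure. Qed.

Lemma itv0_le a b : a <= b -> itv0 a `<=` itv0 b.
Proof. by move=> ab x [x0 xa]; split => //; exact: lt_le_trans ab. Qed.

Lemma itv0_between a : 0 < a -> exists x, itv0 a x.
Proof.
case: a => [x||]//; rewrite ?lte_fin => x0.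
  by exists (x / 2)%R; split; [rewrite divr_gt0|rewrite lte_fin ltr_pdivrMr// ltr_pMr// ltr1n].
by exists 1%R; split => //; rewrite ltry.
Qed.

Lemma emeasurable_fun_gt d (X : measurableType d) (D : set X) (f : X -> \bar R) :
  (forall s : \bar R, measurable (D `&` [set x | s < f x])) -> measurable_fun D f.
Proof.
move=> H mD; apply: (measurability _ (ErealGenOInfty.measurableE R)) => //.
move=> _ [_ [s ->] <-]; rewrite [X in measurable X](_ : _ = D `&` [set x | s%:E < f x])//.
by apply/seteqP; split => x /= [Dx]; rewrite in_itv/= andbT.
Qed.

Definition edecreasing_on a (k : R -> \bar R) :=
  forall x y, itv0 a x -> itv0 a y -> (x <= y)%R -> k y <= k x.

Lemma measurable_edecreasing a k : edecreasing_on a k ->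
  measurable_fun (itv0 a : set T) (k : T -> \bar R).
Proof.
move=> dk; apply: emeasurable_fun_gt => s; apply: measurable_is_interval.
move=> x y [Ix kx] [Iy ky] z /andP[xz zy].
have Iz : itv0 a z by apply: is_interval_itv0 Ix Iy _ _; rewrite xz.
by split => //=; apply: lt_le_trans ky _; exact: dk.
Qed.

Lemma measurable_decreasing a (k : R -> R) : decreasing_on a k ->
  measurable_fun (itv0 a : set T) (k : T -> R).
Proof.
move=> dk; apply/measurable_EFinP/measurable_edecreasing => x y Ix Iy xy /=.
by rewrite lee_fin dk// inE.
Qed.

Lemma measurable_enondecreasing (c : \bar R -> \bar R) :
  (forall x y, x <= y -> c x <= c y) -> measurable_fun setT c.
Proof.
move=> ndc; apply: emeasurable_fun_gt => s; rewrite setTI.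
set U := (X in measurable X); pose y := ereal_inf U.
have up x z : U x -> x <= z -> U z by move=> Ux xz; exact: lt_le_trans (ndc _ _ xz).
have [Uy|NUy] := pselect (U y).
  rewrite (_ : U = `[y, +oo[%classic); first exact: emeasurable_itv.
  apply/seteqP; split => x /=; rewrite in_itv/= andbT; first exact: ereal_inf_lbound.
  exact: up.
rewrite (_ : U = `]y, +oo[%classic); first exact: emeasurable_itv.
apply/seteqP; split => x /=; rewrite in_itv/= andbT.
  move=> Ux; rewrite lt_neqAle ereal_inf_lbound// andbT.
  by apply: contra_notN NUy => /eqP ->.
by move=> /ereal_inf_lt[z Uz zx]; apply: up Uz (ltW zx).
Qed.

End lebesgue_basics.

(** * Staircase approximation by finitely many thresholds *)

Section staircase.
Context {R : realType}.

(* A lower approximation of [x] by a sum of indicators [s < x], which therefore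
   commutes with decreasing rearrangement. *)
Definition stair (n : nat) (x : \bar R) : R :=
  (n.+1%:R^-1 * \sum_(i < n.+1 ^ 2) ((i.+1%:R / n.+1%:R)%:E < x)%E%:R)%R.

Lemma stair_ge0 n x : (0 <= stair n x)%R.
Proof. by rewrite mulr_ge0// sumr_ge0// => i _; rewrite ler0n. Qed.

Lemma stair0 n : stair n 0 = 0%R.
Proof.
rewrite /stair big1 ?mulr0// => i _.
by rewrite lte_fin ltNge divr_ge0.
Qed.

(** Stated for any predicate [P] that forces thresholds to be at most [x], because [realize_stair]
    counts memberships in sets with it. *)
Lemma count_thresholds_le (N : nat) (m x : R) (P : nat -> bool) :
  (0 < m)%R -> (0 <= x)%R -> (forall i, P i -> i.+1%:R / m <= x)%R ->
  (\sum_(i < N) (P i)%:R <= m * x :> R)%R.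
Proof.
move=> m0 x0 Px; elim: N => [|N IH]; first by rewrite big_ord0 mulr_ge0// ltW.
rewrite big_ord_recr/=; have [/Px Nx|_] := boolP (P N); last by rewrite addr0.
rewrite (@le_trans _ _ N.+1%:R)//; last first.
  by rewrite mulrC -ler_pdivrMr.
rewrite -(natr1 N) lerD2r (le_trans (ler_sum _ (G := fun=> 1%R) _))//.
  by move=> i _; rewrite lern1 leq_b1.
by rewrite sumr_const card_ord.
Qed.

Lemma count_ge (N j : nat) (P : nat -> bool) : (j <= N)%N ->
  (forall i, (i < j)%N -> P i) -> (j%:R <= \sum_(i < N) (P i)%:R :> R)%R.
Proof.
elim: N j => [|N IH] j.
  by rewrite leqn0 big_ord0 => /eqP ->.
rewrite big_ord_recr leq_eqVlt => /predU1P[-> HP|jN HP]; last first.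
  by apply: le_trans (IH _ jN HP) _; rewrite lerDl ler0n.
rewrite HP// -natr1 lerD2r; apply: IH => // i iN; apply: HP; exact: ltnW.
Qed.

Lemma count_thresholds_ge (N : nat) (m x : R) : (0 < m)%R ->
  (Num.min N%:R (m * x - 1) <= \sum_(i < N) ((i.+1%:R / m) < x)%R%:R :> R)%R.
Proof.
move=> m0; elim: N => [|N IH]; first by rewrite big_ord0 ge_min lexx.
rewrite big_ord_recr/=; have [Nx|] := boolP (_ < _)%R; last first.
  rewrite -leNgt ler_pdivlMr// addr0 => Nx; apply: le_trans IH.
  rewrite le_min !ge_min lexx orbT andbT; apply/orP; right.
  by move: Nx; rewrite -natr1; lra.
move: Nx; rewrite ltr_pdivrMr// => Nx.
have : (N%:R <= Num.min N%:R (m * x - 1))%R.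
  by rewrite le_min lexx/=; move: Nx; rewrite -natr1; lra.
by move=> /le_trans/(_ IH) h; rewrite ge_min -natr1 lerD2r h.
Qed.

Lemma stair_le n x : 0 <= x -> (stair n x)%:E <= x.
Proof.
case: x => [x||]//; rewrite ?leey// lee_fin => x0.
rewrite lee_fin /stair ler_pdivrMl ?ltr0n//.
under eq_bigr do rewrite lte_fin.
by apply: (@count_thresholds_le _ _ _ (fun i => (i.+1%:R / n.+1%:R < x)%R)) => // i /ltW.
Qed.

Lemma stair_cvg x : 0 <= x -> (stair n x)%:E @[n --> \oo] --> x.
Proof.
case: x => [x||]// x0; last first.
  rewrite (_ : (fun _ => _) = fun n : nat => (n.+1%:R : R)%:E); last first.
    apply/funext => n; congr EFin; rewrite /stair.
    under eq_bigr do rewrite ltry.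
    rewrite sumr_const card_ord natrX expr2 mulrA.
    by rewrite mulVf ?mul1r// pnatr_eq0.
  apply/cvgeyPge => A; near=> n; rewrite lee_fin.
  rewrite (@le_trans _ _ n%:R)// ?ler_nat//; near: n; exact: nbhs_infty_ger.
apply/cvg_EFin; first by apply: nearW.
apply/cvgrPdist_le => /= e e0; near=> n.
rewrite lee_fin in x0.
have h1 : (stair n x%:E <= x)%R by rewrite -lee_fin stair_le.
have n0 : (0 < n.+1%:R :> R)%R by rewrite ltr0n.
have := count_thresholds_ge (n.+1 ^ 2) x n0.
set S := (X in (_ <= X)%R -> _) => h2.
have -> : stair n x%:E = (n.+1%:R^-1 * S)%R.
  by rewrite /stair; under eq_bigr do rewrite lte_fin.
have h3 : (n.+1%:R * x - 1 <= S)%R.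
  apply: le_trans h2; rewrite le_min lexx andbT natrX expr2.
  rewrite (@le_trans _ _ (n.+1%:R * x))%R// ?gerBl// ler_pM2l// -natr1.
  rewrite (@le_trans _ _ n%:R)// ?lerDl//; near: n; exact: nbhs_infty_ger.
have h4 : (x - n.+1%:R^-1 <= n.+1%:R^-1 * S)%R.
  by rewrite -(@ler_pM2l _ n.+1%:R)// mulrA mulfV ?gt_eqF// mul1r mulrBr mulfV ?gt_eqF.
have h5 : (n.+1%:R^-1 * S <= x)%R.
  by move: h1; rewrite /stair; under eq_bigr do rewrite lte_fin.
rewrite ger0_norm ?subr_ge0// lerBlDl -lerBlDr (le_trans _ h4)// lerD2l lerN2.
near: n; apply: filterS (near_infty_natSinv_lt (PosNum e0)) => n; exact: ltW.
Unshelve. all: by end_near. Qed.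

End staircase.

Section stair_integral.
Context d (T : measurableType d) {R : realType} (mu : {measure set T -> \bar R}).
Variables (D : set T) (mD : measurable D).
Implicit Types p k : T -> \bar R.

Lemma measurable_gt_indicator (s : \bar R) k : measurable_fun D k ->
  measurable_fun D (fun x => ((s < k x)%E%:R : R)%:E).
Proof.
pose c (y : \bar R) := ((s < y)%E%:R : R)%:E.
apply: (@measurableT_comp _ _ _ _ _ _ c); apply: measurable_enondecreasing.
move=> x y xy; rewrite lee_fin ler_nat; case: ltP => // sx.
by rewrite (lt_le_trans sx xy).
Qed.

Lemma measurable_stair k n : measurable_fun D k ->
  measurable_fun D (fun x => (stair n (k x))%:E).
Proof.
pose c (y : \bar R) := (stair n y)%:E.
apply: (@measurableT_comp _ _ _ _ _ _ c); apply: measurable_enondecreasing.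
move=> x y xy; rewrite lee_fin ler_wpM2l//; apply: ler_sum => i _.
by rewrite ler_nat; case: ltP => // sx; rewrite (lt_le_trans sx xy).
Qed.

(** A discrete layer-cake formula: it turns inequalities between integrals into inequalities on
    superlevel sets without a product measure. *)
Lemma integral_mul_stair p k n : measurable_fun D p ->
  (forall x, D x -> 0 <= p x) -> measurable_fun D k ->
  \int[mu]_(x in D) (p x * (stair n (k x))%:E) =
  (n.+1%:R^-1)%:E * \sum_(i < n.+1 ^ 2)
     \int[mu]_(x in D `&` [set x | (i.+1%:R / n.+1%:R)%:E < k x]) p x.
Proof.
move=> mp p0 mk.
pose h (i : 'I_(n.+1 ^ 2)) x := p x * (((i.+1%:R / n.+1%:R)%:E < k x)%E%:R : R)%:E.
have mh i : measurable_fun D (h i).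
  by apply: emeasurable_funM => //; exact: measurable_gt_indicator.
have h0 i x : D x -> 0 <= h i x by move=> Dx; rewrite mule_ge0// ?p0// lee_fin.
transitivity (\int[mu]_(x in D) ((n.+1%:R^-1)%:E * \sum_(i < n.+1 ^ 2) h i x)).
  apply: eq_integral => x _; rewrite /stair EFinM muleCA; congr (_ * _).
  by rewrite -sumEFin ge0_sume_distrr.
rewrite ge0_integralZl_EFin//; last 2 first.
  by move=> x Dx; apply: sume_ge0 => i _; exact: h0.
  exact: emeasurable_sum.
rewrite ge0_integral_sum//; congr (_ * _); apply: eq_bigr => i _.
rewrite integral_mkcondr; apply: eq_integral => x _; rewrite patchE /h.
case: ifPn => [|/negP]; rewrite inE/=; first by move=> ->; rewrite mule1.
by move=> /negP/negbTE ->; rewrite mule0.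
Qed.

End stair_integral.

Section limits.
Context {R : realType}.

Lemma limn_einf_le (u : (\bar R)^nat) B : (forall n, u n <= B) -> limn_einf u <= B.
Proof.
move=> uB; rewrite limn_einf_lim; apply: lime_le; first exact: is_cvg_einfs.
by apply: nearW => n; apply: le_trans (uB n); apply: ereal_inf_lbound; exists n => /=.
Qed.

(** The zero cases are separate because multiplication is not continuous at the pair of 0 and [+oo],
    where the product is 0. *)
Lemma mule_stair_cvg (p k : \bar R) : 0 <= p -> 0 <= k ->
  p * (stair n k)%:E @[n --> \oo] --> p * k.
Proof.
move=> p0 k0.
have [->|k_neq0] := eqVneq k 0.
  by under eq_fun do rewrite stair0; rewrite mule0; exact: cvg_cst.
have [->|p_neq0] := eqVneq p 0.
  by under eq_fun do rewrite mul0e; rewrite mul0e; exact: cvg_cst.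
apply: cvgeM; [|exact: cvg_cst|exact: stair_cvg].
by apply: neq0_mule_def; rewrite mule_eq0 negb_or p_neq0.
Qed.

Lemma stairM_cvg (x y : \bar R) : 0 <= x -> 0 <= y ->
  (stair n x)%:E * (stair n y)%:E @[n --> \oo] --> x * y.
Proof.
move=> x0 y0.
have [->|x_neq0] := eqVneq x 0.
  by under eq_fun do rewrite stair0 mul0e; rewrite mul0e; exact: cvg_cst.
have [->|y_neq0] := eqVneq y 0.
  by under eq_fun do rewrite stair0 mule0; rewrite mule0; exact: cvg_cst.
apply: cvgeM; [|exact: stair_cvg..].
by apply: neq0_mule_def; rewrite mule_eq0 negb_or x_neq0.
Qed.

(** Fatou's lemma is the limit theorem used for staircases because [stair n x] is not monotone in
    [n]. *)
Lemma fatou_le d (T : measurableType d) (mu : {measure set T -> \bar R})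
    (D : set T) (f : (T -> \bar R)^nat) (g : T -> \bar R) B :
  measurable D -> (forall n, measurable_fun D (f n)) ->
  (forall n x, D x -> 0 <= f n x) ->
  (forall x, D x -> f n x @[n --> \oo] --> g x) ->
  (forall n, \int[mu]_(x in D) f n x <= B) -> \int[mu]_(x in D) g x <= B.
Proof.
move=> mD mf f0 fg fB.
rewrite (eq_integral (fun x => limn_einf (f^~ x))); last first.
  by move=> x; rewrite inE => Dx; rewrite (cvg_limn_einf_sup (fg x Dx)).1.
by apply: le_trans (fatou mu mD mf f0) _; exact: limn_einf_le.
Qed.

End limits.

(** * Exhaustion of the interval from the left *)

Section exhaustion.
Context {R : realType} (a : \bar R).
Hypothesis a_gt0 : 0 < a.
Local Notation T := (lebesgue_type R).

Definition itv0_seq (n : nat) : R :=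
  if a is r%:E then (r * (1 - n.+2%:R^-1))%R else n.+1%:R.

Lemma itv0_seq_in n : itv0 a (itv0_seq n).
Proof.
rewrite /itv0_seq; case: a a_gt0 => [r||]//= r0; split; rewrite ?ltr0n ?ltry//.
  by rewrite lte_fin in r0; rewrite mulr_gt0// subr_gt0 invf_lt1// ltr1n.
by rewrite lte_fin in r0; rewrite lte_fin gtr_pMr// gtrBl invr_gt0.
Qed.

Lemma itv0_seq_nd m n : (m <= n)%N -> (itv0_seq m <= itv0_seq n)%R.
Proof.
move=> mn; rewrite /itv0_seq; case: a a_gt0 => [r||]//= r0; last by rewrite ler_nat.
rewrite lte_fin in r0.
by rewrite ler_wpM2l ?(ltW r0)// lerD2l lerN2 lef_pV2 ?posrE// ler_nat.
Qed.

Lemma itv0_seq_ex x : itv0 a x -> exists n, (x < itv0_seq n)%R.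
Proof.
move=> [x0 xa]; rewrite /itv0_seq; case: a a_gt0 xa => [r||]//= r0; last first.
  by move=> _; exists (Num.Def.trunc x); rewrite truncnS_gt.
rewrite !lte_fin in r0 * => xr; exists (Num.Def.trunc ((1 - x / r)^-1)).
have h : (0 < 1 - x / r)%R by rewrite subr_gt0 ltr_pdivrMr// mul1r.
have : ((Num.Def.trunc ((1 - x / r)^-1)).+2%:R^-1 < 1 - x / r)%R.
  rewrite -[ltRHS]invrK ltf_pV2 ?posrE ?invr_gt0//.
  by rewrite (lt_trans (truncnS_gt _))// ltr_nat.
by rewrite ltrBrDl -ltrBrDr ltr_pdivrMr// mulrC.
Qed.

Lemma bigcup_itv0_seq : itv0 a = \bigcup_n `]0%R, itv0_seq n[%classic.
Proof.
apply/seteqP; split=> [x Ix|x [n _]/=].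
  have [n xn] := itv0_seq_ex Ix; exists n => //=.
  by rewrite in_itv/= Ix.1 xn.
rewrite in_itv/= => /andP[x0 xn]; split => //.
by rewrite (lt_trans _ (itv0_seq_in n).2)// lte_fin.
Qed.

Lemma itvoo_sub_itv0 (x y : R) : (0 <= x)%R -> y%:E <= a -> `]x, y[ `<=` itv0 a.
Proof.
move=> x0 ya z /=; rewrite in_itv/= => /andP[xz zy]; split.
  exact: le_lt_trans xz.
by apply: lt_le_trans ya; rewrite lte_fin.
Qed.

Lemma integral_itv0_cvg (p : R -> \bar R) :
  measurable_fun (itv0 a : set T) (p : T -> \bar R) ->
  (forall x, itv0 a x -> 0 <= p x) ->
  \int[leb]_(x in `]0%R, itv0_seq n[) p x @[n --> \oo] --> \int[leb]_(x in itv0 a) p x.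
Proof.
move=> mp p0; rewrite bigcup_itv0_seq.
have sub n : `]0%R, itv0_seq n[%classic `<=` itv0 a.
  by apply: itvoo_sub_itv0 => //; apply/ltW; exact: (itv0_seq_in n).2.
apply: ge0_nondecreasing_set_cvg_integral.
- move=> m n mn; apply/subsetPset => x /=; rewrite !in_itv/= => /andP[-> /=].
  by move=> /lt_le_trans; apply; exact: itv0_seq_nd.
- by move=> n; exact: measurable_itv_leb.
- by move=> n; apply: measurable_funS mp => //; exact: measurable_itv0.
- by move=> n x /sub; exact: p0.
Qed.

Lemma integral_itv0_le (p : R -> \bar R) B :
  measurable_fun (itv0 a : set T) (p : T -> \bar R) ->
  (forall x, itv0 a x -> 0 <= p x) ->
  (forall x, itv0 a x -> \int[leb]_(y in `]0%R, x[) p y <= B) ->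
  \int[leb]_(x in itv0 a) p x <= B.
Proof.
move=> mp p0 pB; apply: (cvge_to_le (integral_itv0_cvg mp p0)).
by apply: nearW => n; apply: pB; exact: itv0_seq_in.
Qed.

End exhaustion.

(** * Decreasing rearrangements *)

Section rearrangement.
Context {R : realType} (a : \bar R).
Local Notation T := (lebesgue_type R).
Implicit Types f g k : R -> \bar R.

Lemma distribution_anti f (s s' : R) : (s <= s')%R ->
  distribution a f s' <= distribution a f s.
Proof.
move=> ss'; apply: le_leb => x [Ix fx]; split => //.
by apply: le_lt_trans fx; rewrite lee_fin.
Qed.

Lemma rearr_ge0 f t : 0 <= rearr a f t.
Proof. by apply: le_ereal_inf_tmp => _ [s [s0 _] <-]; rewrite lee_fin. Qed.

Lemma rearr_anti f (x y : R) : (x <= y)%R -> rearr a f y <= rearr a f x.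
Proof.
move=> xy; apply: ereal_inf_le_tmp => _ [s [s0 fs] <-]; exists s => //; split => //.
by apply: le_trans fs _; rewrite lee_fin.
Qed.

Lemma rearr_edecreasing f : edecreasing_on a (rearr a f).
Proof. by move=> x y _ _; exact: rearr_anti. Qed.

Lemma measurable_rearr f :
  measurable_fun (itv0 a : set T) (rearr a f : T -> \bar R).
Proof. exact/measurable_edecreasing/rearr_edecreasing. Qed.

Lemma distribution_le f (s t : R) : (0 <= s)%R -> distribution a f s <= t%:E ->
  rearr a f t <= s%:E.
Proof. by move=> s0 fs; apply: ereal_inf_lbound; exists s. Qed.

Lemma measurable_superlevel f (s : \bar R) : measurable_fun (itv0 a : set T) (f : T -> \bar R) ->
  measurable ([set x | itv0 a x /\ s < `|f x|] : set T).
Proof.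
move=> mf; have := emeasurable_fun_o_infty (measurable_itv0 a) (measurableT_comp (@abse_measurable R _) mf) s.
by congr measurable.
Qed.

(** The Galois connection between the rearrangement and the distribution function. The nontrivial
    direction is right continuity of the latter, that is, continuity from below of the measure along
    the sets where [f] exceeds [s + 1 / (n + 1)] in absolute value. *)
Lemma rearr_le f (s t : R) : measurable_fun (itv0 a : set T) (f : T -> \bar R) ->
  (0 <= s)%R -> (rearr a f t <= s%:E) = (distribution a f s <= t%:E).
Proof.
move=> mf s0; apply/idP/idP; last exact: distribution_le.
move=> fts.
pose A (n : nat) : set R := [set x | itv0 a x /\ (s + n.+1%:R^-1)%:E < `|f x|].
have dA n : leb (A n : set T) <= t%:E.
  have : rearr a f t < (s + n.+1%:R^-1)%:E.
    by apply: le_lt_trans fts _; rewrite lte_fin ltrDl invr_gt0.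
  move=> /ereal_inf_lt[_ [s' [s'0 ds'] <-]]; rewrite lte_fin => s'n.
  by apply: le_trans ds'; apply: distribution_anti; exact: ltW.
have UA : [set x | itv0 a x /\ s%:E < `|f x|] = \bigcup_n A n.
  apply/seteqP; split => [x [Ix sf]|x [n _ [Ix nf]]]; last first.
    by split => //; apply: le_lt_trans nf; rewrite lee_fin lerDl.
  have [y sy yf] := between_EFin sf.
  have [n sn] : exists n, (s + n.+1%:R^-1 < y)%R.
    have ys : (0 < y - s)%R by rewrite subr_gt0.
    have [n _ /(_ n (leqnn n))] := near_infty_natSinv_lt (PosNum ys).
    by exists n; rewrite -ltrBrDl.
  by exists n => //; split => //; apply: lt_trans yf; rewrite lte_fin.
have : leb (A n : set T) @[n --> \oo] --> distribution a f s.
  rewrite /distribution UA; apply: nondecreasing_cvg_mu.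
  - by move=> n; exact: measurable_superlevel.
  - by apply: bigcup_measurable => n _; exact: measurable_superlevel.
  - move=> m n mn; apply/subsetPset => x [Ix fx]; split => //.
    by apply: le_lt_trans fx; rewrite lee_fin lerD2l lef_pV2 ?posrE// ler_nat.
by move=> /cvge_to_le; apply; exact: nearW.
Qed.

Lemma distribution_le_itv f s : 0 <= a -> distribution a f s <= a.
Proof. by move=> a0; rewrite -[leRHS]leb_itv0//; apply: le_leb => x []. Qed.

Lemma superlevel_rearr f (s : R) : 0 <= a ->
  measurable_fun (itv0 a : set T) (f : T -> \bar R) -> (0 <= s)%R ->
  itv0 a `&` [set t | s%:E < rearr a f t] = itv0 (distribution a f s).
Proof.
move=> a0 mf s0; apply/seteqP; split => t /=.
  move=> [[t0 ta]]; rewrite ltNge rearr_le// -ltNge => tf; split => //.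
move=> [t0 tf]; split; last by rewrite ltNge rearr_le// -ltNge.
by split => //; apply: lt_le_trans tf _; exact: distribution_le_itv.
Qed.

Lemma rearr_scale_ge (c : R) f t : (0 < c)%R ->
  c%:E * rearr a f t <= rearr a (escale c f) t.
Proof.
move=> c0; apply: le_ereal_inf_tmp => _ [s [s0 fs] <-].
rewrite muleC -lee_pdivlMr// ; apply: ereal_inf_lbound.
exists (s / c)%R; last by rewrite EFinM.
split; first by rewrite divr_ge0// ltW.
apply: le_trans fs; apply: le_leb => x [Ix fx]; split => //.
rewrite /escale abseM (@gee0_abs _ c%:E) ?lee_fin ?(ltW c0)//.
by rewrite -lte_pdivrMl// -EFinM mulrC.
Qed.

Lemma rearr_scale (c : R) f t : (0 < c)%R ->
  rearr a (escale c f) t = c%:E * rearr a f t.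
Proof.
move=> c0; apply/eqP; rewrite eq_le rearr_scale_ge// andbT.
have ci : (0 < c^-1)%R by rewrite invr_gt0.
have := rearr_scale_ge (escale c f) t ci.
have -> : escale c^-1 (escale c f) = f.
  by apply/funext => x; rewrite /escale muleA -EFinM mulVf ?gt_eqF// mul1e.
by rewrite -lee_pdivrMl ?invr_gt0// invrK.
Qed.

Lemma le_rearr f g t : (forall x, itv0 a x -> `|f x| <= `|g x|) ->
  rearr a f t <= rearr a g t.
Proof.
move=> fg; apply: ereal_inf_le_tmp => _ [s [s0 gs] <-]; exists s => //; split => //.
apply: le_trans gs; apply: le_leb => x [Ix fx]; split => //.
exact: lt_le_trans (fg _ Ix).
Qed.

(** With [rearr_edecreasing_ge] this places the rearrangement of a decreasing function between its
    right limit and its value, so that the two differ only at jumps. *)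
Lemma rearr_edecreasing_le k t : edecreasing_on a k ->
  (forall x, itv0 a x -> 0 <= k x) -> itv0 a t -> rearr a k t <= k t.
Proof.
move=> dk k0 It; have := k0 _ It.
case kt : (k t) => [s||]//; rewrite ?leey// lee_fin => s0.
apply: distribution_le => //; have [t0 _] := It.
rewrite -[leRHS]leb_itv0 ?lee_fin ?(ltW t0)//; apply: le_leb => x [Ix].
rewrite gee0_abs ?k0// => kx; split; first exact: Ix.1.
rewrite lte_fin ltNge; apply/negP => tx.
by have := dk _ _ It Ix tx; rewrite kt leNgt kx.
Qed.

Lemma rearr_edecreasing_ge k t x : edecreasing_on a k ->
  (forall x, itv0 a x -> 0 <= k x) -> (t < x)%R -> itv0 a x ->
  k x <= rearr a k t.
Proof.
move=> dk k0 tx Ix; apply: le_ereal_inf_tmp => _ [s [s0 ks] <-].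
rewrite leNgt; apply/negP => skx.
have : x%:E <= t%:E.
  apply: le_trans ks; rewrite -[leLHS]leb_itv0 ?lee_fin ?(ltW Ix.1)//.
  apply: le_leb => y [y0]; rewrite lte_fin => yx.
  have Iy : itv0 a y.
    by split => //; apply: lt_trans Ix.2; rewrite lte_fin.
  split => //; rewrite gee0_abs ?k0//; apply: lt_le_trans skx _.
  by apply: dk => //; exact: ltW.
by rewrite lee_fin leNgt tx.
Qed.

(* A jump of [k] at [x] contains a rational [q], and [x] is determined by [q]. *)
Definition jump_set k : set R :=
  range (fun q : rat => sup [set x : R | itv0 a x /\ (ratr q)%:E < k x]).

Lemma countable_jump_set k : countable (jump_set k).
Proof. exact: (card_le_trans (card_image_le _ _) (countableP _)). Qed.

Lemma in_jump_set k x (c1 c2 : R) : itv0 a x -> (c1 < c2)%R ->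
  (forall y, itv0 a y -> (y < x)%R -> c2%:E <= k y) ->
  (forall y, itv0 a y -> (x < y)%R -> k y <= c1%:E) -> jump_set k x.
Proof.
move=> Ix c12 kl kr; have [q] := rat_in_itvoo c12.
rewrite in_itv/= => /andP[c1q qc2]; exists q => //.
set S := (X in sup X).
have xS y : itv0 a y -> (y < x)%R -> S y.
  by move=> Iy yx; split => //; apply: lt_le_trans (kl _ Iy yx); rewrite lte_fin.
have ubS : ubound S x.
  move=> y [Iy qy]; rewrite leNgt; apply/negP => xy.
  have := le_trans (ltW qy) (kr _ Iy xy); rewrite lee_fin leNgt; by rewrite c1q.
have Iz z : (0 < z)%R -> (z < x)%R -> itv0 a z.
  by move=> z0 zx; split => //; apply: lt_trans Ix.2; rewrite lte_fin.
have x2 : S (x / 2)%R.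
  have x20 : (0 < x / 2)%R by rewrite divr_gt0// Ix.1.
  have x2x : (x / 2 < x)%R by rewrite ltr_pdivrMr// ltr_pMr ?ltr1n// Ix.1.
  by apply: xS => //; exact: Iz.
apply/eqP; rewrite eq_le ge_sup//=; last by exists (x / 2)%R.
rewrite leNgt; apply/negP => sx.
have s0 : (0 < sup S)%R.
  apply: (@lt_le_trans _ _ (x / 2)%R); first by rewrite divr_gt0// Ix.1.
  by apply: ub_le_sup x2; exists x.
pose z := ((sup S + x) / 2)%R.
have sz : (sup S < z)%R by rewrite midf_lt.
have zx : (z < x)%R by rewrite midf_lt.
have : S z by apply: xS => //; apply: Iz => //; exact: lt_trans sz.
by move=> /(ub_le_sup (ex_intro _ x ubS)); rewrite leNgt sz.
Qed.

Lemma ae_notin_countable (N : set R) (P : R -> Prop) : countable N ->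
  (forall x, ~ N x -> P x) -> {ae (@leb R), forall x : R, P x}.
Proof.
move=> cN NP; exists N; split; [exact: measurable_countable|exact: leb_countable|].
by move=> x /= Px; apply: contrapT => /NP.
Qed.

Lemma rearr_edecreasing_notin k x : edecreasing_on a k ->
  (forall x, itv0 a x -> 0 <= k x) -> itv0 a x -> ~ jump_set k x ->
  rearr a k x = k x.
Proof.
move=> dk k0 Ix Nx; apply/eqP; rewrite eq_le rearr_edecreasing_le//= leNgt.
apply/negP => rk; apply: Nx.
have [c1 c1l c1k] : exists2 c1 : R, rearr a k x <= c1%:E & c1%:E < k x.
  have := rearr_ge0 k x; case E : (rearr a k x) rk => [r||]// rk _; last by rewrite ltNge leey in rk.
  by exists r.
have [c2 c12 c2k] := between_EFin c1k.
apply: (@in_jump_set k x c1 c2 Ix c12) => y Iy.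
  by move=> yx; apply: le_trans (ltW c2k) _; apply: dk => //; exact: ltW.
by move=> xy; apply: le_trans c1l; exact: rearr_edecreasing_ge.
Qed.

Lemma rearr_edecreasing_ae k : edecreasing_on a k ->
  (forall x, itv0 a x -> 0 <= k x) ->
  {ae (@leb R), forall x : R, itv0 a x -> rearr a k x = k x}.
Proof.
move=> dk k0; apply: (ae_notin_countable (countable_jump_set k)) => x Nx Ix.
exact: rearr_edecreasing_notin.
Qed.

Lemma ae_eq_rearr f g :
  {ae (@leb R), forall x : R, itv0 a x -> f x = g x} -> rearr a f = rearr a g.
Proof.
move=> [N [mN N0 fgN]].
have dE h h' s : (forall x, itv0 a x -> ~ N x -> h x = h' x) ->
    distribution a h s <= distribution a h' s.
  move=> hh'; rewrite /distribution.
  apply: (@le_trans _ _ (leb (([set x | itv0 a x /\ s%:E < `|h' x|] `|` N) : set T))).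
    apply: le_leb => x [Ix hx]; have [Nx|Nx] := pselect (N x); [by right|left].
    by split => //; rewrite -hh'.
  rewrite [leRHS](_ : _ = leb ([set x | itv0 a x /\ s%:E < `|h' x|] : set T) + leb (N : set T)); last first.
    by rewrite N0 adde0.
  by rewrite !lebE; exact: outer_measureU2.
have fg x : itv0 a x -> ~ N x -> f x = g x.
  by move=> Ix Nx; apply: contrapT => fgx; apply/Nx/fgN => /= /(_ Ix).
have {}dE s : distribution a f s = distribution a g s.
  apply/eqP; rewrite eq_le !dE// => x Ix Nx; exact/esym/fg.
by apply/funext => t; rewrite /rearr; under eq_set do rewrite dE.
Qed.

End rearrangement.

(** * The inequalities of Hardy and of Hardy and Littlewood *)

Section integral_stairM.
Context d (T : measurableType d) {R : realType} (mu : {measure set T -> \bar R}).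
Variables (D : set T) (mD : measurable D).

Lemma integral_stairM (f g : T -> \bar R) n :
  measurable_fun D f -> measurable_fun D g ->
  \int[mu]_(x in D) ((stair n (f x))%:E * (stair n (g x))%:E) =
  (n.+1%:R^-1)%:E * \sum_(i < n.+1 ^ 2) ((n.+1%:R^-1)%:E * \sum_(j < n.+1 ^ 2)
    mu (D `&` [set x | (i.+1%:R / n.+1%:R)%:E < g x] `&`
              [set x | (j.+1%:R / n.+1%:R)%:E < f x])).
Proof.
move=> mf mg; rewrite integral_mul_stair//; last 2 first.
- exact: measurable_stair.
- by move=> x _; rewrite lee_fin stair_ge0.
congr (_ * _); apply: eq_bigr => i _.
have mDi : measurable (D `&` [set x | (i.+1%:R / n.+1%:R)%:E < g x]).
  exact: emeasurable_fun_o_infty.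
have mfi : measurable_fun (D `&` [set x | (i.+1%:R / n.+1%:R)%:E < g x]) f.
  by apply: measurable_funS mf => // x [].
under eq_integral do rewrite -[_%:E]mul1e.
rewrite (@integral_mul_stair d T R mu _ mDi (cst 1))//.
congr (_ * _); apply: eq_bigr => j _.
by rewrite integral_cst ?mul1e//; exact: emeasurable_fun_o_infty.
Qed.

End integral_stairM.

Section hardy.
Context {R : realType} (a : \bar R).
Local Notation T := (lebesgue_type R).
Implicit Types f g k p q : R -> \bar R.

(** An initial segment is an interval up to its end point, which is null. The end [b] is chosen
    before [p] so that [hardy_le] can integrate two functions over the same set. *)
Lemma integral_initial (D : set R) : measurable (D : set T) -> D `<=` itv0 a ->
  (forall x y, D x -> (0 < y)%R -> (y <= x)%R -> D y) -> 0 <= a ->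
  exists b, [/\ 0 <= b, b <= a & forall p : R -> \bar R,
    measurable_fun (itv0 a : set T) (p : T -> \bar R) ->
    (forall x, itv0 a x -> 0 <= p x) ->
    \int[leb]_(x in D) p x = \int[leb]_(x in itv0 b) p x].
Proof.
(* The maximum with 0 covers an empty [D], whose supremum is [-oo]. *)
move=> mD Da Dini a0; pose b := maxe 0 (ereal_sup [set x%:E | x in D]).
have ba : b <= a.
  rewrite ge_max a0/=; apply: ge_ereal_sup => _ [x Dx <-].
  exact/ltW/(Da _ Dx).2.
exists b; split => //; first by rewrite le_max lexx.
move=> p mp p0.
have mN : measurable ([set fine b] : set T) by exact: measurable_countable.
have bIa := itv0_le ba.
rewrite (@ge0_negligible_integral _ T R leb D [set fine b])//; last 3 first.
  by apply: measurable_funS mp => //; exact: measurable_itv0.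
  by move=> x /Da; exact: p0.
  exact: leb_set1.
rewrite [RHS](@ge0_negligible_integral _ T R leb _ [set fine b])//; last 4 first.
  exact: measurable_itv0.
  by apply: measurable_funS mp => //; exact: measurable_itv0.
  by move=> x /bIa; exact: p0.
  exact: leb_set1.
congr integral; apply/seteqP; split => x [xD xb]; split => //.
  split; first exact: (Da _ xD).1.
  rewrite lt_neqAle; apply/andP; split.
    by apply: contra_notN xb => /eqP <-.
  by rewrite le_max; apply/orP; right; apply: ereal_sup_ubound; exists x.
case: xD => x0; rewrite lt_max => /orP[|/ereal_sup_gt[_ [y Dy <-]]].
  by rewrite ltNge lee_fin (ltW x0).
by rewrite lte_fin => /ltW; exact: Dini.
Qed.

Lemma le_integral_itv0 p q (b : \bar R) : 0 <= b -> b <= a ->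
  measurable_fun (itv0 a : set T) (p : T -> \bar R) ->
  measurable_fun (itv0 a : set T) (q : T -> \bar R) ->
  (forall x, itv0 a x -> 0 <= p x) -> (forall x, itv0 a x -> 0 <= q x) ->
  (forall x, itv0 a x -> \int[leb]_(y in `]0%R, x[) p y <= \int[leb]_(y in `]0%R, x[) q y) ->
  \int[leb]_(x in itv0 b) p x <= \int[leb]_(x in itv0 b) q x.
Proof.
move=> b0 ba mp mq p0 q0 pq; have bIa := itv0_le ba.
have [<-|b_neq0] := eqVneq 0 b.
  rewrite (_ : itv0 0 = set0) ?integral_set0// -subset0 => x [x0].
  by rewrite lte_fin ltNge (ltW x0).
have {}b0 : 0 < b by rewrite lt_neqAle b_neq0.
have mI := @measurable_itv0 R.
apply: integral_itv0_le => //.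
- exact: measurable_funS mp.
- by move=> x /bIa; exact: p0.
move=> x Ix; apply: le_trans (pq _ (bIa _ Ix)) _.
apply: ge0_subset_integral.
- exact: measurable_itv_leb.
- exact: mI.
- exact: measurable_funS mq.
- by move=> y /bIa; exact: q0.
- by apply: itvoo_sub_itv0 => //; exact/ltW/Ix.2.
Qed.

(** The superlevel sets of the decreasing [k] are initial segments, on which the hypothesis compares
    [p] and [q]; the staircases of [k] sum these comparisons. *)
Lemma hardy_le p q k : 0 <= a ->
  measurable_fun (itv0 a : set T) (p : T -> \bar R) ->
  measurable_fun (itv0 a : set T) (q : T -> \bar R) ->
  (forall x, itv0 a x -> 0 <= p x) -> (forall x, itv0 a x -> 0 <= q x) ->
  edecreasing_on a k -> (forall x, itv0 a x -> 0 <= k x) ->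
  (forall x, itv0 a x -> \int[leb]_(y in `]0%R, x[) p y <= \int[leb]_(y in `]0%R, x[) q y) ->
  \int[leb]_(x in itv0 a) (p x * k x) <= \int[leb]_(x in itv0 a) (q x * k x).
Proof.
move=> a0 mp mq p0 q0 dk k0 pq.
have mk : measurable_fun (itv0 a : set T) (k : T -> \bar R) by exact: measurable_edecreasing.
have mI := @measurable_itv0 R a.
have ms n : measurable_fun (itv0 a : set T) (fun x : T => (stair n (k x))%:E).
  exact: measurable_stair.
apply: (@fatou_le R _ T leb (itv0 a) (fun n x => p x * (stair n (k x))%:E)
  (fun x => p x * k x)).
- exact: mI.
- by move=> n; apply: emeasurable_funM; [exact: mp|exact: ms].
- by move=> n x Ix; rewrite mule_ge0 ?p0// lee_fin stair_ge0.
- by move=> x Ix; apply: mule_stair_cvg; [exact: p0|exact: k0].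
move=> n; rewrite (integral_mul_stair leb mI n mp p0 mk).
apply: (@le_trans _ _ (\int[leb]_(x in itv0 a) (q x * (stair n (k x))%:E))).
  rewrite (integral_mul_stair leb mI n mq q0 mk); apply: lee_wpmul2l; first by rewrite lee_fin.
  apply: lee_sum => i _; set s := (_ / _)%:E.
  have mD : measurable (itv0 a `&` [set x | s < k x] : set T).
    exact: (emeasurable_fun_o_infty mI mk).
  have [|x y [Ix kx] y0 yx|b [b0 ba H]] := integral_initial mD _ _ a0.
  - by move=> x [].
  - have Iy : itv0 a y.
      by split => //; apply: le_lt_trans Ix.2; rewrite lee_fin.
    by split => //=; apply: lt_le_trans kx _; exact: dk.
  rewrite (H p mp p0) (H q mq q0).
  exact: (le_integral_itv0 b0 ba mp mq p0 q0 pq).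
apply: ge0_le_integral.
- exact: mI.
- by move=> x Ix; rewrite mule_ge0 ?q0// lee_fin stair_ge0.
- by apply: emeasurable_funM; [exact: mq|exact: ms].
- by apply: emeasurable_funM; [exact: mq|exact: mk].
- by move=> x Ix; rewrite lee_wpmul2l ?q0// stair_le// k0.
Qed.

(** Superlevel sets of rearrangements are intervals starting at 0, so the measure of an intersection
    is the minimum of two distribution functions. *)
Lemma integral_stairM_rearr f g n : 0 <= a ->
  measurable_fun (itv0 a : set T) (f : T -> \bar R) ->
  measurable_fun (itv0 a : set T) (g : T -> \bar R) ->
  \int[leb]_(x in itv0 a) ((stair n (rearr a f x))%:E * (stair n (rearr a g x))%:E) =
  (n.+1%:R^-1)%:E * \sum_(i < n.+1 ^ 2) ((n.+1%:R^-1)%:E * \sum_(j < n.+1 ^ 2)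
    mine (distribution a g (i.+1%:R / n.+1%:R)) (distribution a f (j.+1%:R / n.+1%:R))).
Proof.
move=> a0 mf mg; have mI := @measurable_itv0 R a.
rewrite (integral_stairM leb mI n (@measurable_rearr R a f) (@measurable_rearr R a g)).
congr (_ * _); apply: eq_bigr => i _; congr (_ * _); apply: eq_bigr => j _.
have di (m : nat) : (0 <= m.+1%:R / n.+1%:R :> R)%R by rewrite divr_ge0.
have hg := superlevel_rearr a0 mg (di i); have hf := superlevel_rearr a0 mf (di j).
set d1 := distribution _ _ _ in hg *; set d2 := distribution _ _ _ in hf *.
rewrite hg; transitivity (leb (itv0 (mine d1 d2) : set T)); last first.
  by rewrite leb_itv0// le_min /d1 /d2 /Defs.distribution !measure_ge0.
congr (_ _); apply/seteqP; split => x.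
  move=> [[x0 xd1] xf]; split; first by [].
  rewrite lt_min xd1/=.
  suff [] : itv0 d2 x by [].
  rewrite -hf; split; last exact: xf.
  by split; [|apply: lt_le_trans xd1 _; exact: distribution_le_itv].
move=> [x0]; rewrite lt_min => /andP[xd1 xd2].
have : itv0 d2 x by split.
by rewrite -hf => -[].
Qed.

(** Threshold by threshold: the measure of an intersection of superlevel sets is at most the minimum
    that [integral_stairM_rearr] gives for the rearrangements. *)
Lemma hardy_littlewood f g : 0 <= a ->
  measurable_fun (itv0 a : set T) (f : T -> \bar R) ->
  measurable_fun (itv0 a : set T) (g : T -> \bar R) ->
  \int[leb]_(x in itv0 a) (`|f x| * `|g x|) <=
  \int[leb]_(x in itv0 a) (rearr a f x * rearr a g x).
Proof.
move=> a0 mf mg; have mI := @measurable_itv0 R a.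
have mf' : measurable_fun (itv0 a : set T) (fun x : T => `|f x|).
  exact: (measurableT_comp (@abse_measurable R _) mf).
have mg' : measurable_fun (itv0 a : set T) (fun x : T => `|g x|).
  exact: (measurableT_comp (@abse_measurable R _) mg).
have mrf := @measurable_rearr R a f; have mrg := @measurable_rearr R a g.
apply: (@fatou_le R _ T leb (itv0 a)
  (fun n x => (stair n `|f x|)%:E * (stair n `|g x|)%:E)
  (fun x => `|f x| * `|g x|)).
- exact: mI.
- by move=> n; apply: emeasurable_funM; [exact: measurable_stair mf'|exact: measurable_stair mg'].
- by move=> n x Ix; rewrite mule_ge0// lee_fin stair_ge0.
- by move=> x Ix; exact: stairM_cvg.
move=> n; rewrite (integral_stairM leb mI n mf' mg').
apply: (@le_trans _ _ (\int[leb]_(x in itv0 a)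
   ((stair n (rearr a f x))%:E * (stair n (rearr a g x))%:E))); last first.
  apply: ge0_le_integral.
  - exact: mI.
  - by move=> x Ix; rewrite mule_ge0// lee_fin stair_ge0.
  - by apply: emeasurable_funM; [exact: measurable_stair mrf|exact: measurable_stair mrg].
  - by apply: emeasurable_funM; [exact: mrf|exact: mrg].
  - by move=> x Ix; apply: lee_pmul; rewrite ?lee_fin ?stair_ge0// stair_le// rearr_ge0.
rewrite (integral_stairM_rearr n a0 mf mg); apply: lee_wpmul2l; first by rewrite lee_fin.
apply: lee_sum => i _; apply: lee_wpmul2l; first by rewrite lee_fin.
apply: lee_sum => j _; rewrite le_min; apply/andP; split; apply: le_leb => x /=.
  by case=> -[].
by case=> -[Ix _].
Qed.

End hardy.

(** * Functions with a prescribed rearrangement *)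

Section tie_breaking.
Context {R : realType} (b0 : R) (v : R -> R) (m : nat).
Local Notation T := (lebesgue_type R).
Hypothesis b0_gt0 : (0 < b0)%R.
Local Notation J := (itv0 b0%:E).
Hypothesis mv : measurable_fun (J : set T) (v : T -> R).
Hypothesis v_grid : forall x, exists k : nat, v x = (k%:R / m.+1%:R)%R.

(* A perturbation of [v] which breaks ties: its level sets are null, and the
   order of the values of [v] is preserved. *)
Definition untie (x : R) : R := (v x + m.+1%:R^-1 * (1 + x)^-1)%R.

(** The threshold above which [untie] lies on a set of measure exactly [b], see [leb_untie_set]. *)
Definition untie_level (b : R) : R := fine (rearr b0%:E (EFin \o untie) b).

Definition untie_set (b : R) : set R :=
  [set x | J x /\ (untie_level b < untie x)%R].

Lemma untie_bounds x : J x -> (v x < untie x < v x + m.+1%:R^-1)%R.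
Proof.
move=> [x0 _]; rewrite /untie ltrDl ltrD2l.
have x1 : (0 < 1 + x)%R by rewrite addr_gt0.
by rewrite mulr_gt0 ?invr_gt0//= gtr_pMr ?invr_gt0// invf_lt1// ltrDl.
Qed.

Lemma v_ge0 x : (0 <= v x)%R.
Proof. by have [k ->] := v_grid x; rewrite divr_ge0. Qed.

Lemma untie_gt0 x : J x -> (0 < untie x)%R.
Proof. by move=> /untie_bounds/andP[+ _]; apply: le_lt_trans; exact: v_ge0. Qed.

Lemma measurable_untie : measurable_fun (J : set T) (untie : T -> R).
Proof.
apply: measurable_funD; [exact: mv|apply: measurable_decreasing => x y].
rewrite !inE => -[x0 _] [y0 _] xy; rewrite ler_wpM2l// lef_pV2 ?posrE ?addr_gt0//.
by rewrite lerD2l.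
Qed.

Lemma measurable_untie_gt (s : R) : measurable ([set x | J x /\ (s < untie x)%R] : set T).
Proof.
have mI := @measurable_itv0 R b0%:E.
have := emeasurable_fun_o_infty mI ((measurable_EFinP _ _).2 measurable_untie) s%:E.
congr measurable; apply/seteqP; split => x [Jx] /=; by rewrite lte_fin.
Qed.

(** For each of the countably many possible values of [v], the equation [untie x = s] determines
    [x], as the added term is injective in [x]. *)
Lemma leb_untie_eq (s : R) : leb ([set x | J x /\ untie x = s] : set T) = 0.
Proof.
apply: leb_countable.
apply: (@sub_countable _ _ _ (range (fun k : nat => (m.+1%:R * s - k%:R)^-1 - 1)%R)).
  apply: subset_card_le => x [[x0 _]] <-; have [k vk] := v_grid x; exists k => //.
  rewrite /untie vk mulrDr mulrCA mulfV ?pnatr_eq0// mulr1 mulrA mulfV ?pnatr_eq0//.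
  by rewrite mul1r addrAC subrr add0r invrK addrAC subrr add0r.
exact: (card_le_trans (card_image_le _ _) (countableP _)).
Qed.

Lemma distribution_untie (s : R) :
  distribution b0%:E (EFin \o untie) s = leb ([set x | J x /\ (s < untie x)%R] : set T).
Proof.
congr (leb _); apply/seteqP; split => x [Jx] /=.
  by rewrite lte_fin ger0_norm// ltW// untie_gt0.
by move=> ?; split => //=; rewrite lte_fin ger0_norm// ltW// untie_gt0.
Qed.

Hypothesis v_bounded : exists M : R, forall x, (v x <= M)%R.

Lemma untie_levelE b : (0 <= b)%R -> rearr b0%:E (EFin \o untie) b = (untie_level b)%:E.
Proof.
move=> b_ge0; rewrite fineK// ge0_fin_numE ?rearr_ge0//.
have [M vM] := v_bounded.
have M0 : (0 <= M)%R by apply: le_trans (vM 0%R); exact: v_ge0.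
apply: (@le_lt_trans _ _ (M + m.+1%:R^-1)%:E); last by rewrite ltry.
apply: distribution_le; first by rewrite addr_ge0.
rewrite distribution_untie [X in leb X](_ : _ = set0).
  by rewrite measure0 lee_fin.
rewrite -subset0 => x [Jx]; have /andP[_] := untie_bounds Jx.
have := vM x; move=> h1 h2 h3; have := lt_trans h3 h2.
by rewrite ltrD2r ltNge h1.
Qed.

Lemma untie_level_anti b b' : (0 <= b)%R -> (b <= b')%R ->
  (untie_level b' <= untie_level b)%R.
Proof.
move=> b0' bb'; rewrite -lee_fin -!untie_levelE//; first exact: rearr_anti.
exact: le_trans bb'.
Qed.

(** The Galois connection bounds the measure by [b] at the threshold [t] itself and from below by
    [b] at every smaller threshold. Continuity from above, available as [J] has finite measure,
    gives at least [b] for the set where [untie] is at least [t], and the level set at [t] is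
    null. *)
Lemma leb_untie_set b : (0 <= b)%R -> (b < b0)%R ->
  leb (untie_set b : set T) = b%:E.
Proof.
move=> b_ge0 bb0; set t := untie_level b.
have mu := (measurable_EFinP _ _).2 measurable_untie.
have Galois s : (0 <= s)%R -> (t <= s)%R =
    (leb ([set x | J x /\ (s < untie x)%R] : set T) <= b%:E).
  move=> s0; rewrite -lee_fin -untie_levelE// rearr_le//.
  by rewrite distribution_untie.
have t_ge0 : (0 <= t)%R by rewrite -lee_fin -untie_levelE// rearr_ge0.
have t0 : (0 < t)%R.
  rewrite lt_neqAle t_ge0 andbT; apply/eqP => t0.
  have := Galois 0%R (lexx _); rewrite -t0 lexx => /esym.
  rewrite [X in leb X](_ : _ = J) ?leb_itv0 ?lee_fin ?(ltW b0_gt0)// 1?leNgt ?bb0//.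
  by apply/seteqP; split => [x []//|x Jx]; split => //; exact: untie_gt0.
apply/eqP; rewrite eq_le; apply/andP; split; first by have := Galois t t_ge0; rewrite lexx.
pose A (n : nat) : set R := [set x | J x /\ (t * (1 - n.+1%:R^-1) < untie x)%R].
have An n : b%:E <= leb (A n : set T).
  rewrite leNgt; apply/negP => /ltW.
  have n1 : (0 <= 1 - n.+1%:R^-1 :> R)%R by rewrite subr_ge0 invf_le1// ler1n.
  rewrite -Galois; last by rewrite mulr_ge0.
  by rewrite ler_pMr// lerBrDl gerDr leNgt invr_gt0 ltr0n.
have mA n : measurable (A n : set T) by exact: measurable_untie_gt.
have AI : \bigcap_n A n = [set x | J x /\ (t <= untie x)%R].
  apply/seteqP; split => x; last first.
    move=> [Jx tx] n _; split => //; apply: lt_le_trans tx.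
    by rewrite gtr_pMr// gtrBl invr_gt0.
  move=> Ax; split; first by have [] := Ax 0%N.
  rewrite leNgt; apply/negP => xt.
  have e0 : (0 < 1 - untie x / t)%R by rewrite subr_gt0 ltr_pdivrMr// mul1r.
  have [n _ /(_ n (leqnn n))/= ne] := near_infty_natSinv_lt (PosNum e0).
  have [Jx] := Ax n Logic.I; apply/negP; rewrite -leNgt mulrC -ler_pdivrMr//.
  by rewrite lerBrDl -lerBrDr ltW.
have : leb (A n : set T) @[n --> \oo] --> leb (\bigcap_n A n : set T).
  apply: nonincreasing_cvg_mu.
  - apply: (@le_lt_trans _ _ (leb (J : set T))); first by apply: le_leb => x [].
    by rewrite leb_itv0 ?ltry// lee_fin ltW.
  - exact: mA.
  - by apply: bigcap_measurable => // n _; exact: mA.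
  - move=> i j ij; apply/subsetPset => x [Jx jx]; split => //.
    apply: le_lt_trans jx; rewrite ler_pM2l// lerD2l lerN2.
    by rewrite lef_pV2 ?posrE// ler_nat.
move=> /cvge_to_ge/(_ (nearW _ An)) /le_trans; apply; rewrite AI.
apply: (@le_trans _ _ (leb ((untie_set b `|` [set x | J x /\ untie x = t]) : set T))).
  apply: le_leb => x [Jx]; rewrite le_eqVlt => /predU1P[tx|tx]; first by right.
  by left.
apply: (@le_trans _ _ (leb (untie_set b : set T) + leb ([set x | J x /\ untie x = t] : set T))).
  by rewrite !lebE; exact: outer_measureU2.
by rewrite leb_untie_eq adde0.
Qed.

End tie_breaking.

Section indicator_sum.
Context d (T : measurableType d) {R : realType} (mu : {measure set T -> \bar R}).
Variables (D : set T) (mD : measurable D).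

Lemma integral_mul_indicators (p : T -> \bar R) (c : R) (N : nat) (E : nat -> set T) :
  (0 <= c)%R -> measurable_fun D p -> (forall x, D x -> 0 <= p x) ->
  (forall i, measurable (E i)) ->
  \int[mu]_(x in D) (p x * (c * \sum_(i < N) \1_(E i) x)%:E) =
  c%:E * \sum_(i < N) \int[mu]_(x in D `&` E i) p x.
Proof.
move=> c0 mp p0 mE.
pose h (i : 'I_N) x := p x * (\1_(E i) x)%:E.
have mh i : measurable_fun D (h i).
  by apply: emeasurable_funM; [exact: mp|exact/measurable_EFinP/measurable_indic].
have h0 i x : D x -> 0 <= h i x by move=> Dx; rewrite mule_ge0 ?p0// lee_fin.
transitivity (\int[mu]_(x in D) (c%:E * \sum_(i < N) h i x)).
  apply: eq_integral => x _; rewrite EFinM muleCA; congr (_ * _).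
  by rewrite -sumEFin ge0_sume_distrr.
rewrite ge0_integralZl_EFin//; last 2 first.
  by move=> x Dx; apply: sume_ge0 => i _; exact: h0.
  exact: emeasurable_sum.
rewrite ge0_integral_sum//; congr (_ * _); apply: eq_bigr => i _.
rewrite integral_mkcondr; apply: eq_integral => x _; rewrite patchE /h indicE.
by case: (x \in E i); rewrite ?mule1 ?mule0.
Qed.

End indicator_sum.

(** * Realizing a decreasing test function along the level sets of f *)

Section realization.
Context {R : realType} (a : \bar R).
Local Notation T := (lebesgue_type R).
Hypothesis a_gt0 : 0 < a.

(** Truncation to [(0, b)], whose finite measure makes [leb_untie_set] available. *)
Definition cutoff (b : R) (f : R -> \bar R) (x : R) : \bar R :=
  if (x < b)%R then f x else 0.

Lemma measurable_cutoff b (f : R -> \bar R) :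
  measurable_fun (itv0 a : set T) (f : T -> \bar R) ->
  measurable_fun (itv0 a : set T) (cutoff b f : T -> \bar R).
Proof.
move=> mf; have -> : cutoff b f = fun x => f x * ((x < b)%R%:R : R)%:E.
  by apply/funext => x; rewrite /cutoff; case: ifP => _; rewrite ?mule1 ?mule0.
apply: emeasurable_funM; first exact: mf.
apply/measurable_EFinP/measurable_decreasing => x y _ _ xy.
by rewrite ler_nat; case: (ltP y b) => // yb; rewrite (le_lt_trans xy yb).
Qed.

Lemma distribution_cutoff b f (s : R) : b%:E <= a -> (0 <= s)%R ->
  distribution a (cutoff b f) s = leb ([set x | itv0 b%:E x /\ s%:E < `|f x|] : set T).
Proof.
move=> ba s0; congr (leb _); apply/seteqP; split => x [Ix]; rewrite /cutoff.
  case: ifPn => [xb sf|_]; last by rewrite abse0 ltNge lee_fin s0.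
  by split => //; split; [exact: Ix.1|rewrite lte_fin].
move=> sf; have [x0] := Ix; rewrite lte_fin => xb.
by split; [exact: itv0_le Ix|rewrite /= ifT].
Qed.

Lemma stair_grid n (x : \bar R) : exists k : nat, stair n x = (k%:R / n.+1%:R)%R.
Proof.
exists (\sum_(i < n.+1 ^ 2) ((i.+1%:R / n.+1%:R)%:E < x)%E)%N.
by rewrite /stair mulrC natr_sum.
Qed.

Lemma stair_bounded n : exists M : R, forall x : \bar R, (stair n x <= M)%R.
Proof.
exists (n.+1%:R^-1 * \sum_(i < n.+1 ^ 2) 1)%R => x.
by rewrite ler_wpM2l//; apply: ler_sum => i _; rewrite lern1 leq_b1.
Qed.

Lemma stair_ge n (x : \bar R) (j : nat) : (j < n.+1 ^ 2)%N ->
  (j.+1%:R / n.+1%:R)%:E < x -> (j.+1%:R / n.+1%:R <= stair n x)%R.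
Proof.
move=> jN jx; rewrite mulrC ler_wpM2l//.
apply: (@count_ge _ _ _ (fun i => (i.+1%:R / n.+1%:R)%:E < x)) => // i ij.
by apply: le_lt_trans jx; rewrite lee_fin ler_wpM2r// ler_nat.
Qed.

Lemma stair_le_grid n (x : \bar R) (j : nat) :
  x <= (j.+1%:R / n.+1%:R)%:E -> (stair n x <= j%:R / n.+1%:R)%R.
Proof.
move=> jx; rewrite [leRHS]mulrC /stair ler_wpM2l//.
rewrite (le_trans (@count_thresholds_le _ _ n.+1%:R (j%:R / n.+1%:R)%R
  (fun i => (i.+1%:R / n.+1%:R)%:E < x) _ _ _))//.
- move=> i /lt_le_trans/(_ jx); rewrite lte_fin ltr_pM2r ?invr_gt0 ?ltr0n//.
  by rewrite ltr_nat => ij; rewrite ler_wpM2r// ler_nat.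
- by rewrite mulrCA mulfV ?pnatr_eq0// mulr1.
Qed.

Variables (h : R -> R) (T0 : R).
Hypothesis h_anti : decreasing_on a h.
Hypothesis h_ge0 : forall x, itv0 a x -> (0 <= h x)%R.
Hypothesis T0_ge0 : (0 <= T0)%R.
Hypothesis h_supp : forall x, itv0 a x -> (T0 <= x)%R -> h x = 0%R.

(** The staircase of [h] is transported onto the largest values of [f]: [g] adds the indicators of
    the sets [E i], where [untie] is largest and whose measure is the length [be i] of the set where
    [h > s i]. Each [E i] is nested with each superlevel set of [f] on [(0, b)], so intersections
    have the minimal of the two measures, which is the equality case of the Hardy-Littlewood
    inequality. *)
Lemma realize_stair (b : R) (f : R -> \bar R) n : itv0 a b -> (T0 < b)%R ->
  measurable_fun (itv0 a : set T) (f : T -> \bar R) ->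
  exists g : R -> R, [/\ L0 a g, forall x, (0 <= g x)%R,
    forall t, itv0 a t -> rearr a (EFin \o g) t <= (h t)%:E &
    \int[leb]_(x in itv0 a) ((stair n (rearr a (cutoff b f) x))%:E * (stair n (h x)%:E)%:E) <=
    \int[leb]_(x in itv0 a) ((stair n `|f x|)%:E * (g x)%:E)].
Proof.
move=> Ib T0b mf.
have mI := @measurable_itv0 R a; have a0 := ltW a_gt0.
have mJ := @measurable_itv0 R b%:E.
have JI : itv0 b%:E `<=` itv0 a by apply: itv0_le; exact/ltW/Ib.2.
have b_gt0 : (0 < b)%R := Ib.1.
have mf' : measurable_fun (itv0 a : set T) (fun x : T => `|f x|).
  exact: (measurableT_comp (@abse_measurable R _) mf).
pose s (i : nat) : R := (i.+1%:R / n.+1%:R)%R.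
have s0 i : (0 <= s i)%R by rewrite divr_ge0.
pose v x := stair n `|f x|.
have mv : measurable_fun (itv0 b%:E : set T) (v : T -> R).
  apply/measurable_EFinP; apply: (measurable_funS mI JI).
  exact: (measurable_stair n mf').
have v_grid x : exists k : nat, v x = (k%:R / n.+1%:R)%R by exact: stair_grid.
have v_bd : exists M : R, forall x, (v x <= M)%R.
  by have [M HM] := stair_bounded n; exists M => x; exact: HM.
(* The point 0 gives a nonnegative supremum even when [h] never exceeds [s i]. *)
pose S i := [set x : R | itv0 a x /\ (s i < h x)%R] `|` [set 0%R].
pose be i := sup (S i).
have ubS i : ubound (S i) T0.
  move=> x [[Ix sh]|->//]; rewrite leNgt; apply/negP => /ltW /(h_supp Ix) hx.
  by move: sh; rewrite hx ltNge s0.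
have be0 i : (0 <= be i)%R by apply: ub_le_sup; [exists T0|right].
have beT0 i : (be i <= T0)%R by apply: ge_sup => //; exists 0%R; right.
have beb i : (be i < b)%R := le_lt_trans (beT0 i) T0b.
have h_le_be i x : itv0 a x -> (s i < h x)%R -> (x <= be i)%R.
  by move=> Ix sh; apply: ub_le_sup; [exists T0|left].
pose E i := untie_set b v n (be i).
have mE i : measurable (E i : set T).
  exact: (measurable_untie_gt n mv (untie_level b v n (be i))).
have lebEi i : leb (E i : set T) = (be i)%:E.
  exact: (leb_untie_set b_gt0 mv v_grid v_bd (be0 i) (beb i)).
have EI i : E i `<=` itv0 a by move=> x [/JI].
pose g x : R := (n.+1%:R^-1 * \sum_(i < n.+1 ^ 2) \1_(E i) x)%R.
have g0 x : (0 <= g x)%R by rewrite mulr_ge0// sumr_ge0// => i _; rewrite indicE.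
exists g; split => //.
- apply: measurable_funM; first exact: measurable_cst.
  by apply: measurable_sum => i; exact: measurable_indic.
- move=> t It; apply: distribution_le; first exact: h_ge0.
  (* Sets of prescribed measure exist only below [b], while [t] may be larger; all [be i] are at
     most [T0]. *)
  pose u := Num.min t T0.
  have u0 : (0 <= u)%R by rewrite le_min T0_ge0 (ltW It.1).
  have ub : (u < b)%R by rewrite gt_min T0b orbT.
  apply: (@le_trans _ _ (leb (untie_set b v n u : set T))); last first.
    by rewrite (leb_untie_set b_gt0 mv v_grid v_bd u0 ub) lee_fin ge_min lexx.
  apply: le_leb => x [Ix] /=; rewrite lte_fin ger0_norm// => hg.
  have [i Ei hi] : exists2 i, E i x & (h t < s i)%R.
    apply: contrapT => /forall2NP H; move: hg; apply/negP; rewrite -leNgt.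
    rewrite /g ler_pdivrMl ?ltr0n//.
    under eq_bigr do rewrite indicE.
    apply: (@count_thresholds_le _ _ _ _ (fun i => x \in E i)) => //.
    - exact: h_ge0.
    - by move=> i; rewrite inE => Ei; have [|/negP] := H i; [move=> /(_ Ei)|rewrite -leNgt].
  case: Ei => Jx; move=> Hx; split => //; apply: le_lt_trans Hx.
  apply: (untie_level_anti b v_grid v_bd); first exact: be0.
  rewrite le_min beT0 andbT; apply: ge_sup; first by exists 0%R; right.
  move=> y [[Iy sh]|->]; last exact/ltW/It.1.
  rewrite leNgt; apply/negP => ty.
  have := h_anti; move=> /(_ t y); rewrite !inE => /(_ It Iy (ltW ty)).
  by rewrite leNgt (lt_trans hi).
have dh : edecreasing_on a (EFin \o h).
  by move=> x y Ix Iy xy; rewrite lee_fin h_anti// inE.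
have mh := measurable_edecreasing dh.
rewrite (integral_stairM leb mI n (@measurable_rearr R a (cutoff b f)) mh).
have ms := measurable_stair n mf'.
rewrite (@integral_mul_indicators _ T R leb (itv0 a) mI (fun x => (stair n `|f x|)%:E) _ _ E)//; last first.
  by move=> x _; rewrite lee_fin stair_ge0.
apply: lee_wpmul2l; first by rewrite lee_fin.
apply: lee_sum => i _.
have mDi : measurable (itv0 a `&` E i : set T) by exact: measurableI.
have mfi : measurable_fun (itv0 a `&` E i : set T) (fun x : T => `|f x|).
  by apply: (measurable_funS mI) => // x [].
under [leRHS]eq_integral do rewrite -[_%:E]mul1e.
rewrite (@integral_mul_stair _ T R leb _ mDi (cst 1))//.
apply: lee_wpmul2l; first by rewrite lee_fin.
apply: lee_sum => j _; rewrite integral_cst; last exact: (emeasurable_fun_o_infty mDi mfi).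
rewrite mul1e -/(s i) -/(s j).
set L := [set x | itv0 b%:E x /\ (s j)%:E < `|f x|].
(* On [(0, b)] the perturbation is smaller than the grid step, so [untie] exceeds [s j] exactly
   where [f] does in absolute value. Both sets are thus superlevel sets of [untie]. *)
have chain : E i `<=` L \/ L `<=` E i.
  have [sj|sj] := leP (s j) (untie_level b v n (be i)).
    left=> x [Jx ex]; split => //; rewrite ltNge; apply/negP => fx.
    have /andP[_] := untie_bounds v n Jx.
    have := stair_le_grid fx; rewrite -/(v x) => h1.
    have : (s j = j%:R / n.+1%:R + n.+1%:R^-1)%R by rewrite /s -natr1 mulrDl mul1r.
    by move=> sE /(lt_trans ex)/(le_lt_trans sj); rewrite sE ltrD2r ltNge h1.
  right=> x [Jx fx]; split => //; apply: lt_trans sj _.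
  have /andP[+ _] := untie_bounds v n Jx; apply: le_lt_trans.
  exact: stair_ge.
apply: (@le_trans _ _ (mine (be i)%:E (leb (L : set T)))).
  rewrite le_min; apply/andP; split.
    apply: (@le_trans _ _ (leb (`]0%R, be i]%classic : set T))).
      by apply: le_leb => x [[Ix sh] _]; rewrite /= in_itv/= Ix.1 h_le_be.
    rewrite lebE lebesgue_measure_itv/= lte_fin; case: ifP => _; last by rewrite lee_fin.
    by rewrite -EFinB subr0.
  rewrite -(distribution_cutoff _ _ (s0 j)) ?(ltW Ib.2)//.
  rewrite -[leRHS]leb_itv0 ?measure_ge0//.
  rewrite -(superlevel_rearr a0 _ (s0 j)); last exact: measurable_cutoff.
  by apply: le_leb => x [[Ix _] ?].
case: chain => H.
  apply: (@le_trans _ _ (be i)%:E); first by rewrite ge_min lexx.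
  rewrite -lebEi; apply: le_leb => x Ex; split; last by have [] := H x Ex.
  by split; [exact: (EI i x Ex)|exact: Ex].
apply: (@le_trans _ _ (leb (L : set T))); first by rewrite ge_min lexx orbT.
by apply: le_leb => x Lx; split; [split; [exact: (EI i x (H x Lx))|exact: H]|case: Lx].
Qed.

(** Only finitely many thresholds enter [stair n], and they are compared strictly, so each threshold
    exceeded by the limit is already exceeded at some finite index. *)
Lemma stair_eventually n (u : nat -> \bar R) (l : \bar R) :
  (forall i j, (i <= j)%N -> u i <= u j) -> (forall k, u k <= l) ->
  (forall s : R, (0 <= s)%R -> s%:E < l -> exists k, s%:E < u k) ->
  exists k0, forall k, (k0 <= k)%N -> stair n (u k) = stair n l.
Proof.
move=> ndu ul H.
have [k0 Hk0] : exists k0, forall i : nat, (i < n.+1 ^ 2)%N ->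
    (i.+1%:R / n.+1%:R)%:E < l -> (i.+1%:R / n.+1%:R)%:E < u k0.
  elim: (n.+1 ^ 2)%N => [|N [k1 IH]]; first by exists 0%N.
  have [Nl|lN] := ltP (N.+1%:R / n.+1%:R)%:E l; last first.
    exists k1 => i; rewrite ltnS leq_eqVlt => /predU1P[->|]; last exact: IH.
    by rewrite ltNge lN.
  have [|k2 Hk2] := H _ _ Nl; first by rewrite divr_ge0.
  exists (maxn k1 k2) => i; rewrite ltnS leq_eqVlt => /predU1P[->|iN].
    by move=> _; apply: lt_le_trans Hk2 _; apply: ndu; exact: leq_maxr.
  by move=> /(IH _ iN) /lt_le_trans; apply; apply: ndu; exact: leq_maxl.
exists k0 => k k0k; rewrite /stair; congr (_ * _)%R; apply: eq_bigr => i _.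
congr (nat_of_bool _)%:R; apply/idP/idP => [/lt_le_trans|]; first exact.
by move=> /(Hk0 _ (ltn_ord i)) /lt_le_trans; apply; exact: ndu.
Qed.

Lemma lt_rearr_cutoff (f : R -> \bar R) (s x : R) :
  measurable_fun (itv0 a : set T) (f : T -> \bar R) -> (0 <= s)%R ->
  s%:E < rearr a f x -> exists k, s%:E < rearr a (cutoff (itv0_seq a k) f) x.
Proof.
move=> mf s0; rewrite ltNge rearr_le// -ltNge => xs.
apply: contrapT => /forallNP H.
have Hk k : leb ([set y | itv0 (itv0_seq a k)%:E y /\ s%:E < `|f y|] : set T) <= x%:E.
  have := H k; rewrite ltNge => /negP; rewrite negbK rearr_le//; last exact: measurable_cutoff.
  by rewrite distribution_cutoff//; exact/ltW/(itv0_seq_in a_gt0 k).2.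
have Ik k : itv0 (itv0_seq a k)%:E `<=` itv0 a.
  by apply: itv0_le; exact/ltW/(itv0_seq_in a_gt0 k).2.
have mk k : measurable ([set y | itv0 (itv0_seq a k)%:E y /\ s%:E < `|f y|] : set T).
  apply: measurable_superlevel; apply: (measurable_funS (@measurable_itv0 R a) (Ik k)).
  exact: mf.
have UE : [set y | itv0 a y /\ s%:E < `|f y|] =
    \bigcup_k [set y | itv0 (itv0_seq a k)%:E y /\ s%:E < `|f y|].
  apply/seteqP; split => [y [Iy sf]|y [k _ [/Ik]]//].
  have [k yk] := itv0_seq_ex a_gt0 Iy.
  by exists k => //; split => //; split; [exact: Iy.1|rewrite lte_fin].
have : leb ([set y | itv0 (itv0_seq a k)%:E y /\ s%:E < `|f y|] : set T) @[k --> \oo] -->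
    distribution a f s.
  rewrite /Defs.distribution UE; apply: nondecreasing_cvg_mu.
  - exact: mk.
  - by apply: bigcup_measurable => k _; exact: mk.
  - move=> i j ij; apply/subsetPset => y [Jy sf]; split => //.
    by apply: itv0_le Jy; rewrite lee_fin itv0_seq_nd.
move=> /cvge_to_le/(_ (nearW _ Hk)); by rewrite leNgt xs.
Qed.

Lemma rearr_cutoff_le (f : R -> \bar R) (b b' x : R) : (b <= b')%R ->
  rearr a (cutoff b f) x <= rearr a (cutoff b' f) x.
Proof.
move=> bb'; apply: le_rearr => y _; rewrite /cutoff.
case: ifPn => [yb|_]; first by rewrite (lt_le_trans yb bb').
by rewrite abse0 abse_ge0.
Qed.

(** Two limits by Fatou's lemma lead from [realize_stair] to the rearrangement: over the staircase
    index [n] and, for fixed [n], over the cutoff index [k], where the integrand is eventually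
    constant at each point. *)
Lemma integral_rearr_le (f : R -> \bar R) K : (T0%:E < a) ->
  measurable_fun (itv0 a : set T) (f : T -> \bar R) ->
  (forall g : R -> R, L0 a g -> (forall x, (0 <= g x)%R) ->
     (forall t, itv0 a t -> rearr a (EFin \o g) t <= (h t)%:E) ->
     \int[leb]_(x in itv0 a) (`|f x| * (g x)%:E) <= K) ->
  \int[leb]_(x in itv0 a) (rearr a f x * (h x)%:E) <= K.
Proof.
move=> T0a mf HK.
have mI := @measurable_itv0 R a.
have mf' : measurable_fun (itv0 a : set T) (fun x : T => `|f x|).
  exact: (measurableT_comp (@abse_measurable R _) mf).
have mh : measurable_fun (itv0 a : set T) (EFin \o h : T -> \bar R).
  by apply/measurable_EFinP; exact: measurable_decreasing.
have mr := @measurable_rearr R a.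
have msh n : measurable_fun (itv0 a : set T) (fun x : T => (stair n (h x)%:E)%:E).
  exact: (measurable_stair n mh).
have [k0 T0k0] : exists k0, (T0 < itv0_seq a k0)%R.
  have [y T0y ya] := between_EFin T0a.
  have Iy : itv0 a y by split => //; exact: le_lt_trans T0y.
  by have [k0 yk0] := itv0_seq_ex a_gt0 Iy; exists k0; exact: lt_trans yk0.
apply: (@fatou_le R _ T leb (itv0 a)
  (fun n x => (stair n (rearr a f x))%:E * (stair n (h x)%:E)%:E)
  (fun x => rearr a f x * (h x)%:E)).
- exact: mI.
- by move=> n; apply: emeasurable_funM; [exact: (measurable_stair n (mr f))|exact: msh].
- by move=> n x Ix; rewrite mule_ge0// lee_fin stair_ge0.
- by move=> x Ix; apply: stairM_cvg; [exact: rearr_ge0|rewrite lee_fin h_ge0].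
move=> n.
apply: (@fatou_le R _ T leb (itv0 a)
  (fun k x => (stair n (rearr a (cutoff (itv0_seq a (k + k0)) f) x))%:E * (stair n (h x)%:E)%:E)
  (fun x => (stair n (rearr a f x))%:E * (stair n (h x)%:E)%:E)).
- exact: mI.
- by move=> k; apply: emeasurable_funM; [exact: (measurable_stair n (mr _))|exact: msh].
- by move=> k x Ix; rewrite mule_ge0// lee_fin stair_ge0.
- move=> x Ix.
  have [|||k1 Hk1] := @stair_eventually n
      (fun k => rearr a (cutoff (itv0_seq a k) f) x) (rearr a f x).
  + by move=> i j ij; apply: rearr_cutoff_le; exact: itv0_seq_nd.
  + move=> k; apply: le_rearr => y _; rewrite /cutoff; case: ifP => //.
    by rewrite abse0 abse_ge0.
  + by move=> s s0; exact: lt_rearr_cutoff.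
  apply: cvg_near_cst; near=> k; rewrite Hk1//.
  by rewrite (@leq_trans k)// ?leq_addr//; near: k; exact: nbhs_infty_ge.
move=> k; have Ik := itv0_seq_in a_gt0 (k + k0).
have T0k : (T0 < itv0_seq a (k + k0))%R.
  by apply: lt_le_trans T0k0 _; apply: itv0_seq_nd => //; exact: leq_addl.
have [g [mg g0 gh fg]] := realize_stair n Ik T0k mf.
apply: (le_trans fg); apply: le_trans (HK g mg g0 gh).
have mg' : measurable_fun (itv0 a : set T) (fun x : T => (g x)%:E).
  by apply/measurable_EFinP; exact: mg.
apply: ge0_le_integral.
- exact: mI.
- by move=> x Ix; rewrite mule_ge0 ?lee_fin ?stair_ge0 ?g0.
- by apply: emeasurable_funM; [exact: (measurable_stair n mf')|exact: mg'].
- by apply: emeasurable_funM; [exact: mf'|exact: mg'].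
- by move=> x Ix; apply: lee_wpmul2r; [rewrite lee_fin|exact: stair_le].
Unshelve. all: by end_near. Qed.

End realization.

(** * Orlicz functions and the upper bounds *)

Section orlicz_functions.
Context {R : realType} (phi : R -> R).
Hypothesis phi_orlicz : orlicz_function phi.

Lemma orlicz0 : phi 0%R = 0%R.
Proof. by case: phi_orlicz. Qed.

Lemma orlicz_gt0 t : (0 < t)%R -> (0 < phi t)%R.
Proof. by case: phi_orlicz => _ _; exact. Qed.

Lemma orlicz_ge0 t : (0 <= t)%R -> (0 <= phi t)%R.
Proof.
rewrite le_eqVlt => /predU1P[<-|/orlicz_gt0/ltW//]; by rewrite orlicz0.
Qed.

Lemma orlicz_convex (l x y : R) : (0 <= l <= 1)%R -> (0 <= x)%R -> (0 <= y)%R ->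
  (phi (l * x + (1 - l) * y) <= l * phi x + (1 - l) * phi y)%R.
Proof.
move=> /andP[l0 l1] x0 y0; case: phi_orlicz => cphi _ _.
have := cphi (Itv01 l0 l1) x y; rewrite !inE/= !convRE/=.
by rewrite /unstable.onem; apply.
Qed.

Lemma orlicz_scale (l x : R) : (0 <= l <= 1)%R -> (0 <= x)%R ->
  (phi (l * x) <= l * phi x)%R.
Proof.
move=> l01 x0; have := orlicz_convex l01 x0 (lexx 0%R).
by rewrite orlicz0 !mulr0 !addr0.
Qed.

Lemma orlicz_nd (s t : R) : (0 <= s)%R -> (s <= t)%R -> (phi s <= phi t)%R.
Proof.
move=> s0 st; have [t0|t0] := leP t 0%R.
  by have -> : s = t by apply/eqP; rewrite eq_le st (le_trans t0 s0).
have l01 : (0 <= s / t <= 1)%R.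
  by rewrite divr_ge0 ?(ltW t0)//= ler_pdivrMr// mul1r.
have := orlicz_scale l01 (ltW t0); rewrite divfK ?gt_eqF// => /le_trans; apply.
rewrite ler_piMl ?orlicz_ge0 ?(ltW t0)//; by case/andP: l01.
Qed.

Lemma er_map_orlicz_ge0 x : 0 <= x -> 0 <= er_map phi x.
Proof. by case: x => [x||]//=; rewrite !lee_fin; exact: orlicz_ge0. Qed.

Lemma er_map_orlicz_nd x y : 0 <= x -> x <= y -> er_map phi x <= er_map phi y.
Proof.
case: x => [x||]//; case: y => [y||]//=; rewrite ?lee_fin ?leey//.
exact: orlicz_nd.
Qed.

Lemma complementary_ge0 x : 0 <= complementary phi x.
Proof.
by apply: ereal_sup_ubound; exists 0%R => //=; rewrite mul0e orlicz0 sube0.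
Qed.

Lemma complementary_nd x y : x <= y -> complementary phi x <= complementary phi y.
Proof.
move=> xy; apply: ge_ereal_sup => _ [s /= s0 <-].
apply: (@le_trans _ _ (s%:E * y - (phi s)%:E)).
  by apply: leeD2r; apply: lee_wpmul2l => //; rewrite lee_fin.
by apply: ereal_sup_ubound; exists s.
Qed.

Lemma young (x y : \bar R) : 0 <= x -> 0 <= y ->
  x * y <= er_map phi y + complementary phi x.
Proof.
move=> x0; case: y => [y||]// y0 /=.
  rewrite addeC -leeBlDr// muleC; apply: ereal_sup_ubound; exists y => //=.
rewrite addye ?leey// gt_eqF// (@lt_le_trans _ _ 0)//; exact: complementary_ge0.
Qed.

End orlicz_functions.

(** * Upper bound for the pairing *)

Section pairing.
Context {R : realType} (a : \bar R) (phi w v : R -> R).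
Local Notation T := (lebesgue_type R).
Hypothesis a_ge0 : 0 <= a.
Hypothesis phi_orlicz : orlicz_function phi.
Hypothesis w_pos : positive_on a w.
Hypothesis w_decr : decreasing_on a w.
Hypothesis v_pos : positive_on a v.
Hypothesis v_decr : decreasing_on a v.
Hypothesis vw : forall x, itv0 a x ->
  \int[leb]_(y in `]0%R, x[) (v y)%:E <= \int[leb]_(y in `]0%R, x[) (w y)%:E.

Lemma measurable_div_weight (p : R -> \bar R) :
  measurable_fun (itv0 a : set T) (p : T -> \bar R) ->
  measurable_fun (itv0 a : set T) ((fun x => p x / (v x)%:E) : T -> \bar R).
Proof.
(* The double negation exhibits [(v x)^-1] as the opposite of a decreasing function. *)
move=> mp; apply: (@eq_measurable_fun _ _ T _ _ (fun x => p x * (- (- (v x)^-1))%:E)).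
  move=> x; rewrite inE => Ix.
  by rewrite opprK inver gt_eqF// v_pos// inE.
apply: emeasurable_funM; first exact: mp.
apply/measurable_EFinP; apply: measurableT_comp; first exact: oppr_measurable.
apply: measurable_decreasing => x y; rewrite !inE => Ix Iy xy.
by rewrite lerN2 lef_pV2 ?posrE ?v_pos ?inE// v_decr ?inE.
Qed.

Lemma measurable_Mmod (p : R -> \bar R) :
  measurable_fun (itv0 a : set T) (p : T -> \bar R) ->
  measurable_fun (itv0 a : set T)
    ((fun x => complementary phi (p x / (v x)%:E) * (v x)%:E) : T -> \bar R).
Proof.
move=> mp; apply: emeasurable_funM; last first.
  by apply/measurable_EFinP; exact: measurable_decreasing.
apply: measurableT_comp; last exact: measurable_div_weight.
by apply: measurable_enondecreasing; exact: complementary_nd.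
Qed.

Lemma er_map_rearr_edecreasing (f : R -> \bar R) :
  edecreasing_on a (fun x => er_map phi (rearr a f x)).
Proof.
by move=> x y _ _ xy; apply: er_map_orlicz_nd => //; [exact: rearr_ge0|exact: rearr_anti].
Qed.

Lemma Mmod_ge0 (u : R -> R) (f : R -> \bar R) : positive_on a u -> 0 <= Mmod a phi u f.
Proof.
move=> u_pos; apply: integral_ge0 => x Ix; rewrite mule_ge0//.
  exact: complementary_ge0.
by rewrite lee_fin ltW// u_pos// inE.
Qed.

Lemma Phi_ge0 (f : R -> \bar R) : 0 <= Phi a phi w f.
Proof.
apply: integral_ge0 => x Ix; rewrite mule_ge0//.
  by apply: er_map_orlicz_ge0 => //; exact: rearr_ge0.
by rewrite lee_fin ltW// w_pos// inE.
Qed.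

(** Both relaxations, [f] submajorized by [f'] and [v] by [w], are treated at once: all upper bounds
    are instances with [f' = f] or [v = w]. Young's inequality is applied to [f'^* / v] and [g^*]
    under the weight [v]; Hardy's inequality replaces [v] by [w] because [phi] of a rearrangement
    decreases. *)
Lemma pairing_le (f f' g : R -> \bar R) (s t : R) :
  measurable_fun (itv0 a : set T) (f : T -> \bar R) ->
  measurable_fun (itv0 a : set T) (g : T -> \bar R) ->
  submaj a f f' -> (0 < s)%R -> (0 < t)%R ->
  \int[leb]_(x in itv0 a) (`|f x| * `|g x|) <=
  (s * t)%:E * (Phi a phi w (escale s^-1 g) + Mmod a phi v (escale t^-1 f')).
Proof.
move=> mf mg ff' s0 t0; have mI := @measurable_itv0 R a.
have mr := @measurable_rearr R a; have r0 h x : itv0 a x -> 0 <= rearr a h x by move=> _; exact: rearr_ge0.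
apply: le_trans (hardy_littlewood a_ge0 mf mg) _.
apply: le_trans (hardy_le a_ge0 (mr f) (mr f') (r0 f) (r0 f')
  (@rearr_edecreasing R a g) (r0 g) ff') _.
have si : (0 < s^-1)%R by rewrite invr_gt0.
have ti : (0 < t^-1)%R by rewrite invr_gt0.
pose y := rearr a (escale s^-1 g); pose x := rearr a (escale t^-1 f').
have yE z : rearr a g z = s%:E * y z.
  by rewrite /y rearr_scale// muleA -EFinM mulfV ?gt_eqF// mul1e.
have xE z : rearr a f' z = t%:E * x z.
  by rewrite /x rearr_scale// muleA -EFinM mulfV ?gt_eqF// mul1e.
have mv : measurable_fun (itv0 a : set T) (fun z : T => (v z)%:E).
  by apply/measurable_EFinP; exact: measurable_decreasing.
have mw : measurable_fun (itv0 a : set T) (fun z : T => (w z)%:E).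
  by apply/measurable_EFinP; exact: measurable_decreasing.
have v0 z : itv0 a z -> 0 <= (v z)%:E by move=> Iz; rewrite lee_fin ltW// v_pos// inE.
have w0 z : itv0 a z -> 0 <= (w z)%:E by move=> Iz; rewrite lee_fin ltW// w_pos// inE.
pose A z := er_map phi (y z) * (v z)%:E.
pose B z := complementary phi (x z / (v z)%:E) * (v z)%:E.
have phiy0 z : itv0 a z -> 0 <= er_map phi (y z).
  by move=> _; apply: er_map_orlicz_ge0 => //; exact: rearr_ge0.
have A0 z : itv0 a z -> 0 <= A z by move=> Iz; rewrite mule_ge0 ?v0// phiy0.
have B0 z : itv0 a z -> 0 <= B z.
  by move=> Iz; rewrite mule_ge0 ?v0//; exact: complementary_ge0.
have mphi : measurable_fun (itv0 a : set T) (fun z : T => er_map phi (y z)).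
  by apply: measurable_edecreasing; exact: er_map_rearr_edecreasing.
have mA : measurable_fun (itv0 a : set T) (A : T -> \bar R).
  by apply: emeasurable_funM; [exact: mphi|exact: mv].
have mB : measurable_fun (itv0 a : set T) (B : T -> \bar R).
  exact: (measurable_Mmod (mr _)).
have st0 : (0 <= s * t)%R by rewrite mulr_ge0// ltW.
apply: (@le_trans _ _ (\int[leb]_(z in itv0 a) ((s * t)%:E * (A z + B z)))).
  apply: ge0_le_integral.
  - exact: mI.
  - by move=> z Iz; rewrite mule_ge0 ?r0.
  - by apply: emeasurable_funM; [exact: (mr f')|exact: (mr g)].
  - apply: emeasurable_funM; first exact: measurable_cst.
    by apply: emeasurable_funD; [exact: mA|exact: mB].
  move=> z Iz; rewrite xE yE muleACA -EFinM [(t * s)%R]mulrC.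
  apply: lee_wpmul2l; first by rewrite lee_fin.
  have vz : (0 < v z)%R by rewrite v_pos// inE.
  have xz0 : 0 <= x z by exact: rearr_ge0.
  have yz0 : 0 <= y z by exact: rearr_ge0.
  have xv0 : 0 <= x z / (v z)%:E by rewrite inver gt_eqF// mule_ge0// lee_fin invr_ge0 ltW.
  rewrite [leLHS](_ : _ = (x z / (v z)%:E) * y z * (v z)%:E); last first.
    rewrite inver gt_eqF// -(muleA _ (y z)) (muleC (y z)) muleA -(muleA _ _ (v z)%:E).
    by rewrite -EFinM mulVf ?gt_eqF// mule1.
  rewrite /A /B -ge0_muleDl ?phiy0//; last exact: complementary_ge0.
  by apply: lee_wpmul2r; [exact: v0|exact: young].
have AB0 z : itv0 a z -> 0 <= A z + B z by move=> Iz; rewrite adde_ge0 ?A0 ?B0.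
have mAB : measurable_fun (itv0 a : set T) (fun z : T => A z + B z).
  by apply: emeasurable_funD; [exact: mA|exact: mB].
rewrite (ge0_integralZl_EFin leb mI AB0 mAB st0).
apply: lee_wpmul2l; first by rewrite lee_fin.
rewrite (ge0_integralD leb mI A0 mA B0 mB).
apply: leeD; last by [].
rewrite /A /Phi -/y.
under eq_integral do rewrite muleC.
under [leRHS]eq_integral do rewrite muleC.
apply: (hardy_le a_ge0 mv mw v0 w0 _ phiy0 vw).
exact: er_map_rearr_edecreasing.
Qed.

End pairing.

(** * Koethe norms and decreasing test functions *)

Lemma escale1 {R : realType} (f : R -> \bar R) : escale 1 f = f.
Proof. by apply/funext => x; rewrite /escale mul1e. Qed.

Lemma escaleM {R : realType} (c c' : R) (f : R -> \bar R) :
  escale c (escale c' f) = escale (c * c') f.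
Proof. by apply/funext => x; rewrite /escale muleA -EFinM. Qed.

Lemma le_addgt0_mul {R : realType} (x c : \bar R) : 0 <= c ->
  (forall e : R, (0 < e)%R -> x <= (1 + e)%:E * c) -> x <= c.
Proof.
case: c => [c||]//; last by move=> _ _; exact: leey.
rewrite lee_fin => c0 H; apply/lee_addgt0Pr => e e0.
have c1 : (0 < c + 1)%R by rewrite ltr_wpDl.
apply: le_trans (H (e / (c + 1))%R _) _; first by rewrite divr_gt0.
rewrite -EFinM -EFinD lee_fin mulrDl mul1r lerD2l mulrAC ler_pdivrMr//.
by rewrite ler_wpM2l ?(ltW e0)// lerDl.
Qed.

Section duality.
Context {R : realType} (a : \bar R) (phi w : R -> R).
Local Notation T := (lebesgue_type R).
Hypothesis a_gt0 : 0 < a.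
Hypothesis phi_orlicz : orlicz_function phi.
Hypothesis w_pos : positive_on a w.
Hypothesis w_decr : decreasing_on a w.
Hypothesis w_int : forall t, itv0 a t -> \int[leb]_(x in `]0%R, t[) (w x)%:E < +oo.

Let a_ge0 := ltW a_gt0.

Section upper.
Variables (f : R -> R) (m : R -> \bar R).
Hypothesis m_ge0 : forall t, 0 <= m t.
Hypothesis pair : forall g s t, L0 a g -> (0 < s)%R -> (0 < t)%R ->
  \int[leb]_(x in itv0 a) (`|f x * g x|%R)%:E <=
  (s * t)%:E * (Phi a phi w (escale s^-1 (EFin \o g)) + m t).

Lemma kothe_lux_le t : (0 < t)%R ->
  kothe_norm a (Lambda a phi w) (Lambda_norm a phi w) f <= t%:E * (1 + m t).
Proof.
move=> t0; apply: ge_ereal_sup => _ [g [[mg _] /= gN] <-].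
have c0 : 0 <= t%:E * (1 + m t).
  by rewrite mule_ge0 ?lee_fin ?(ltW t0)// adde_ge0.
apply: le_addgt0_mul => // e e0.
have /ereal_inf_lt[_ [l [l0 Pl] <-]] : Lambda_norm a phi w (EFin \o g) < (1 + e)%:E.
  by apply: le_lt_trans gN _; rewrite lte_fin ltrDl.
rewrite lte_fin => le.
apply: le_trans (pair mg l0 t0) _; rewrite EFinM -muleA.
apply: (@le_trans _ _ (l%:E * (t%:E * (1 + m t)))).
  apply: lee_wpmul2l; first by rewrite lee_fin ltW.
  apply: lee_wpmul2l; first by rewrite lee_fin ltW.
  exact: leeD2r.
by apply: lee_wpmul2r => //; rewrite lee_fin ltW.
Qed.

(** From [c >= 1], [Phi + c] is at most [c * (1 + Phi)]. The choice [c = 1] gives the norm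
    inequality, a large [c] gives finiteness when the modular is only finite. *)
Lemma kothe_ame_le (t c : R) : (0 < t)%R -> (1 <= c)%R -> m t <= c%:E ->
  kothe_norm a (Lambda a phi w) (Lambda_norm0 a phi w) f <= (t * c)%:E.
Proof.
move=> t0 c1 mt; have c0 : (0 <= c)%R by exact: le_trans c1.
apply: ge_ereal_sup => _ [g [[mg _] /= gN] <-].
apply: le_addgt0_mul => [|e e0]; first by rewrite lee_fin mulr_ge0// ltW.
have /ereal_inf_lt[_ [s s0 <-] sg] : Lambda_norm0 a phi w (EFin \o g) < (1 + e)%:E.
  by apply: le_lt_trans gN _; rewrite lte_fin ltrDl.
have P0 := Phi_ge0 phi_orlicz w_pos (escale s^-1 (EFin \o g)).
apply: le_trans (pair mg s0 t0) _; rewrite mulrC EFinM -muleA EFinM [leRHS]muleCA.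
apply: lee_wpmul2l; first by rewrite lee_fin ltW.
apply: (@le_trans _ _ (s%:E * (1 + Phi a phi w (escale s^-1 (EFin \o g))) * c%:E)).
  rewrite -muleA; apply: lee_wpmul2l; first by rewrite lee_fin ltW.
  rewrite ge0_muleDl// mul1e addeC; apply: leeD => //.
  by rewrite -[leLHS]mule1; apply: lee_wpmul2l.
by apply: lee_wpmul2r; [rewrite lee_fin|exact: ltW].
Qed.

End upper.

(* Decreasing test functions, bounded and vanishing outside a compact subset
   of [0, a): the competitors in the dual problem. *)
Definition test_fun (h : R -> R) :=
  [/\ decreasing_on a h, forall x, itv0 a x -> (0 <= h x)%R,
      exists T0 : R, [/\ (0 <= T0)%R, T0%:E < a &
        forall x, itv0 a x -> (T0 <= x)%R -> h x = 0%R] &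
      exists M : R, forall x, itv0 a x -> (h x <= M)%R].

Definition modular (h : R -> R) : \bar R :=
  \int[leb]_(x in itv0 a) (phi (h x) * w x)%:E.

Definition pairing (f : R -> R) (h : R -> R) : \bar R :=
  \int[leb]_(x in itv0 a) (rearr a (EFin \o f) x * (h x)%:E).

Lemma measurable_weight : measurable_fun (itv0 a : set T) (fun x : T => (w x)%:E).
Proof. by apply/measurable_EFinP; exact: measurable_decreasing. Qed.

Lemma weight_ge0 x : itv0 a x -> (0 <= w x)%R.
Proof. by move=> Ix; rewrite ltW// w_pos// inE. Qed.

Lemma measurable_modular h : test_fun h ->
  measurable_fun (itv0 a : set T) (fun x : T => (phi (h x) * w x)%:E).
Proof.
move=> [hd h0 _ _]; apply/measurable_EFinP; apply: measurable_decreasing => x y Ix Iy xy.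
rewrite !inE in Ix Iy; apply: ler_pM.
- by apply: orlicz_ge0 => //; exact: h0.
- exact: weight_ge0.
- by apply: orlicz_nd => //; [exact: h0|rewrite hd ?inE].
- by rewrite w_decr ?inE.
Qed.

Lemma modular_ge0 h : test_fun h -> 0 <= modular h.
Proof.
move=> [_ h0 _ _]; apply: integral_ge0 => x Ix.
by rewrite lee_fin mulr_ge0 ?(orlicz_ge0 phi_orlicz) ?h0 ?weight_ge0.
Qed.

Lemma pairing_ge0 f h : test_fun h -> 0 <= pairing f h.
Proof.
move=> [_ h0 _ _]; apply: integral_ge0 => x Ix.
by rewrite mule_ge0 ?rearr_ge0// lee_fin h0.
Qed.

Lemma Phi_le_modular g h : test_fun h ->
  (forall t, itv0 a t -> rearr a (EFin \o g) t <= (h t)%:E) ->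
  Phi a phi w (EFin \o g) <= modular h.
Proof.
move=> th gh; have [_ h0 _ _] := th; apply: ge0_le_integral.
- exact: (@measurable_itv0 R a).
- move=> x Ix; rewrite mule_ge0 ?lee_fin ?weight_ge0//.
  by apply: er_map_orlicz_ge0 => //; exact: rearr_ge0.
- apply: emeasurable_funM; last exact: measurable_weight.
  by apply: measurable_edecreasing; exact: er_map_rearr_edecreasing.
- exact: measurable_modular.
- move=> x Ix; rewrite EFinM; apply: lee_wpmul2r; first by rewrite lee_fin weight_ge0.
  rewrite -[leRHS]/(er_map phi (h x)%:E).
  by apply: er_map_orlicz_nd => //; [exact: rearr_ge0|exact: gh].
Qed.

(** The part common to the two norms: all that depends on [N] is the factor [c] normalizing a
    function [g] whose modular is at most that of [h]. *)
Lemma pairing_le_kothe N f h K : L0 a f -> test_fun h -> 0 <= K ->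
  (forall g, Lambda a phi w g -> Phi a phi w (EFin \o g) <= modular h ->
     exists2 c : R, (0 < c)%R & N (escale c^-1 (EFin \o g)) <= 1 /\
       c%:E * kothe_norm a (Lambda a phi w) N f <= K) ->
  modular h < +oo -> pairing f h <= K.
Proof.
move=> mf th K0 HN hoo; have [hd h0 [T0 [T00 T0a hT0]] _] := th.
have mf' : measurable_fun (itv0 a : set T) (EFin \o f : T -> \bar R).
  by apply/measurable_EFinP; exact: mf.
apply: (integral_rearr_le a_gt0 hd h0 T00 hT0 T0a mf') => g mg g0 gh.
have Pg : Phi a phi w (EFin \o g) <= modular h by exact: Phi_le_modular.
have Lg : Lambda a phi w g.
  split => //; exists 1%R => //; rewrite escale1; exact: le_lt_trans Pg hoo.
have [c c0 [Ng cK]] := HN g Lg Pg.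
apply: le_trans cK.
have ci : (0 < c^-1)%R by rewrite invr_gt0.
have Lcg : Lambda a phi w (fun x => c^-1 * g x)%R.
  split; first by apply: measurable_funM; [exact: measurable_cst|exact: mg].
  have [_ [l l0 lP]] := Lg; exists (l * c)%R; first by rewrite mulr_gt0.
  rewrite (_ : escale _ _ = escale l (EFin \o g))//; apply/funext => x.
  by rewrite /escale /= -!EFinM mulrA mulfK// gt_eqF.
have Ncg : N (EFin \o (fun x => c^-1 * g x)%R) <= 1.
  by rewrite (_ : _ \o _ = escale c^-1 (EFin \o g)).
have : \int[leb]_(x in itv0 a) (`|f x * (c^-1 * g x)|%R)%:E <=
    kothe_norm a (Lambda a phi w) N f.
  by apply: ereal_sup_ubound; exists (fun x => c^-1 * g x)%R.
move=> /(lee_wpmul2l (_ : 0 <= c%:E)); rewrite lee_fin (ltW c0) => /(_ isT).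
apply: le_trans.
rewrite -(ge0_integralZl_EFin leb (@measurable_itv0 R a)); last 3 first.
- by move=> x Ix; rewrite lee_fin.
- apply/measurable_EFinP; apply: measurableT_comp; first exact: normr_measurable.
  apply: measurable_funM; first exact: mf.
  by apply: measurable_funM; [exact: measurable_cst|exact: mg].
- exact: ltW.
rewrite le_eqVlt; apply/orP; left; apply/eqP; apply: eq_integral => x _.
rewrite -EFinM /= -EFinM; congr EFin.
by rewrite !normrM (gtr0_norm ci) (ger0_norm (g0 x)) [RHS]mulrCA mulVKf ?gt_eqF.
Qed.

Lemma pairing_le_ame f h K : L0 a f -> test_fun h -> modular h < +oo ->
  kothe_norm a (Lambda a phi w) (Lambda_norm0 a phi w) f <= K%:E -> (0 <= K)%R ->
  pairing f h <= K%:E * (1 + modular h).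
Proof.
move=> mf th hoo fK K0.
have hfin : modular h \is a fin_num by rewrite ge0_fin_numE// modular_ge0.
have h0 := modular_ge0 th.
apply: (pairing_le_kothe (N := Lambda_norm0 a phi w)) => //.
  by rewrite mule_ge0 ?lee_fin// adde_ge0.
move=> g Lg Pg.
have h00 : (0 <= fine (modular h))%R by rewrite fine_ge0.
(* The scale [c^-1] in the Amemiya infimum of [g / c] gives [c^-1 * (1 + Phi g)], which is at most 1
   for this [c]. *)
exists (1 + fine (modular h))%R; first by rewrite ltr_wpDr.
split.
  have c0 : (0 < 1 + fine (modular h))%R by rewrite ltr_wpDr.
  apply: (@le_trans _ _ ((1 + fine (modular h))^-1%:E * (1 + Phi a phi w (EFin \o g)))).
    have cK : escale (1 + fine (modular h))^-1^-1 (escale (1 + fine (modular h))^-1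
        (EFin \o g)) = EFin \o g.
      by rewrite escaleM mulVf ?escale1// invr_neq0// gt_eqF.
    apply: ereal_inf_lbound; exists (1 + fine (modular h))^-1%R.
      by rewrite /= invr_gt0.
    by rewrite cK.
  rewrite lee_pdivrMl// mule1 EFinD fineK//; exact: leeD2l.
rewrite EFinD fineK// muleC; apply: lee_wpmul2r => //; by rewrite adde_ge0.
Qed.

Lemma pairing_le_lux f h K : L0 a f -> test_fun h -> modular h <= 1 ->
  kothe_norm a (Lambda a phi w) (Lambda_norm a phi w) f <= K%:E -> (0 <= K)%R ->
  pairing f h <= K%:E.
Proof.
move=> mf th h1 fK K0.
apply: (pairing_le_kothe (N := Lambda_norm a phi w)) => //; last first.
  by apply: le_lt_trans h1 _; rewrite ltry.
move=> g Lg Pg; exists 1%R => //; rewrite invr1 escale1 mul1e; split => //.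
apply: ereal_inf_lbound; exists 1%R => //; split => //.
by rewrite invr1 escale1; exact: le_trans h1.
Qed.

Lemma test_fun_bound h : test_fun h -> exists2 T1, itv0 a T1 &
  forall x, itv0 a x -> (T1 <= x)%R -> h x = 0%R.
Proof.
move=> [_ _ [T0 [T00 T0a hT0]] _]; have [T1 T01 T1a] := between_EFin T0a.
exists T1; first by split => //; exact: le_lt_trans T01.
by move=> x Ix /(le_trans (ltW T01)); exact: hT0.
Qed.

Lemma integral_vanish (p : R -> \bar R) (b : R) : itv0 a b ->
  (forall x, itv0 a x -> (b <= x)%R -> p x = 0) ->
  \int[leb]_(x in itv0 a) p x = \int[leb]_(x in `]0%R, b[) p x.
Proof.
move=> Ib p0.
have -> : `]0%R, b[%classic = itv0 a `&` `]0%R, b[%classic.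
  by rewrite setIidr//; apply: itvoo_sub_itv0 => //; exact/ltW/Ib.2.
rewrite [RHS]integral_mkcondr; apply: eq_integral => x; rewrite inE => Ix.
rewrite patchE; case: ifPn => // /negP; rewrite inE/= in_itv/= Ix.1/= => /negP.
by rewrite -leNgt => /(p0 _ Ix) ->.
Qed.

Lemma modular_lty h : test_fun h -> modular h < +oo.
Proof.
move=> th; have [T1 IT1 hT1] := test_fun_bound th.
have [hd h0 _ [M hM]] := th.
have M0 : (0 <= M)%R by apply: le_trans (hM _ IT1); exact: h0.
rewrite /modular (integral_vanish IT1); last first.
  by move=> x Ix /(hT1 _ Ix) ->; rewrite (orlicz0 phi_orlicz) mul0r.
have sub : `]0%R, T1[%classic `<=` itv0 a.
  by apply: itvoo_sub_itv0 => //; exact/ltW/IT1.2.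
have mI := @measurable_itv0 R a.
have mw := measurable_funS mI sub measurable_weight.
have pM := orlicz_ge0 phi_orlicz M0.
apply: (@le_lt_trans _ _ (\int[leb]_(x in `]0%R, T1[) ((phi M)%:E * (w x)%:E))).
  apply: ge0_le_integral.
  - exact: measurable_itv_leb.
  - move=> x /sub Ix; rewrite lee_fin mulr_ge0 ?weight_ge0//.
    by apply: orlicz_ge0 => //; exact: h0.
  - exact: (measurable_funS mI sub (measurable_modular th)).
  - by apply: emeasurable_funM; [exact: measurable_cst|exact: mw].
  - move=> x /sub Ix; rewrite -EFinM lee_fin ler_wpM2r ?weight_ge0//.
    by apply: orlicz_nd => //; [exact: h0|exact: hM].
rewrite (ge0_integralZl_EFin leb (measurable_itv_leb _)).
- by rewrite lte_mul_pinfty ?lee_fin// w_int.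
- by move=> x /sub Ix; rewrite lee_fin weight_ge0.
- exact: mw.
- exact: pM.
Qed.

Lemma modular_fin h : test_fun h -> modular h = (fine (modular h))%:E.
Proof. by move=> th; rewrite fineK// ge0_fin_numE ?modular_ge0// modular_lty. Qed.

Lemma test_fun0 : test_fun (fun=> 0%R).
Proof.
split=> //; last by exists 0%R.
by exists 0%R; split.
Qed.

Lemma test_fun_mix (l1 l2 : R) h1 h2 : (0 <= l1)%R -> (0 <= l2)%R ->
  test_fun h1 -> test_fun h2 -> test_fun (fun x => l1 * h1 x + l2 * h2 x)%R.
Proof.
move=> l10 l20 [hd1 h10 [T1 [T10 T1a hT1]] [M1 hM1]] [hd2 h20 [T2 [T20 T2a hT2]] [M2 hM2]].
split.
- by move=> x y Ix Iy xy; rewrite lerD// ler_wpM2l// ?hd1 ?hd2.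
- by move=> x Ix; rewrite addr_ge0// mulr_ge0// ?h10 ?h20.
- exists (Num.max T1 T2); split; first by rewrite le_max T10.
    exact: max_lt_EFin.
  by move=> x Ix; rewrite ge_max => /andP[xT1 xT2]; rewrite hT1// hT2// !mulr0 addr0.
- exists (l1 * M1 + l2 * M2)%R => x Ix; rewrite lerD// ler_wpM2l// ?hM1 ?hM2//.
Qed.

Lemma measurable_pairing f h : test_fun h ->
  measurable_fun (itv0 a : set T) (fun x : T => rearr a (EFin \o f) x * (h x)%:E).
Proof.
move=> [hd _ _ _]; apply: emeasurable_funM; first exact: (@measurable_rearr R a).
by apply/measurable_EFinP; exact: measurable_decreasing.
Qed.

Lemma pairing_mix f (l1 l2 : R) h1 h2 : (0 <= l1)%R -> (0 <= l2)%R ->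
  test_fun h1 -> test_fun h2 ->
  pairing f (fun x => l1 * h1 x + l2 * h2 x)%R =
  l1%:E * pairing f h1 + l2%:E * pairing f h2.
Proof.
move=> l10 l20 th1 th2; have [_ h10 _ _] := th1; have [_ h20 _ _] := th2.
have mI := @measurable_itv0 R a.
have m1 := measurable_pairing f th1; have m2 := measurable_pairing f th2.
have p1 x : itv0 a x -> 0 <= rearr a (EFin \o f) x * (h1 x)%:E.
  by move=> Ix; rewrite mule_ge0 ?rearr_ge0// lee_fin h10.
have p2 x : itv0 a x -> 0 <= rearr a (EFin \o f) x * (h2 x)%:E.
  by move=> Ix; rewrite mule_ge0 ?rearr_ge0// lee_fin h20.
rewrite /pairing -(ge0_integralZl_EFin leb mI p1 m1 l10).
rewrite -(ge0_integralZl_EFin leb mI p2 m2 l20).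
rewrite -(ge0_integralD leb mI).
- apply: eq_integral => x; rewrite inE => Ix.
  rewrite EFinD !EFinM ge0_muleDr; first by rewrite muleCA [X in _ + X]muleCA.
  + by rewrite mule_ge0// lee_fin// h10.
  + by rewrite mule_ge0// lee_fin// h20.
- by move=> x Ix; rewrite mule_ge0 ?lee_fin ?p1.
- by apply: emeasurable_funM; [exact: measurable_cst|exact: m1].
- by move=> x Ix; rewrite mule_ge0 ?lee_fin ?p2.
- by apply: emeasurable_funM; [exact: measurable_cst|exact: m2].
Qed.

Lemma modular_mix (l : R) h1 h2 : (0 <= l <= 1)%R ->
  test_fun h1 -> test_fun h2 ->
  modular (fun x => l * h1 x + (1 - l) * h2 x)%R <=
  l%:E * modular h1 + (1 - l)%:E * modular h2.
Proof.
move=> l01 th1 th2; have [_ h10 _ _] := th1; have [_ h20 _ _] := th2.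
have mI := @measurable_itv0 R a; have /andP[l0 l1] := l01.
have l1' : (0 <= 1 - l)%R by rewrite subr_ge0.
have th := test_fun_mix l0 l1' th1 th2.
have m1 := measurable_modular th1; have m2 := measurable_modular th2.
have p1 x : itv0 a x -> 0 <= (phi (h1 x) * w x)%:E.
  by move=> Ix; rewrite lee_fin mulr_ge0 ?(orlicz_ge0 phi_orlicz) ?h10 ?weight_ge0.
have p2 x : itv0 a x -> 0 <= (phi (h2 x) * w x)%:E.
  by move=> Ix; rewrite lee_fin mulr_ge0 ?(orlicz_ge0 phi_orlicz) ?h20 ?weight_ge0.
rewrite /modular -(ge0_integralZl_EFin leb mI p1 m1 l0).
rewrite -(ge0_integralZl_EFin leb mI p2 m2 l1').
have q1 x : itv0 a x -> 0 <= l%:E * (phi (h1 x) * w x)%:E.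
  by move=> Ix; apply: mule_ge0; [rewrite lee_fin|exact: p1].
have q2 x : itv0 a x -> 0 <= (1 - l)%:E * (phi (h2 x) * w x)%:E.
  by move=> Ix; apply: mule_ge0; [rewrite lee_fin|exact: p2].
have n1 : measurable_fun (itv0 a : set T) (fun x : T => l%:E * (phi (h1 x) * w x)%:E).
  by apply: emeasurable_funM; [exact: measurable_cst|exact: m1].
have n2 : measurable_fun (itv0 a : set T) (fun x : T => (1 - l)%:E * (phi (h2 x) * w x)%:E).
  by apply: emeasurable_funM; [exact: measurable_cst|exact: m2].
rewrite -(ge0_integralD leb mI q1 n1 q2 n2).
apply: ge0_le_integral.
- exact: mI.
- move=> x Ix; have [_ hh0 _ _] := th.
  by rewrite lee_fin mulr_ge0 ?(orlicz_ge0 phi_orlicz) ?hh0 ?weight_ge0.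
- exact: (measurable_modular th).
- by apply: emeasurable_funD; [exact: n1|exact: n2].
- move=> x Ix; rewrite -!EFinM -EFinD lee_fin !mulrA -mulrDl ler_wpM2r ?weight_ge0//.
  by apply: orlicz_convex => //; [exact: h10|exact: h20].
Qed.

(** When the modular [b] of [h] exceeds 1, convexity with the zero function shows that [h / b] has
    modular at most 1. The Luxemburg norm thus yields the same affine growth in the modular as the
    Amemiya norm, and this growth is what the level function requires. *)
Lemma pairing_growth_lux f h K : L0 a f -> test_fun h ->
  kothe_norm a (Lambda a phi w) (Lambda_norm a phi w) f <= K%:E -> (0 <= K)%R ->
  pairing f h <= K%:E * (1 + modular h).
Proof.
move=> mf th fK K0; have h0 := modular_ge0 th.
have [h1|h1] := leP (modular h) 1.
  apply: le_trans (pairing_le_lux mf th h1 fK K0) _.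
  rewrite -[leLHS]mule1; apply: lee_wpmul2l; first by rewrite lee_fin.
  exact: leeDl.
have hE := modular_fin th; set b := fine (modular h) in hE.
have b1 : (1 < b)%R by rewrite -lte_fin -hE.
have b0 : (0 < b)%R by exact: lt_trans b1.
have bi : (0 <= b^-1 <= 1)%R by rewrite invr_ge0 ltW//= invf_le1 ?ltW.
have /andP[bi0 bi1] := bi.
have bi2 : (0 <= 1 - b^-1)%R by rewrite subr_ge0.
have tm := test_fun_mix bi0 bi2 th test_fun0.
have mm : modular (fun x => b^-1 * h x + (1 - b^-1) * 0)%R <= 1.
  apply: le_trans (modular_mix bi th test_fun0) _.
  rewrite hE -EFinM mulVf ?gt_eqF// [X in _ * X](_ : _ = 0) ?mule0 ?adde0//.
  rewrite /modular integral0_eq// => x _.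
  by rewrite (orlicz0 phi_orlicz) mul0r.
have := pairing_le_lux mf tm mm fK K0.
rewrite (pairing_mix f bi0 bi2 th test_fun0) [X in _ + _ * X](_ : _ = 0); last first.
  by rewrite /pairing integral0_eq// => x _; rewrite mule0.
rewrite mule0 adde0 lee_pdivrMl// => /le_trans; apply.
rewrite muleC; apply: lee_wpmul2l; first by rewrite lee_fin.
by rewrite hE -EFinD lee_fin lerDr.
Qed.

(* Lagrange duality in one variable: [t] is a supergradient at [b = 1] of the
   concave function [b |-> sup {pairing f h | modular h <= b}]. *)
Lemma pairing_lagrange f K : L0 a f -> (0 <= K)%R ->
  kothe_norm a (Lambda a phi w) (Lambda_norm a phi w) f <= K%:E ->
  forall e : R, (0 < e)%R -> exists2 t : R, (0 < t)%R &
    forall h, test_fun h -> pairing f h + t%:E <= (K + e)%:E + t%:E * modular h.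
Proof.
move=> mf K0 fK e e0.
have JE h : test_fun h -> pairing f h = (fine (pairing f h))%:E.
  move=> th; rewrite fineK// ge0_fin_numE ?pairing_ge0//.
  apply: le_lt_trans (pairing_growth_lux mf th fK K0) _.
  by rewrite (modular_fin th) -EFinD -EFinM ltry.
pose j h := fine (pairing f h); pose p h := fine (modular h).
have p0 h : test_fun h -> (0 <= p h)%R by move=> th; rewrite fine_ge0// modular_ge0.
have jK h : test_fun h -> (p h <= 1)%R -> (j h <= K)%R.
  move=> th p1; rewrite -lee_fin -JE//; apply: pairing_le_lux => //.
  by rewrite (modular_fin th) lee_fin.
(* Slopes of the lines joining [(p h, j h)] to [(1, K)] for [p h < 1]. By concavity no line towards
   a point with [p h > 1] is steeper, so the infimum [t0] serves on both sides. *)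
pose S := [set ((K - j h) / (1 - p h))%R | h in [set h | test_fun h /\ (p h < 1)%R]].
have S0 : has_inf S.
  split.
    exists ((K - j (fun=> 0%R)) / (1 - p (fun=> 0%R)))%R; exists (fun=> 0%R) => //.
    split; first exact: test_fun0.
    rewrite /p /modular integral0_eq//= => x _.
    by rewrite (orlicz0 phi_orlicz) mul0r.
  exists 0%R => _ [h [th ph] <-]; rewrite divr_ge0 ?subr_ge0 ?(ltW ph)//.
  by rewrite jK// ltW.
pose t0 := inf S.
have t00 : (0 <= t0)%R.
  apply: lb_le_inf S0.1 _ => _ [h [th ph] <-]; rewrite divr_ge0 ?subr_ge0 ?(ltW ph)//.
  by rewrite jK// ltW.
have main h : test_fun h -> (j h <= K + t0 * (p h - 1))%R.
  move=> th; have [p1|p1|p1] := ltgtP (p h) 1%R; last 1 first.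
  - by rewrite p1 subrr mulr0 addr0 jK// p1.
  - have : (t0 <= (K - j h) / (1 - p h))%R by apply: ge_inf S0.2 _ _; exists h.
    by rewrite ler_pdivlMr ?subr_gt0//; lra.
  have : ((j h - K) / (p h - 1) <= t0)%R.
    apply: lb_le_inf S0.1 _ => _ [h1 [th1 ph1] <-].
    rewrite ler_pdivrMr ?subr_gt0// mulrAC ler_pdivlMr ?subr_gt0//.
    have pp : (0 < p h - p h1)%R by rewrite subr_gt0 (lt_trans ph1).
    (* The mixture of [h1] and [h] for which convexity bounds the modular by exactly 1. *)
    pose l := ((p h - 1) / (p h - p h1))%R.
    have l01 : (0 <= l <= 1)%R.
      apply/andP; split; first by rewrite divr_ge0 ?(ltW pp)// subr_ge0 ltW.
      by rewrite ler_pdivrMr// mul1r lerD2l lerN2 ltW.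
    have /andP[l0 l1] := l01; have l1' : (0 <= 1 - l)%R by rewrite subr_ge0.
    have tm := test_fun_mix l0 l1' th1 th.
    have lE : (l * (p h - p h1) = p h - 1)%R by rewrite /l divfK ?gt_eqF.
    have jm : (j (fun x => l * h1 x + (1 - l) * h x) = l * j h1 + (1 - l) * j h)%R.
      rewrite {1}/j (pairing_mix f l0 l1' th1 th) (JE _ th1) (JE _ th).
      by rewrite -!EFinM -EFinD.
    have pm : (p (fun x => l * h1 x + (1 - l) * h x) <= 1)%R.
      have := modular_mix l01 th1 th; rewrite (modular_fin tm).
      rewrite (modular_fin th1) (modular_fin th) -!EFinM -EFinD lee_fin -/(p _).
      rewrite -/(p h1) -/(p h) => /le_trans; apply.
      by rewrite le_eqVlt; apply/orP; left; apply/eqP; move: lE; lra.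
    have := jK _ tm pm; rewrite jm => /(ler_wpM2r (ltW pp)).
    have -> : ((l * j h1 + (1 - l) * j h) * (p h - p h1) =
        l * (p h - p h1) * j h1 + ((p h - p h1) - l * (p h - p h1)) * j h)%R by ring.
    by rewrite lE; lra.
  rewrite ler_pdivrMr ?subr_gt0//; lra.
(* [t0] may be 0, but the multiplier becomes a scale and must be positive; the shift is paid by the
   slack [e]. *)
exists (t0 + e)%R; first by rewrite ltr_wpDl.
move=> h th; rewrite (JE _ th) (modular_fin th) -EFinM -!EFinD lee_fin -/(j h) -/(p h).
have := main h th; have : (0 <= e * p h)%R by rewrite mulr_ge0 ?p0// ltW.
lra.
Qed.

End duality.

(** * Primitives of decreasing functions *)

Section primitive.
Context {R : realType} (a : \bar R) (k : R -> \bar R).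
Local Notation T := (lebesgue_type R).
Hypothesis a_gt0 : 0 < a.
Hypothesis k_decr : edecreasing_on a k.
Hypothesis k_ge0 : forall x, itv0 a x -> 0 <= k x.
Hypothesis k_int : forall t, itv0 a t -> \int[leb]_(x in `]0%R, t[) k x < +oo.

Definition primitive (t : R) : R := fine (\int[leb]_(x in `]0%R, t[) k x).

Let mI := @measurable_itv0 R a.
Let mk : measurable_fun (itv0 a : set T) (k : T -> \bar R).
Proof. exact: measurable_edecreasing. Qed.

Lemma cdom_sub (s t : R) : (0 <= s)%R -> cdom a t -> `]s, t[ `<=` itv0 a.
Proof. by move=> s0 [_ ta]; exact: itvoo_sub_itv0. Qed.

Lemma measurable_sub (s t : R) : (0 <= s)%R -> cdom a t ->
  measurable_fun (`]s, t[%classic : set T) (k : T -> \bar R).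
Proof. by move=> s0 Dt; exact: (measurable_funS mI (cdom_sub s0 Dt) mk). Qed.

Lemma integral_sub_ge0 (s t : R) : (0 <= s)%R -> cdom a t ->
  0 <= \int[leb]_(x in `]s, t[) k x.
Proof. by move=> s0 Dt; apply: integral_ge0 => x /(cdom_sub s0 Dt); exact: k_ge0. Qed.

Lemma integral_split (p : R -> \bar R) (r s t : R) : (0 <= r)%R ->
  (r <= s)%R -> (s <= t)%R -> cdom a t ->
  measurable_fun (itv0 a : set T) (p : T -> \bar R) ->
  (forall x, itv0 a x -> 0 <= p x) ->
  \int[leb]_(x in `]r, t[) p x =
  \int[leb]_(x in `]r, s[) p x + \int[leb]_(x in `]s, t[) p x.
Proof.
move=> r0 rs st Dt mp p0; have s0 := le_trans r0 rs.
have sub := cdom_sub r0 Dt.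
have rst : `]r, s[%classic `|` `]s, t[%classic `<=` `]r, t[%classic.
  move=> x /= []; rewrite !in_itv/= => /andP[rx xs]; apply/andP; split => //.
  - exact: lt_le_trans st.
  - exact: le_lt_trans rx.
have mN : measurable ([set s] : set T) by exact: measurable_countable.
rewrite (@ge0_negligible_integral _ T R leb _ [set s] _ mN (measurable_itv_leb _)
  (measurable_funS mI sub mp) (fun x xr => p0 x (sub x xr)) (leb_set1 s)).
rewrite -(ge0_integral_setU leb (measurable_itv_leb _) (measurable_itv_leb _)).
- congr integral; apply/seteqP; split => x.
    move=> [/=]; rewrite in_itv/= => /andP[rx xt] /eqP xs.
    by rewrite !in_itv/= rx xt/= andbT; apply/orP; rewrite -neq_lt.
  move=> xrst; split; first exact: rst.
  by case: xrst => /=; rewrite in_itv/= => /andP[h1 h2] xs; rewrite xs ltxx in h1 h2.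
- exact: (measurable_funS mI (subset_trans rst sub) mp).
- by move=> x /rst/sub; exact: p0.
- apply/disj_setPS => x [/=]; rewrite !in_itv/= => /andP[_ xs] /andP[sx _].
  by have := lt_trans xs sx; rewrite ltxx.
Qed.

Lemma integral_lo (s t : R) : (0 <= s)%R -> (s <= t)%R -> itv0 a t ->
  k t * (t - s)%:E <= \int[leb]_(x in `]s, t[) k x.
Proof.
move=> s0 st It; have Dt : cdom a t by split; [exact/ltW/It.1|exact/ltW/It.2].
rewrite -leb_itvoo// -(integral_cst leb (measurable_itv_leb _)).
apply: ge0_le_integral.
- exact: measurable_itv_leb.
- by move=> x _; exact: k_ge0.
- exact: measurable_cst.
- exact: measurable_sub.
- move=> x xst; apply: k_decr => //; first exact: (cdom_sub s0 Dt).
  by move: xst; rewrite /= in_itv/= => /andP[_ /ltW].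
Qed.

Lemma integral_hi (s t : R) : itv0 a s -> (s <= t)%R -> cdom a t ->
  \int[leb]_(x in `]s, t[) k x <= k s * (t - s)%:E.
Proof.
move=> Is st Dt; have s0 := ltW Is.1.
rewrite -leb_itvoo// -(integral_cst leb (measurable_itv_leb _)).
apply: ge0_le_integral.
- exact: measurable_itv_leb.
- by move=> x /(cdom_sub s0 Dt); exact: k_ge0.
- exact: measurable_sub.
- exact: measurable_cst.
- move=> x xst; apply: k_decr => //; first exact: (cdom_sub s0 Dt).
  by move: xst; rewrite /= in_itv/= => /andP[/ltW].
Qed.

Lemma k_fin t : itv0 a t -> k t = (fine (k t))%:E.
Proof.
move=> It; rewrite fineK// ge0_fin_numE ?k_ge0// ltey; apply/eqP => kt.
have := integral_lo (lexx 0%R) (ltW It.1) It.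
rewrite kt subr0 gt0_mulye ?lte_fin ?It.1// leye_eq => /eqP H.
by have := k_int It; rewrite H.
Qed.

(** The new case is [t = a] finite, which [k_int] does not reach: beyond [t / 2] the function is
    bounded by its value there. *)
Lemma integral_lty t : cdom a t -> \int[leb]_(x in `]0%R, t[) k x < +oo.
Proof.
move=> Dt; have [t0|t0] := leP t 0%R.
  rewrite (_ : `]0%R, t[%classic = set0) ?integral_set0// -subset0 => x /=.
  by rewrite in_itv/= => /andP[x0 /(lt_trans x0)]; rewrite ltNge t0.
have Is : itv0 a (t / 2)%R.
  split; first by rewrite divr_gt0.
  by apply: lt_le_trans Dt.2; rewrite lte_fin ltr_pdivrMr// ltr_pMr// ltr1n.
have st : (t / 2 <= t)%R by rewrite ler_pdivrMr// ler_pMr// ler1n.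
rewrite (integral_split (lexx _) (ltW Is.1) st Dt mk k_ge0).
apply: lte_add_pinfty; [exact: k_int|apply: le_lt_trans (integral_hi Is st Dt) _].
by rewrite (k_fin Is) -EFinM ltry.
Qed.

Lemma primitiveE t : cdom a t -> \int[leb]_(x in `]0%R, t[) k x = (primitive t)%:E.
Proof.
by move=> Dt; rewrite fineK// ge0_fin_numE ?integral_lty ?integral_sub_ge0.
Qed.

Lemma primitive0 : primitive 0%R = 0%R.
Proof.
rewrite /primitive (_ : `]0%R, 0%R[%classic = set0) ?integral_set0// -subset0 => x /=.
by rewrite in_itv/= => /andP[x0 /(lt_trans x0)]; rewrite ltxx.
Qed.

Lemma cdom_le s t : (0 <= s)%R -> (s <= t)%R -> cdom a t -> cdom a s.
Proof. by move=> s0 st [_ ta]; split => //; apply: le_trans ta; rewrite lee_fin. Qed.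

Lemma integral_primitive (s t : R) : (0 <= s)%R -> (s <= t)%R -> cdom a t ->
  \int[leb]_(x in `]s, t[) k x = (primitive t - primitive s)%:E.
Proof.
move=> s0 st Dt; have Ds := cdom_le s0 st Dt.
have := integral_split (lexx _) s0 st Dt mk k_ge0.
rewrite (primitiveE Dt) (primitiveE Ds).
have := integral_sub_ge0 s0 Dt; case: (\int[leb]_(x in `]s, t[) k x) => [x||]//= _.
by rewrite -EFinD => -[->]; rewrite addrAC subrr add0r.
Qed.

Lemma primitive_nd s t : cdom a s -> cdom a t -> (s <= t)%R ->
  (primitive s <= primitive t)%R.
Proof.
move=> [s0 _] Dt st; rewrite -subr_ge0 -lee_fin -integral_primitive//.
exact: integral_sub_ge0.
Qed.

Lemma primitive_lo s t : (0 <= s)%R -> (s < t)%R -> itv0 a t ->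
  (fine (k t) * (t - s) <= primitive t - primitive s)%R.
Proof.
move=> s0 st It; have Dt : cdom a t by split; [exact/ltW/It.1|exact/ltW/It.2].
rewrite -lee_fin EFinM -(k_fin It) -(integral_primitive s0 (ltW st) Dt).
exact: integral_lo s0 (ltW st) It.
Qed.

Lemma primitive_hi s t : itv0 a s -> (s < t)%R -> cdom a t ->
  (primitive t - primitive s <= fine (k s) * (t - s))%R.
Proof.
move=> Is st Dt; rewrite -lee_fin EFinM -(k_fin Is).
rewrite -(integral_primitive (ltW Is.1) (ltW st) Dt).
exact: integral_hi Is (ltW st) Dt.
Qed.

Lemma fine_decr_ge0 x : itv0 a x -> (0 <= fine (k x))%R.
Proof. by move=> Ix; rewrite -lee_fin -k_fin// k_ge0. Qed.

Lemma fine_decr_anti x y : itv0 a x -> itv0 a y -> (x <= y)%R ->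
  (fine (k y) <= fine (k x))%R.
Proof. by move=> Ix Iy xy; rewrite -lee_fin -!k_fin// k_decr. Qed.

(** Continuity at 0, where [k] may be unbounded: the integrals over [(b / (n + 1), b)] increase to
    the integral over [(0, b)], and the difference is the primitive at [b / (n + 1)]. *)
Lemma primitive_small e : (0 < e)%R -> exists2 d, (0 < d)%R &
  forall y, cdom a y -> (y < d)%R -> (primitive y < e)%R.
Proof.
move=> e0; have [b Ib] := itv0_between a_gt0; have b0 := Ib.1.
have Db : cdom a b by split; [exact: ltW|exact/ltW/Ib.2].
pose s (n : nat) : R := (b * n.+1%:R^-1)%R.
have s0 n : (0 < s n)%R by rewrite mulr_gt0// invr_gt0.
have sb n : (s n <= b)%R by rewrite ler_piMr ?(ltW b0)// invf_le1// ler1n.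
pose S n : set R := `]s n, b[%classic.
have subS n : S n `<=` itv0 a by apply: cdom_sub => //; exact: ltW.
have US : `]0%R, b[%classic = \bigcup_n S n.
  apply/seteqP; split => x /=; last first.
    move=> [n _ /=]; rewrite !in_itv/= => /andP[sx xb]; apply/andP; split => //.
    exact: lt_trans sx.
  rewrite in_itv/= => /andP[x0 xb].
  have xb0 : (0 < x / b)%R by rewrite divr_gt0.
  have [n _ /(_ n (leqnn n))/= nx] := near_infty_natSinv_lt (PosNum xb0).
  by exists n => //; rewrite /S/= in_itv/= xb andbT /s mulrC -ltr_pdivlMr.
have : \int[leb]_(x in S n) k x @[n --> \oo] --> \int[leb]_(x in `]0%R, b[) k x.
  rewrite US; apply: ge0_nondecreasing_set_cvg_integral.
  - move=> i j ij; apply/subsetPset => x; rewrite /S/= !in_itv/= => /andP[ix ->].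
    rewrite andbT; apply: le_lt_trans ix; rewrite ler_pM2l//.
    by rewrite lef_pV2 ?posrE// ler_nat.
  - by move=> n; exact: measurable_itv_leb.
  - by move=> n; exact: (measurable_funS mI (subS n) mk).
  - by move=> n x /subS; exact: k_ge0.
rewrite (primitiveE Db) => cv.
have [n Hn] : exists n, (primitive b - e)%:E < \int[leb]_(x in S n) k x.
  apply: contrapT => /forallNP H.
  have /(cvge_to_le cv) : \forall n \near \oo, \int[leb]_(x in S n) k x <= (primitive b - e)%:E.
    by apply: nearW => n; rewrite leNgt; exact/negP.
  by rewrite lee_fin lerBrDl gerDr leNgt e0.
exists (s n) => // y Dy yn; move: Hn; rewrite /S (integral_primitive (ltW (s0 n)) (sb n) Db).
rewrite lte_fin ltrD2l ltrN2; apply: le_lt_trans; apply: primitive_nd => //.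
  exact: cdom_le (ltW (s0 n)) (sb n) Db.
exact: ltW.
Qed.

Lemma primitive_cont : cont_on (cdom a) primitive.
Proof.
move=> x Dx e e0; have [x0|x0] := leP x 0%R.
  have -> : x = 0%R by apply/eqP; rewrite eq_le x0 Dx.1.
  have [d d0 Hd] := primitive_small e0; exists d => // y Dy.
  rewrite subr0 primitive0 subr0 ger0_norm ?Dy.1// => /(Hd _ Dy).
  rewrite ger0_norm// -primitive0; apply: primitive_nd => //; last exact: Dy.1.
  by split => //; apply: le_trans Dy.2; rewrite lee_fin Dy.1.
pose s := (x / 2)%R.
have s0 : (0 < s)%R by rewrite divr_gt0.
have sx : (s < x)%R by rewrite ltr_pdivrMr// ltr_pMr// ltr1n.
have Is : itv0 a s by split => //; apply: lt_le_trans Dx.2; rewrite lte_fin.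
have c0 : (0 < fine (k s) + 1)%R by rewrite ltr_wpDl// fine_decr_ge0.
exists (Num.min (x - s) (e / (fine (k s) + 1)))%R.
  by rewrite lt_min subr_gt0 sx divr_gt0.
have key y z : cdom a z -> (s < y)%R -> (y < z)%R ->
    (z - y < e / (fine (k s) + 1))%R -> (`|primitive z - primitive y| < e)%R.
  move=> Dz sy yz; rewrite ltr_pdivlMr// => zy.
  have Iy : itv0 a y.
    by split; [exact: lt_trans sy|apply: lt_le_trans Dz.2; rewrite lte_fin].
  have Dy : cdom a y by split; [exact/ltW/Iy.1|exact/ltW/Iy.2].
  rewrite ger0_norm ?subr_ge0 ?primitive_nd ?(ltW yz)//.
  apply: le_lt_trans (primitive_hi Iy yz Dz) _; apply: le_lt_trans zy.
  rewrite mulrC ler_wpM2l ?subr_ge0 ?(ltW yz)//.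
  by rewrite (le_trans (fine_decr_anti Is Iy (ltW sy)))// lerDl.
move=> y Dy; rewrite lt_min => /andP[yxs yxe].
have [xy|yx|->] := ltgtP x y; last by rewrite subrr normr0.
  by apply: key => //; move: yxe; rewrite ger0_norm ?subr_ge0 ?ltW.
rewrite distrC; apply: key => //.
  move: yxs; rewrite distrC ger0_norm ?subr_ge0 ?(ltW yx)//.
  by rewrite ltrD2l ltrN2.
by move: yxe; rewrite distrC ger0_norm ?subr_ge0 ?ltW.
Qed.

End primitive.

(** * The level function *)

Section level_function.
Context {R : realType} (a : \bar R) (f : R -> \bar R) (w : R -> R) (C : R).
Local Notation T := (lebesgue_type R).
Hypothesis a_gt0 : 0 < a.
Hypothesis w_pos : positive_on a w.
Hypothesis w_decr : decreasing_on a w.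
Hypothesis w_int : forall t, itv0 a t -> \int[leb]_(x in `]0%R, t[) (w x)%:E < +oo.
Hypothesis f_int : forall t, itv0 a t -> \int[leb]_(x in `]0%R, t[) rearr a f x < +oo.
Local Notation F := (primitive (rearr a f)).
Local Notation W := (primitive (EFin \o w)).
Local Notation fr := (fine \o rearr a f).
Hypothesis C_ge0 : (0 <= C)%R.
Hypothesis growth : forall t, cdom a t -> (F t <= C * (1 + W t))%R.

Let kd : edecreasing_on a (rearr a f). Proof. exact: rearr_edecreasing. Qed.
Let k0 x : itv0 a x -> 0 <= rearr a f x. Proof. by move=> _; exact: rearr_ge0. Qed.
Let wd : edecreasing_on a (EFin \o w).
Proof. by move=> x y Ix Iy xy; rewrite lee_fin w_decr ?inE. Qed.
Let w0 x : itv0 a x -> 0 <= (EFin \o w) x.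
Proof. by move=> Ix; rewrite lee_fin ltW// w_pos// inE. Qed.
Let w_int' t : itv0 a t -> \int[leb]_(x in `]0%R, t[) (EFin \o w) x < +oo.
Proof. exact: w_int. Qed.

Let mI := @measurable_itv0 R a.
Let mk : measurable_fun (itv0 a : set T) (rearr a f : T -> \bar R).
Proof. exact: measurable_rearr. Qed.
Let mw : measurable_fun (itv0 a : set T) (EFin \o w : T -> \bar R).
Proof. exact: measurable_edecreasing. Qed.

Let F_nd s t : cdom a s -> cdom a t -> (s <= t)%R -> (F s <= F t)%R.
Proof. exact: primitive_nd. Qed.
Let F_cont : cont_on (cdom a) F. Proof. exact: primitive_cont. Qed.
Let W_cont : cont_on (cdom a) W. Proof. exact: primitive_cont. Qed.
Let F0 : F 0%R = 0%R. Proof. exact: primitive0. Qed.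
Let W0 : W 0%R = 0%R. Proof. exact: primitive0. Qed.
Let fr_ge0 t : itv0 a t -> (0 <= fr t)%R.
Proof. exact: fine_decr_ge0. Qed.
Let fr_anti : decreasing_on a fr.
Proof. by move=> x y; rewrite !inE => Ix Iy; exact: (fine_decr_anti kd k0 f_int Ix Iy). Qed.
Let F_lo s t : (0 <= s)%R -> (s < t)%R -> itv0 a t -> (fr t * (t - s) <= F t - F s)%R.
Proof. exact: primitive_lo. Qed.
Let F_hi s t : itv0 a s -> (s < t)%R -> cdom a t -> (F t - F s <= fr s * (t - s))%R.
Proof. exact: primitive_hi. Qed.
Let W_lo s t : (0 <= s)%R -> (s < t)%R -> itv0 a t -> (w t * (t - s) <= W t - W s)%R.
Proof. exact: (primitive_lo wd w0 w_int'). Qed.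
Let W_hi s t : itv0 a s -> (s < t)%R -> cdom a t -> (W t - W s <= w s * (t - s))%R.
Proof. exact: (primitive_hi wd w0 w_int'). Qed.
Let W_inc s t : cdom a s -> cdom a t -> (s < t)%R -> (W s < W t)%R.
Proof.
move=> Ds Dt st; pose m := ((s + t) / 2)%R.
have [sm mt] : (s < m)%R /\ (m < t)%R by rewrite !midf_lt.
have Im : itv0 a m.
  by split; [exact: le_lt_trans Ds.1 sm|apply: lt_le_trans Dt.2; rewrite lte_fin].
have Dm : cdom a m by split; [exact/ltW/Im.1|exact/ltW/Im.2].
apply: (@lt_le_trans _ _ (W m)).
  rewrite -subr_gt0; apply: lt_le_trans (W_lo Ds.1 sm Im).
  by rewrite mulr_gt0 ?subr_gt0// w_pos// inE.
by apply: (primitive_nd wd w0 w_int') => //; exact: ltW.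
Qed.

Let slope_le (al t c : R) : cdom a al -> cdom a t -> (al < t)%R ->
  ((F t - F al) / (W t - W al) <= c)%R = (tilt F W c t <= tilt F W c al)%R.
Proof.
move=> Dal Dt alt; rewrite ler_pdivrMr ?subr_gt0 ?W_inc// /tilt.
by rewrite -subr_ge0 -[RHS]subr_ge0; congr (0 <= _)%R; ring.
Qed.

Let slope_ge (al t c : R) : cdom a al -> cdom a t -> (al < t)%R ->
  (c <= (F t - F al) / (W t - W al))%R = (tilt F W c al <= tilt F W c t)%R.
Proof.
move=> Dal Dt alt; rewrite ler_pdivlMr ?subr_gt0 ?W_inc// /tilt.
by rewrite -subr_ge0 -[RHS]subr_ge0; congr (0 <= _)%R; ring.
Qed.

Lemma avg_finE (al t : R) : (0 <= al)%R -> (al < t)%R -> cdom a t ->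
  avg_fin a w f al t = ((F t - F al) / (W t - W al))%:E.
Proof.
move=> al0 alt Dt; rewrite /avg_fin.
rewrite (integral_primitive kd k0 f_int al0 (ltW alt) Dt).
rewrite (integral_primitive wd w0 w_int' al0 (ltW alt) Dt).
rewrite inver gt_eqF// subr_gt0 W_inc//.
exact: cdom_le al0 (ltW alt) Dt.
Qed.

Lemma limf_esup_pinfty_le (u : R -> \bar R) (M : R) (B : \bar R) :
  (forall t, (M < t)%R -> u t <= B) -> limf_esup u (pinfty_nbhs R) <= B.
Proof.
move=> uB; apply: (@le_trans _ _ (ereal_sup (u @` [set t | (M < t)%R]))).
  apply: ereal_inf_lbound; exists [set t | (M < t)%R] => //.
  by exists M; split => //; rewrite num_real.
by apply: ge_ereal_sup => _ [t Mt <-]; exact: uB.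
Qed.

Lemma limf_esup_pinfty_ge (u : R -> \bar R) (B : \bar R) :
  (forall M, exists2 t, (M < t)%R & B <= u t) -> B <= limf_esup u (pinfty_nbhs R).
Proof.
move=> uB; apply: le_ereal_inf_tmp => _ [V [M [_ MV]] <-].
have [t Mt Bt] := uB M; apply: (le_trans Bt).
by apply: ereal_sup_ubound; exists t => //; exact: MV.
Qed.

(** For [b = +oo] the averages only control chords from [al], whereas [is_level] asks for chords
    from every later [t]; these come from a chord from [al] of slope close to [c] with a distant
    end. The limsup is finite by [growth]. A finite [b] is the case of [is_level_point]. *)
Lemma level_interval_is_level (al : R) (b : \bar R) : level_interval a w f al b ->
  exists2 c, is_level a F W al b c & avg a w f al b = c%:E.
Proof.
move=> [al0 alb ba]; case: b => [b||]//= in alb ba *; last first.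
  have aoo : a = +oo by apply/eqP; rewrite -leye_eq.
  set L := limf_esup _ _ => L0 LU.
  have D t : (al <= t)%R -> cdom a t.
    by move=> alt; split; [exact: le_trans alt|rewrite aoo leey].
  have Dal : cdom a al by exact: D.
  have avE t : (al < t)%R -> avg_fin a w f al t = ((F t - F al) / (W t - W al))%:E.
    by move=> alt; apply: avg_finE => //; exact/D/ltW.
  have Loo : L < +oo.
    have al1 : (al < al + 1)%R by rewrite ltrDl.
    have D1 := D _ (ltW al1).
    have W1 : (0 < W (al + 1) - W al)%R by rewrite subr_gt0 W_inc.
    (* The bound [growth] divided by [W t - W al], which is at least [W (al + 1) - W al] for
       [t > al + 1]. *)
    apply: (@le_lt_trans _ _ (C + C * (1 + W al) / (W (al + 1) - W al))%:E); last by rewrite ltry.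
    apply: (@limf_esup_pinfty_le _ (al + 1)) => t tal.
    have alt : (al < t)%R := lt_trans al1 tal.
    have Dt := D _ (ltW alt).
    have Wt : (0 < W t - W al)%R by rewrite subr_gt0 W_inc.
    rewrite avE// lee_fin ler_pdivrMr//.
    have h1 := growth Dt.
    have F1 : (0 <= F al)%R by rewrite -F0 F_nd//; split => //; rewrite aoo leey.
    have W2 : (0 <= W al)%R.
      rewrite -W0; have [->|aln] := eqVneq al 0%R; first by [].
      apply/ltW/W_inc => //; first by split => //; rewrite aoo leey.
      by rewrite lt_neqAle eq_sym aln.
    have h2 : (C * (1 + W al) <= C * (1 + W al) / (W (al + 1) - W al) * (W t - W al))%R.
      rewrite mulrAC ler_pdivlMr// ler_wpM2l ?mulr_ge0 ?addr_ge0//.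
      by rewrite lerD2r ltW// W_inc.
    rewrite mulrDl; lra.
  have Lfin : L = (fine L)%:E by rewrite fineK// ge0_fin_numE// ltW.
  exists (fine L) => //; set c := fine L.
  have c0 : (0 < c)%R by rewrite -lte_fin -Lfin.
  have U t : (al < t)%R -> (tilt F W c t <= tilt F W c al)%R.
    move=> alt; rewrite -slope_le//; last exact/D/ltW.
    by rewrite -lee_fin -avE// -Lfin; apply: LU => //; rewrite ltry.
  split; first by split.
  split=> [t alt _|t c' T0 alt _ cc' _]; first exact: U.
  have Dt := D _ alt.
  have Utt : (tilt F W c t <= tilt F W c al)%R.
    by move: alt; rewrite le_eqVlt => /predU1P[->//|]; exact: U.
  pose s := (t + 1)%R; have ts : (t < s)%R by rewrite ltrDl.
  have Ds := D _ (le_trans alt (ltW ts)).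
  have d0 : (0 < W s - W t)%R by rewrite subr_gt0 W_inc.
  have Wtal : (0 <= W t - W al)%R.
    by rewrite subr_ge0; move: alt; rewrite le_eqVlt => /predU1P[->//|/W_inc-/(_ Dal Dt)/ltW].
  pose D1 := (W t - W al + (W s - W t))%R.
  have D10 : (0 < D1)%R by rewrite ltr_wpDl.
  (* Chosen so that a chord from [al] of slope [c - e] still rises at the rate [c'] when started
     from [t]; the fixed point [s] bounds [W t' - W t] from below. *)
  pose e := ((c - c') * (W s - W t) / D1)%R.
  have e0 : (0 < e)%R by rewrite divr_gt0// mulr_gt0// subr_gt0.
  have [t' + Rt'] : exists2 t', (Num.max T0 s < t')%R & (c - e)%:E <= avg_fin a w f al t'.
    apply: contrapT => H; suff : L <= (c - e)%:E.
      by rewrite Lfin lee_fin -/c lerBrDr gerDl leNgt e0.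
    apply: (@limf_esup_pinfty_le _ (Num.max T0 s)) => t' t't.
    by rewrite leNgt; apply/negP => /ltW ?; apply: H; exists t'.
  rewrite gt_max => /andP[T0t' st'].
  have tt' := lt_trans ts st'; have alt' := le_lt_trans alt tt'.
  have Dt' := D _ (ltW alt').
  exists t'; split => //; first by rewrite ltry.
  move: Rt'; rewrite avE// lee_fin slope_ge// => Rt'.
  have Ws : (W s < W t')%R by exact: W_inc.
  have ee : (e * D1 = (c - c') * (W s - W t))%R by rewrite /e divfK// gt_eqF.
  have h : ((c - c' - e) * (W s - W t) <= (c - c' - e) * (W t' - W t))%R.
    rewrite ler_wpM2l ?lerD2r ?(ltW Ws)//.
    rewrite subr_ge0 /e ler_pdivrMr// ler_wpM2l ?subr_ge0 ?(ltW cc')//.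
    by rewrite /D1 lerDr.
  by move: Utt Rt' h ee; rewrite /tilt /D1; lra.
rewrite lte_fin in alb.
have D t : (al <= t)%R -> (t <= b)%R -> cdom a t.
  move=> alt tb; split; first exact: le_trans alt.
  by apply: le_trans ba; rewrite lee_fin.
have Dal := D _ (lexx _) (ltW alb); have Db := D _ (ltW alb) (lexx _).
rewrite avg_finE// lte_fin => c0 LU.
set c := ((F b - F al) / (W b - W al))%R in c0 LU *.
exists c => //; apply: (is_level_point W_inc F_cont W_cont) => //.
  by apply/eqP; rewrite eq_le -slope_le// -slope_ge// lexx.
move=> t alt tb; have := LU t alt; rewrite lte_fin => /(_ tb).
have Dt := D _ (ltW alt) (ltW tb).
by rewrite avg_finE// lee_fin slope_le.
Qed.

Lemma is_level_level_interval (al : R) (b : \bar R) c : is_level a F W al b c ->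
  level_interval a w f al b /\ avg a w f al b = c%:E.
Proof.
move=> l; have [[al0 alb ba c0] [U L]] := l.
have D t : (al <= t)%R -> t%:E < b -> cdom a t.
  by move=> alt tb; exact: lt_cdom al0 alt tb ba.
have Dal := D _ (lexx _) alb.
suff avgE : avg a w f al b = c%:E.
  split => //; split => //; first by rewrite avgE.
  move=> t alt tb; have Dt := D _ (ltW alt) tb.
  by rewrite avgE /= avg_finE// lee_fin slope_le// U.
case: b => [b||]//= in l alb ba U L D Dal *; last first.
  have aoo : a = +oo by apply/eqP; rewrite -leye_eq.
  apply/eqP; rewrite eq_le; apply/andP; split.
    apply: (@limf_esup_pinfty_le _ al) => t alt.
    have tb : t%:E < +oo by rewrite ltry.
    have Dt := D _ (ltW alt) tb.
    by rewrite avg_finE// lee_fin slope_le// U.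
  apply/lee_subgt0Pr => e e0; rewrite -EFinB.
  apply: limf_esup_pinfty_ge => M.
  have ce : (c - e < c)%R by rewrite gtrBl.
  have [|t [alt Mt tb ct]] := L al (c - e)%R M (lexx _) alb ce.
    by rewrite ltry.
  have Dt := D _ (ltW alt) tb.
  by exists t => //; rewrite avg_finE// lee_fin slope_ge.
rewrite lte_fin in alb.
have Db : cdom a b by split => //; exact/ltW/(le_lt_trans al0).
rewrite avg_finE//; congr EFin; apply/eqP.
have cb := is_level_tilt W_inc F_cont W_cont l.
by rewrite eq_le slope_le// slope_ge// cb lexx.
Qed.

Local Notation maxl := (max_level a F W).

Lemma maximal_level_intervalP al b : maximal_level_interval a w f al b <->
  exists c, maxl al b c.
Proof.
split=> [[li m]|[c [l m]]].
  have [c l _] := level_interval_is_level li; exists c; split => //.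
  by move=> al' b' c' /is_level_level_interval[li' _]; exact: m.
split; first by have [] := is_level_level_interval l.
by move=> al' b' /level_interval_is_level[c' l' _]; exact: m l'.
Qed.

Local Notation slope := (level_slope a F W fr w).
Local Notation weight := (level_weight a F W fr w).

Lemma level_functionE t : itv0 a t -> level_function a w f t = (slope t * w t)%:E.
Proof.
move=> It; rewrite /level_function; case: pselect => [ex|nex].
  case: cid => -[al b] [/= /maximal_level_intervalP[c ml] alt tb].
  have cov : covers a F W (al, b, c) t by split.
  rewrite (level_slope_covered F_nd W_inc F0 W0 C_ge0 growth fr w cov)/=.
  by have [_ ->] := is_level_level_interval ml.1; rewrite EFinM.
have Ut : uncovered a F W t.
  move=> [[al b] c] [/= ml alt tb]; apply: nex; exists (al, b); split => //=.
  by apply/maximal_level_intervalP; exists c.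
rewrite level_slope_uncovered//= divfK ?gt_eqF ?w_pos ?inE//.
exact: (k_fin kd k0 f_int).
Qed.

Let covU p q t : covers a F W p t -> covers a F W q t -> p = q.
Proof. exact: (covers_uniq F_nd W_inc F0 W0 C_ge0 growth). Qed.

Lemma slope_covered p t : covers a F W p t -> slope t = p.2.
Proof. exact: (level_slope_covered F_nd W_inc F0 W0 C_ge0 growth). Qed.

Let weight_cov p t : covers a F W p t -> weight t = (fr t / p.2)%R.
Proof. exact: (level_weight_covered F_nd W_inc F0 W0 C_ge0 growth). Qed.

Let left_uncov p t : covers a F W p t -> uncovered a F W p.1.1.
Proof. exact: (max_level_left F_nd W_inc F0 W0 C_ge0 growth). Qed.

Lemma weight_pos : positive_on a weight.
Proof. exact: (level_weight_gt0 F_nd W_inc F0 W0 C_ge0 growth w_pos F_hi). Qed.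

Lemma weight_decr : decreasing_on a weight.
Proof.
exact: (level_weight_anti F_nd W_inc F_cont W_cont F0 W0 C_ge0 growth fr_anti
  w_decr F_lo F_hi W_lo W_hi).
Qed.

Lemma slope_ge0 t : itv0 a t -> (0 <= slope t)%R.
Proof. exact: (level_slope_ge0 F_nd W_inc F0 W0 C_ge0 growth fr_ge0 w_pos). Qed.

Lemma slope_weight t : itv0 a t -> (slope t * weight t)%:E = rearr a f t.
Proof.
move=> It; rewrite (k_fin kd k0 f_int It); congr EFin.
exact: (level_slopeM F_nd W_inc F0 W0 C_ge0 growth fr w_pos It).
Qed.

(** Outside the jump set the rearrangement is continuous, which is the condition [fr_cont_at] of
    [level_slope_anti]. *)
Lemma slope_anti t t' : itv0 a t -> itv0 a t' -> ~ jump_set a (rearr a f) t ->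
  ~ jump_set a (rearr a f) t' -> (t <= t')%R -> (slope t' <= slope t)%R.
Proof.
have jump x : itv0 a x -> ~ jump_set a (rearr a f) x -> fr_cont_at a fr x.
  move=> Ix Nx e e0; have kE y (Iy : itv0 a y) := k_fin kd k0 f_int Iy.
  split; apply: contrapT => H; apply: Nx.
    apply: (@in_jump_set _ a _ x (fr x + e / 2)%R (fr x + e)%R) => //.
    - by rewrite ltrD2l ltr_pdivrMr// ltr_pMr// ltr1n.
    - move=> y Iy yx; rewrite kE// lee_fin leNgt; apply/negP => yf.
      by apply: H; exists y.
    - move=> y Iy xy; rewrite kE// lee_fin.
      apply: (@le_trans _ _ (fr x)); last by rewrite lerDl divr_ge0// ltW.
      by apply: fr_anti; rewrite ?inE// ltW.
  apply: (@in_jump_set _ a _ x (fr x - e)%R (fr x - e / 2)%R) => //.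
  - by rewrite ltrD2l ltrN2 ltr_pdivrMr// ltr_pMr// ltr1n.
  - move=> y Iy yx; rewrite kE// lee_fin.
    apply: (@le_trans _ _ (fr x)); first by rewrite gerBl divr_ge0// ltW.
    by apply: fr_anti; rewrite ?inE// ltW.
  - move=> y Iy xy; rewrite kE// lee_fin leNgt; apply/negP => yf.
    by apply: H; exists y.
move=> It It' Nt Nt' tt'.
exact: (level_slope_anti F_nd W_inc F_cont W_cont F0 W0 C_ge0 growth fr_ge0
  w_pos F_lo F_hi W_lo W_hi It It' (jump _ It Nt) (jump _ It' Nt') tt').
Qed.

(** Indices coding no rational give 0, which lies in no level interval. *)
Let rat_seq (n : nat) : R := ratr (odflt (0%R : rat) (unpickle n)).

(* The [n]-th piece is the maximal level interval containing the [n]-th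
   rational, unless an earlier rational belongs to it. *)
Let piece (t : R) (n : nat) : set R := [set x | (0 < x < t)%R /\
  exists p, [/\ covers a F W p x, covers a F W p (rat_seq n) &
    forall m, (m < n)%N -> ~ covers a F W p (rat_seq m)]].

(** A nonempty piece is a whole maximal level interval: [t] is uncovered, so none that starts before
    [t] extends beyond it. *)
Let pieceP t n : cdom a t -> uncovered a F W t -> piece t n = set0 \/
  exists al b c s, [/\ covers a F W (al, b%:E, c) s, (0 <= al)%R, (al < b)%R, (b <= t)%R &
    piece t n = `]al, b[%classic].
Proof.
move=> Dt Ut; have [[x [xt [p [px pn pm]]]]|] := pselect (exists x, piece t n x); last first.
  by move=> H; left; rewrite -subset0 => x Hx; apply: H; exists x.
right; case: p px pn pm => [[al b] c] px pn pm.
have [/= [[[al0 alb ba c0] _] _] alx xb] := px.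
have bt : b <= t%:E.
  rewrite leNgt; apply/negP => tb; apply: (Ut (al, b, c)).
  case: px => mlx _ _; split => //=; case/andP: xt => _.
  exact: lt_trans.
have [b' ?] := EFin_between xb bt; subst b.
rewrite lee_fin in bt; rewrite lte_fin in xb; rewrite lte_fin in alb.
exists al, b', c, x; split => //; apply/seteqP; split => y.
  move=> [yt [q [qy qn _]]]; have := covU qn pn => qE; subst q.
  by case: qy => /= _ aly yb; rewrite in_itv/= aly.
rewrite /= in_itv/= => /andP[aly yb]; split.
  by rewrite (le_lt_trans al0 aly) (lt_le_trans yb bt).
by exists (al, b'%:E, c); split => //; case: px.
Qed.

Let measurable_piece t n : cdom a t -> uncovered a F W t ->
  measurable (piece t n : set T).
Proof.
move=> Dt Ut; have [->|[al [b [c [s [_ _ _ _ ->]]]]]] := pieceP n Dt Ut.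
  exact: measurable0.
exact: measurable_itv_leb.
Qed.

Let piece_cover t : cdom a t ->
  \bigcup_n piece t n = [set x | (0 < x < t)%R /\ exists p, covers a F W p x].
Proof.
move=> Dt; apply/seteqP; split => x.
  by move=> [n _ [xt [p [px _ _]]]]; split => //; exists p.
move=> [xt [p px]].
have [n0 Hn0] : exists n, `[< covers a F W p (rat_seq n) >].
  case: p px => [[al b] c] [/= ml alx xb].
  have [s xs sb] := between_EFin xb.
  have [q] := rat_in_itvoo xs; rewrite in_itv/= => /andP[xq qs].
  exists (pickle q); apply/asboolP; rewrite /rat_seq pickleK/=; split => //=.
    exact: lt_trans xq.
  by rewrite (lt_trans _ sb)// lte_fin.
have ex : exists n, `[< covers a F W p (rat_seq n) >] by exists n0.
exists (ex_minn ex) => //; split => //; exists p; split => //.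
  by case: ex_minnP => n /asboolP.
move=> m; case: ex_minnP => n _ Hn mn pm.
by have := Hn m (asboolT pm); rewrite leqNgt mn.
Qed.

Let piece_disjoint t : trivIset setT (piece t).
Proof.
apply/trivIsetP => i j _ _; wlog ij : i j / (i < j)%N.
  move=> H; rewrite neq_lt => /orP[ij|ji]; first by apply: H => //; rewrite lt_eqF.
  by rewrite setIC; apply: H => //; rewrite lt_eqF.
move=> _; rewrite -subset0 => x [[_ [p [px pi _]]] [_ [q [qx _ qm]]]].
by apply: (qm i ij); rewrite -(covU px qx).
Qed.

(** Up to an uncovered [t] the interval [(0, t)] splits into its uncovered points and countably many
    complete maximal level intervals, so equality has to be checked only pointwise on the former and
    in the mean on the latter. *)
Lemma eq_integral_uncovered (p q : R -> \bar R) t : cdom a t -> uncovered a F W t ->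
  measurable_fun (itv0 a : set T) (p : T -> \bar R) ->
  measurable_fun (itv0 a : set T) (q : T -> \bar R) ->
  (forall x, itv0 a x -> 0 <= p x) -> (forall x, itv0 a x -> 0 <= q x) ->
  (forall x, itv0 a x -> uncovered a F W x -> p x = q x) ->
  (forall al b c s, covers a F W (al, b%:E, c) s ->
    \int[leb]_(x in `]al, b[) p x = \int[leb]_(x in `]al, b[) q x) ->
  \int[leb]_(x in `]0%R, t[) p x = \int[leb]_(x in `]0%R, t[) q x.
Proof.
move=> Dt Ut mp mq p0 q0 pq pqc.
have sub := cdom_sub (lexx _) Dt.
pose U := \bigcup_n piece t n.
have mU : measurable (U : set T).
  by apply: bigcup_measurable => n _; exact: measurable_piece.
have Ut' : U `<=` `]0%R, t[%classic.
  by move=> x [n _ [xt _]]; rewrite /= in_itv.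
pose V := `]0%R, t[%classic `\` U.
have mV : measurable (V : set T) by apply: measurableD => //; exact: measurable_itv_leb.
have decomp (g : R -> \bar R) : measurable_fun (itv0 a : set T) (g : T -> \bar R) ->
    (forall x, itv0 a x -> 0 <= g x) ->
    \int[leb]_(x in `]0%R, t[) g x =
    \int[leb]_(x in V) g x + \sum_(n <oo) \int[leb]_(x in piece t n) g x.
  move=> mg g0; rewrite -(setDKU Ut') -/V (ge0_integral_setU leb mV mU).
  - congr (_ + _); apply: (ge0_integral_bigcup leb).
    + by move=> n; exact: measurable_piece.
    + exact: (measurable_funS mI (subset_trans Ut' sub) mg).
    + by move=> x /Ut'/sub; exact: g0.
    + exact: piece_disjoint.
  - rewrite /V (setDKU Ut'); exact: (measurable_funS mI sub mg).
  - by rewrite /V (setDKU Ut') => x /sub; exact: g0.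
  - by apply/disj_setPS => x [[_ nU] /nU].
rewrite (decomp p mp p0) (decomp q mq q0); congr (_ + _).
  apply: eq_integral => x; rewrite inE => -[xt nU]; apply: pq; first exact: sub.
  have [[r rx]|//] := covered_or a F W x; exfalso; apply: nU.
  by rewrite /U (piece_cover Dt); split; [move: xt; rewrite /= in_itv|exists r].
apply: eq_eseriesr => n _.
have [->|[al [b [c [s [cov _ _ _ ->]]]]]] := pieceP n Dt Ut.
  by rewrite !integral_set0.
exact: pqc cov.
Qed.

Let slope_eq x : itv0 a x -> (slope x * w x)%:E = rearr a f x * (weight x)^-1%:E * (w x)%:E.
Proof.
by move=> Ix; rewrite -(slope_weight Ix) -!EFinM mulfK// gt_eqF// weight_pos// inE.
Qed.

(** The slope is known to decrease only outside the jumps, so measurability is drawn from its form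
    as the rearrangement divided by the decreasing [weight]. *)
Lemma measurable_slopeM :
  measurable_fun (itv0 a : set T) ((fun x => (slope x * w x)%:E) : T -> \bar R).
Proof.
apply: (@eq_measurable_fun _ _ T _ _ (fun x => rearr a f x * (- - (weight x)^-1)%:E * (w x)%:E)).
  by move=> x; rewrite inE opprK => /slope_eq.
apply: emeasurable_funM; last exact: mw.
apply: emeasurable_funM; first exact: mk.
apply/measurable_EFinP; apply: measurableT_comp; first exact: oppr_measurable.
apply: measurable_decreasing => x y Ix Iy xy.
by rewrite lerN2 lef_pV2 ?posrE ?weight_pos// weight_decr.
Qed.

Lemma measurable_level_weight :
  measurable_fun (itv0 a : set T) ((EFin \o weight) : T -> \bar R).
Proof. by apply/measurable_EFinP; apply: measurable_decreasing; exact: weight_decr. Qed.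

Let sw0 x : itv0 a x -> 0 <= (slope x * w x)%:E.
Proof. by move=> Ix; rewrite lee_fin mulr_ge0 ?slope_ge0//; have := w0 Ix; rewrite lee_fin. Qed.

Let v0 x : itv0 a x -> 0 <= (EFin \o weight) x.
Proof. by move=> Ix; rewrite lee_fin ltW// weight_pos// inE. Qed.

(** On a complete level interval [is_level_tilt] says that [c * (W b - W al)] equals [F b - F al]:
    levelling preserves the mass of each piece. *)
Lemma integral_slope_uncovered t : cdom a t -> uncovered a F W t ->
  \int[leb]_(x in `]0%R, t[) (slope x * w x)%:E = (F t)%:E.
Proof.
move=> Dt Ut; rewrite -(primitiveE kd k0 f_int Dt).
apply: (eq_integral_uncovered Dt Ut measurable_slopeM mk sw0 k0).
  move=> x Ix Ux; rewrite level_slope_uncovered// divfK ?gt_eqF ?w_pos ?inE//.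
  by rewrite (k_fin kd k0 f_int Ix).
move=> al b c s cov; have [/= [l _] als sb] := cov; have [[al0 alb ba c0] _] := l.
rewrite lte_fin in alb.
have Db : cdom a b by split => //; exact/ltW/(le_lt_trans al0).
have sub := cdom_sub al0 Db.
rewrite (integral_primitive kd k0 f_int al0 (ltW alb) Db).
rewrite (@eq_integral _ T R leb _ (fun x => c%:E * (EFin \o w) x)); last first.
  move=> x; rewrite inE/= in_itv/= => /andP[alx xb].
  rewrite (slope_covered (_ : covers a F W (al, b%:E, c) x)) ?EFinM//.
  by case: cov => ml _ _; split.
rewrite (ge0_integralZl_EFin leb (measurable_itv_leb _)).
- rewrite (integral_primitive wd w0 w_int' al0 (ltW alb) Db) -EFinM; congr EFin.
  by have := is_level_tilt W_inc F_cont W_cont l; rewrite /tilt; lra.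
- by move=> x /sub; exact: w0.
- exact: (measurable_funS mI sub mw).
- exact: ltW.
Qed.

Lemma integral_weight_uncovered t : cdom a t -> uncovered a F W t ->
  \int[leb]_(x in `]0%R, t[) (weight x)%:E = (W t)%:E.
Proof.
move=> Dt Ut; rewrite -(primitiveE wd w0 w_int' Dt).
apply: (eq_integral_uncovered Dt Ut measurable_level_weight mw v0 w0).
  by move=> x Ix Ux /=; rewrite level_weight_uncovered.
move=> al b c s cov; have [/= [l _] als sb] := cov; have [[al0 alb ba c0] _] := l.
rewrite lte_fin in alb.
have Db : cdom a b by split => //; exact/ltW/(le_lt_trans al0).
have sub := cdom_sub al0 Db.
rewrite (integral_primitive wd w0 w_int' al0 (ltW alb) Db).
rewrite (@eq_integral _ T R leb _ (fun x => c^-1%:E * rearr a f x)); last first.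
  move=> x xab; have Ix : itv0 a x by apply: sub; rewrite inE in xab.
  move: xab; rewrite inE/= in_itv/= => /andP[alx xb].
  rewrite (weight_cov (_ : covers a F W (al, b%:E, c) x)); last first.
    by case: cov => ml _ _; split.
  by rewrite (k_fin kd k0 f_int Ix) -EFinM mulrC.
rewrite (ge0_integralZl_EFin leb (measurable_itv_leb _)).
- rewrite (integral_primitive kd k0 f_int al0 (ltW alb) Db) -EFinM; congr EFin.
  apply: (mulfI (lt0r_neq0 c0)); rewrite mulVKf ?gt_eqF//.
  by have := is_level_tilt W_inc F_cont W_cont l; rewrite /tilt; lra.
- by move=> x /sub; exact: k0.
- exact: (measurable_funS mI sub mk).
- by rewrite invr_ge0 ltW.
Qed.

Lemma integral_slope_covered al b c t : covers a F W (al, b, c) t ->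
  \int[leb]_(x in `]0%R, t[) (slope x * w x)%:E = (F al + c * (W t - W al))%:E.
Proof.
move=> cov; have [/= [l _] alt tb] := cov; have [[al0 alb ba c0] _] := l.
have Dt := lt_cdom al0 (ltW alt) tb ba; have Dal := lt_cdom al0 (lexx _) alb ba.
rewrite (integral_split (lexx _) al0 (ltW alt) Dt measurable_slopeM sw0).
rewrite (integral_slope_uncovered Dal (left_uncov cov)) EFinD; congr (_ + _).
have sub := cdom_sub al0 Dt.
rewrite (@eq_integral _ T R leb _ (fun x => c%:E * (EFin \o w) x)); last first.
  move=> x; rewrite inE/= in_itv/= => /andP[alx xt].
  rewrite (slope_covered (_ : covers a F W (al, b, c) x)) ?EFinM//.
  case: cov => ml _ _; split => //=.
  by rewrite (lt_trans _ tb)// lte_fin.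
rewrite (ge0_integralZl_EFin leb (measurable_itv_leb _)).
- by rewrite (integral_primitive wd w0 w_int' al0 (ltW alt) Dt) -EFinM.
- by move=> x /sub; exact: w0.
- exact: (measurable_funS mI sub mw).
- exact: ltW.
Qed.

Lemma integral_weight_covered al b c t : covers a F W (al, b, c) t ->
  \int[leb]_(x in `]0%R, t[) (weight x)%:E = (W al + c^-1 * (F t - F al))%:E.
Proof.
move=> cov; have [/= [l _] alt tb] := cov; have [[al0 alb ba c0] _] := l.
have Dt := lt_cdom al0 (ltW alt) tb ba; have Dal := lt_cdom al0 (lexx _) alb ba.
rewrite (integral_split (lexx _) al0 (ltW alt) Dt measurable_level_weight v0).
rewrite (integral_weight_uncovered Dal (left_uncov cov)) EFinD; congr (_ + _).
have sub := cdom_sub al0 Dt.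
rewrite (@eq_integral _ T R leb _ (fun x => c^-1%:E * rearr a f x)); last first.
  move=> x xab; have Ix : itv0 a x by apply: sub; rewrite inE in xab.
  move: xab; rewrite inE/= in_itv/= => /andP[alx xt].
  rewrite (weight_cov (_ : covers a F W (al, b, c) x)); last first.
    by case: cov => ml _ _; split => //=; rewrite (lt_trans _ tb)// lte_fin.
  by rewrite (k_fin kd k0 f_int Ix) -EFinM mulrC.
rewrite (ge0_integralZl_EFin leb (measurable_itv_leb _)).
- by rewrite (integral_primitive kd k0 f_int al0 (ltW alt) Dt) -EFinM.
- by move=> x /sub; exact: k0.
- exact: (measurable_funS mI sub mk).
- by rewrite invr_ge0 ltW.
Qed.

Lemma rearr_le_slope x : itv0 a x ->
  \int[leb]_(t in `]0%R, x[) rearr a f t <= \int[leb]_(t in `]0%R, x[) (slope t * w t)%:E.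
Proof.
move=> Ix; have Dx : cdom a x by split; [exact/ltW/Ix.1|exact/ltW/Ix.2].
rewrite (primitiveE kd k0 f_int Dx).
have [[[[al b] c] cov]|Ux] := covered_or a F W x; last first.
  by rewrite integral_slope_uncovered.
rewrite (integral_slope_covered cov) lee_fin.
have [/= [[_ [U _]] _] alx xb] := cov.
by have := U _ alx xb; rewrite /tilt; lra.
Qed.

Lemma weight_submaj x : itv0 a x ->
  \int[leb]_(t in `]0%R, x[) (weight t)%:E <= \int[leb]_(t in `]0%R, x[) (w t)%:E.
Proof.
move=> Ix; have Dx : cdom a x by split; [exact/ltW/Ix.1|exact/ltW/Ix.2].
have -> := primitiveE wd w0 w_int' Dx.
have [[[[al b] c] cov]|Ux] := covered_or a F W x; last first.
  by rewrite integral_weight_uncovered.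
rewrite (integral_weight_covered cov) lee_fin.
have [/= [[[_ _ _ c0] [U _]] _] alx xb] := cov.
rewrite -lerBrDl ler_pdivrMl//.
by have := U _ alx xb; rewrite /tilt; lra.
Qed.

Lemma integral_slope_bound c B x : itv0 a x ->
  (forall t, (0 <= t)%R -> t%:E < a -> (tilt F W c t <= B)%R) ->
  (forall p, covers a F W p x -> (c <= p.2)%R) ->
  \int[leb]_(t in `]0%R, x[) (slope t * w t)%:E <= (B + c * W x)%:E.
Proof.
move=> Ix HB Hc; have Dx : cdom a x by split; [exact/ltW/Ix.1|exact/ltW/Ix.2].
have [[[[al b] cc] cov]|Ux] := covered_or a F W x; last first.
  rewrite integral_slope_uncovered// lee_fin.
  by have := HB x (ltW Ix.1) Ix.2; rewrite /tilt; lra.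
rewrite (integral_slope_covered cov) lee_fin.
have [/= [l _] alx xb] := cov.
have := level_tilt_bound W_inc l (ltW alx) xb (Hc _ cov) HB; lra.
Qed.

End level_function.

(** * Discretized modulars *)

Section orlicz_increments.
Context {R : realType} (phi : R -> R).
Hypothesis phi_orlicz : orlicz_function phi.

Definition increment (d : R) (i : nat) : R := (phi (i.+1%:R * d) - phi (i%:R * d))%R.

Lemma increment_ge0 d i : (0 <= d)%R -> (0 <= increment d i)%R.
Proof.
move=> d0; rewrite subr_ge0 (orlicz_nd phi_orlicz) ?mulr_ge0//.
by rewrite ler_wpM2r// ler_nat.
Qed.

Lemma increment_nd d i j : (0 <= d)%R -> (i <= j)%N -> (increment d i <= increment d j)%R.
Proof.
move=> d0; apply: (@homo_leq _ (increment d) (fun x y => x <= y)%R).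
- by move=> x; exact: lexx.
- by move=> y x z; exact: le_trans.
move=> k; rewrite /increment.
have := @orlicz_convex _ _ phi_orlicz 2^-1 (k%:R * d) (k.+2%:R * d).
have -> : (2^-1 * (k%:R * d) + (1 - 2^-1) * (k.+2%:R * d) = k.+1%:R * d :> R)%R.
  by rewrite -[in k.+2]addn2 -[in k.+1]addn1 !natrD; field.
rewrite invr_ge0 ler0n invf_le1 ?ltr0n// ler1n !mulr_ge0// => /(_ isT isT isT).
lra.
Qed.

Lemma sum_increment d m : (\sum_(i < m) increment d i = phi (m%:R * d))%R.
Proof.
elim: m => [|m IH]; first by rewrite big_ord0 mul0r (orlicz0 phi_orlicz).
by rewrite big_ord_recr/= IH /increment addrC subrK.
Qed.

(* By convexity the increments increase, so that among all sets of [m] of them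
   the first [m] have the smallest sum, which is [phi (m * d)]. *)
Lemma orlicz_count d N (P : nat -> bool) : (0 <= d)%R ->
  (phi (d * \sum_(i < N) (P i)%:R) <= \sum_(i < N) increment d i * (P i)%:R)%R.
Proof.
move=> d0; rewrite -natr_sum mulrC -sum_increment.
have cN n : (\sum_(i < n) P i <= n)%N.
  by rewrite -[leqRHS]card_ord -sum1_card; apply: leq_sum => i _; case: (P i).
elim: N => [|N IH]; first by rewrite !big_ord0.
have cS : (\sum_(i < N.+1) P i = \sum_(i < N) P i + P N)%N by rewrite big_ord_recr.
rewrite cS [X in (_ <= X)%R]big_ord_recr/=.
case: (P N) => /=; last by rewrite addn0 mulr0 addr0.
by rewrite addn1 big_ord_recr/= mulr1 lerD// increment_nd// cN.
Qed.

(** A discretized complementary function. Since the increments increase, the positive terms come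
    first, and the sum is the maximum over [m <= N] of [m d x - phi (m d)]. As a sum it can be
    integrated term by term, each term involving a single slope threshold. *)
Definition excess (d : R) (N : nat) (x : R) : R :=
  (\sum_(i < N) Num.max 0 (d * x - increment d i))%R.

Lemma excess_ge d N m x : (m <= N)%N -> (m%:R * d * x - phi (m%:R * d) <= excess d N x)%R.
Proof.
move=> mN; apply: (@le_trans _ _ (excess d m x)).
  have -> : (m%:R * d * x = \sum_(i < m) (d * x))%R.
    by rewrite sumr_const card_ord -mulrA mulr_natl.
  rewrite -sum_increment -sumrB.
  by apply: ler_sum => i _; rewrite le_max lexx orbT.
rewrite /excess -(subnKC mN) big_split_ord/= lerDl.
by apply: sumr_ge0 => i _; rewrite le_max lexx.
Qed.

(** The competitor [s] is rounded down to a grid point [m / (n + 1)]; the mesh shrinks while the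
    range of the grid grows to [n + 1]. *)
Lemma complementary_liminf (x : R) : (0 <= x)%R ->
  complementary phi x%:E <= limn_einf (fun n => (excess n.+1%:R^-1 (n.+1 ^ 2) x)%:E).
Proof.
move=> x0; apply: ge_ereal_sup => _ [s s0 <-]; rewrite -EFinM -EFinB.
apply/lee_subgt0Pr => e e0; rewrite -EFinB.
(* [s <= n + 1] keeps the rounded [s] within the [(n + 1) ^ 2] grid points, and [x / e <= n + 1]
   keeps the rounding loss [x / (n + 1)] at most [e]. *)
have [n0 Hn0] : exists n0 : nat, (s + x / e <= n0.+1%:R)%R.
  exists (Num.truncn (s + x / e)); apply/ltW/truncnS_gt.
have xe0 : (0 <= x / e)%R by rewrite divr_ge0// ltW.
rewrite limn_einf_lim; apply: (@le_trans _ _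
  (einfs (fun n => (excess n.+1%:R^-1 (n.+1 ^ 2) x)%:E) n0)); last first.
  rewrite (cvg_lim _ (ereal_nondecreasing_cvgn (nondecreasing_einfs _)))//.
  by apply: ereal_sup_ubound; exists n0.
apply: le_ereal_inf_tmp => _ [n /= n0n <-]; rewrite lee_fin.
have nr : (s + x / e <= n.+1%:R :> R)%R by rewrite (le_trans Hn0)// ler_nat ltnS.
have N0 : (0 < n.+1%:R :> R)%R by [].
pose m := Num.truncn (s * n.+1%:R)%R.
have sn0 : (0 <= s * n.+1%:R)%R by rewrite mulr_ge0.
have [m1 m2] : (m%:R <= s * n.+1%:R)%R /\ (s * n.+1%:R < m.+1%:R)%R.
  by have /andP[] := truncn_itv sn0.
have mN : (m <= n.+1 ^ 2)%N.
  rewrite -(@ler_nat R) natrX expr2; apply: (le_trans m1); rewrite ler_wpM2r//.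
  by apply: le_trans nr; rewrite lerDl.
apply: le_trans (excess_ge _ _ mN).
have q1 : (m%:R * n.+1%:R^-1 <= s :> R)%R by rewrite ler_pdivrMr.
have q2 : (s <= m%:R * n.+1%:R^-1 + n.+1%:R^-1 :> R)%R.
  by rewrite -[X in (_ + X)%R]mul1r -mulrDl ler_pdivlMr// natr1 ltW.
have p1 := orlicz_nd phi_orlicz (mulr_ge0 (ler0n R m) (ltW (etrans (invr_gt0 _) N0))) q1.
have xn : (n.+1%:R^-1 * x <= e)%R.
  rewrite mulrC ler_pdivrMr// -ler_pdivrMl// mulrC (le_trans _ nr)// lerDr//.
have := ler_wpM2r x0 q2; rewrite mulrDl; move: p1 xn; clear.
move: (phi _) (phi s) (_ * x)%R (_ * x)%R (_ * x)%R => y1 y2 y3 y4 y5; lra.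
Qed.

End orlicz_increments.

(** * Functions decreasing outside a countable set *)

Section ae_decreasing.
Context {R : realType} (a : \bar R) (u : R -> \bar R) (N : set R).
Local Notation T := (lebesgue_type R).
Hypothesis countable_N : countable N.
Hypothesis u_decr : forall x y, itv0 a x -> itv0 a y -> ~ N x -> ~ N y ->
  (x <= y)%R -> u y <= u x.
Hypothesis u_ge0 : forall x, itv0 a x -> 0 <= u x.

(** [k x] is the supremum of [u] over the good points not before [x]; the maximum with 0 makes it
    nonnegative whatever these points are. *)
Lemma ae_decreasing_regular : exists k, [/\ edecreasing_on a k,
  forall x, itv0 a x -> 0 <= k x & forall x, itv0 a x -> ~ N x -> k x = u x].
Proof.
pose S t := [set u x | x in [set x | (t <= x)%R /\ itv0 a x /\ ~ N x]].
exists (fun t => maxe 0 (ereal_sup (S t))); split.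
- move=> x y Ix Iy xy; rewrite ge_max le_max lexx/= le_max; apply/orP; right.
  apply: ereal_sup_le => _ [z [yz Hz] <-].
  by exists z => //; split => //; exact: le_trans yz.
- by move=> x Ix; rewrite le_max lexx.
move=> x Ix Nx; apply/eqP; rewrite eq_le; apply/andP; split.
  rewrite ge_max u_ge0//=; apply: ge_ereal_sup => _ [z [xz [Iz Nz]] <-].
  exact: u_decr.
by rewrite le_max; apply/orP; right; apply: ereal_sup_ubound; exists x.
Qed.

Lemma rearr_ae_decreasing : {ae (@leb R), forall x : R, itv0 a x -> rearr a u x = u x}.
Proof.
have [k [kd k0 ku]] := ae_decreasing_regular.
have aeu : {ae (@leb R), forall x : R, itv0 a x -> u x = k x}.
  by apply: (ae_notin_countable countable_N) => x Nx Ix; rewrite ku.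
rewrite (ae_eq_rearr aeu).
apply: (@filterS2 _ _ (ae_filter_ringOfSetsType (@leb R))) (rearr_edecreasing_ae kd k0) aeu => x kx ux Ix.
by rewrite kx// ux.
Qed.

Lemma hardy_le_ae (p q : R -> \bar R) : 0 <= a ->
  measurable_fun (itv0 a : set T) (p : T -> \bar R) ->
  measurable_fun (itv0 a : set T) (q : T -> \bar R) ->
  measurable_fun (itv0 a : set T) ((fun x => p x * u x) : T -> \bar R) ->
  measurable_fun (itv0 a : set T) ((fun x => q x * u x) : T -> \bar R) ->
  (forall x, itv0 a x -> 0 <= p x) -> (forall x, itv0 a x -> 0 <= q x) ->
  (forall x, itv0 a x -> \int[leb]_(y in `]0%R, x[) p y <= \int[leb]_(y in `]0%R, x[) q y) ->
  \int[leb]_(x in itv0 a) (p x * u x) <= \int[leb]_(x in itv0 a) (q x * u x).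
Proof.
move=> a0 mp mq mpu mqu p0 q0 pq; have [k [kd k0 ku]] := ae_decreasing_regular.
have E (r : R -> \bar R) : measurable_fun (itv0 a : set T) (r : T -> \bar R) ->
    measurable_fun (itv0 a : set T) ((fun x => r x * u x) : T -> \bar R) ->
    (forall x, itv0 a x -> 0 <= r x) ->
    \int[leb]_(x in itv0 a) (r x * u x) = \int[leb]_(x in itv0 a) (r x * k x).
  move=> mr mru r0; apply: ge0_ae_eq_integral.
  - exact: measurable_itv0.
  - exact: mru.
  - apply: emeasurable_funM; [exact: mr|exact: measurable_edecreasing].
  - by move=> x Ix; rewrite mule_ge0 ?r0 ?u_ge0.
  - by move=> x Ix; rewrite mule_ge0 ?r0 ?k0.
  - by apply: (ae_notin_countable countable_N) => x Nx Ix; rewrite ku.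
rewrite (E p)// (E q)//; exact: hardy_le.
Qed.

End ae_decreasing.

Lemma integral_rearr_weight {R : realType} (a : \bar R) (v : R -> R) x :
  0 < a -> positive_on a v -> decreasing_on a v -> itv0 a x ->
  \int[leb]_(t in `]0%R, x[) rearr a (EFin \o v) t = \int[leb]_(t in `]0%R, x[) (v t)%:E.
Proof.
move=> a0 vp vd Ix; have sub : `]0%R, x[ `<=` itv0 a.
  by apply: itvoo_sub_itv0 => //; exact/ltW/Ix.2.
have vd' : edecreasing_on a (EFin \o v).
  by move=> y z Iy Iz yz; rewrite lee_fin vd ?inE.
have v0' y : itv0 a y -> 0 <= (EFin \o v) y.
  by move=> Iy; rewrite lee_fin ltW// vp// inE.
have mI := @measurable_itv0 R a.
apply: ge0_ae_eq_integral.
- exact: measurable_itv_leb.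
- apply: (measurable_funS mI sub); exact: measurable_rearr.
- apply: (measurable_funS mI sub); exact: (measurable_edecreasing vd').
- by move=> y _; exact: rearr_ge0.
- by move=> y /sub; exact: v0'.
apply: (@filterS _ _ (ae_filter_ringOfSetsType (@leb R))) (rearr_edecreasing_ae vd' v0').
by move=> y H /sub Iy; exact: H.
Qed.

(** * The modular of the level function *)

Section level_modular.
Context {R : realType} (a : \bar R) (f : R -> \bar R) (w : R -> R) (C : R).
Local Notation T := (lebesgue_type R).
Hypothesis a_gt0 : 0 < a.
Hypothesis w_pos : positive_on a w.
Hypothesis w_decr : decreasing_on a w.
Hypothesis w_int : forall t, itv0 a t -> \int[leb]_(x in `]0%R, t[) (w x)%:E < +oo.
Hypothesis f_int : forall t, itv0 a t -> \int[leb]_(x in `]0%R, t[) rearr a f x < +oo.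
Local Notation F := (primitive (rearr a f)).
Local Notation W := (primitive (EFin \o w)).
Local Notation fr := (fine \o rearr a f).
Hypothesis C_ge0 : (0 <= C)%R.
Hypothesis growth : forall t, cdom a t -> (F t <= C * (1 + W t))%R.
Local Notation slope := (level_slope a F W fr w).
Local Notation weight := (level_weight a F W fr w).
Local Notation N := (jump_set a (rearr a f)).

Let a_ge0 : 0 <= a := ltW a_gt0.
Let countable_N : countable N. Proof. exact: countable_jump_set. Qed.
Let slope0 t : itv0 a t -> (0 <= slope t)%R.
Proof. exact: (slope_ge0 w_pos w_decr w_int f_int C_ge0 growth). Qed.
Let slope_decr t t' : itv0 a t -> itv0 a t' -> ~ N t -> ~ N t' ->
  (t <= t')%R -> (slope t' <= slope t)%R.
Proof. exact: (slope_anti a_gt0 w_pos w_decr w_int f_int C_ge0 growth). Qed.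
Let mslope : measurable_fun (itv0 a : set T) ((fun x => (slope x * w x)%:E) : T -> \bar R).
Proof. exact: (measurable_slopeM a_gt0 w_pos w_decr w_int f_int C_ge0 growth). Qed.
Let vpos : positive_on a weight.
Proof. exact: (weight_pos w_pos w_decr w_int f_int C_ge0 growth). Qed.
Let vdecr : decreasing_on a weight.
Proof. exact: (weight_decr a_gt0 w_pos w_decr w_int f_int C_ge0 growth). Qed.
Let lfE t : itv0 a t -> level_function a w f t = (slope t * w t)%:E.
Proof. exact: (level_functionE a_gt0 w_pos w_decr w_int f_int C_ge0 growth). Qed.
Let mw : measurable_fun (itv0 a : set T) ((EFin \o w) : T -> \bar R).
Proof. by apply/measurable_EFinP; apply: measurable_decreasing; exact: w_decr. Qed.
Let w0 x : itv0 a x -> (0 <= w x)%R.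
Proof. by move=> Ix; rewrite ltW// w_pos// inE. Qed.
Let mI := @measurable_itv0 R a.
Let aeF := ae_filter_ringOfSetsType (@leb R).

Lemma level_function_ae_decreasing x y : itv0 a x -> itv0 a y -> ~ N x -> ~ N y ->
  (x <= y)%R -> level_function a w f y <= level_function a w f x.
Proof.
move=> Ix Iy Nx Ny xy; rewrite !lfE// lee_fin ler_pM ?slope0 ?w0//.
  exact: slope_decr.
by rewrite w_decr ?inE.
Qed.

Lemma level_function_ge0 x : itv0 a x -> 0 <= level_function a w f x.
Proof. by move=> Ix; rewrite lfE// lee_fin mulr_ge0 ?slope0 ?w0. Qed.

Lemma measurable_level_function :
  measurable_fun (itv0 a : set T) (level_function a w f : T -> \bar R).
Proof.
apply: (@eq_measurable_fun _ _ T _ _ (fun x => (slope x * w x)%:E)); last exact: mslope.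
by move=> x; rewrite inE => Ix; rewrite lfE.
Qed.

Lemma rearr_level_function :
  {ae (@leb R), forall x : R, itv0 a x ->
     rearr a (level_function a w f) x = (slope x * w x)%:E}.
Proof.
have := rearr_ae_decreasing countable_N level_function_ae_decreasing level_function_ge0.
by apply: (@filterS _ _ aeF) => x H Ix; rewrite H// lfE.
Qed.

Section modulars.
Variable phi : R -> R.
Hypothesis phi_orlicz : orlicz_function phi.

Lemma measurable_complementary_slope t : measurable_fun (itv0 a : set T)
  ((fun x => complementary phi (t^-1 * slope x)%:E * (w x)%:E) : T -> \bar R).
Proof.
apply: (@eq_measurable_fun _ _ T _ _ (fun x => complementary phi
   (t^-1%:E * (slope x * w x)%:E / (w x)%:E) * (w x)%:E)).
  move=> x; rewrite inE => Ix; rewrite -EFinM inver gt_eqF ?w_pos ?inE//.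
  by rewrite -EFinM mulrA mulfK// gt_eqF// w_pos// inE.
apply: (measurable_Mmod phi w_pos w_decr (p := fun x => t^-1%:E * (slope x * w x)%:E)).
by apply: emeasurable_funM; [exact: measurable_cst|exact: mslope].
Qed.

Lemma Mmod_level_function t : (0 < t)%R ->
  Mmod a phi w (escale t^-1 (level_function a w f)) =
  \int[leb]_(x in itv0 a) (complementary phi (t^-1 * slope x)%:E * (w x)%:E).
Proof.
move=> t0; rewrite /Mmod; apply: ge0_ae_eq_integral.
- exact: mI.
- apply: (measurable_Mmod phi w_pos w_decr); exact: measurable_rearr.
- exact: measurable_complementary_slope.
- by move=> x Ix; rewrite mule_ge0 ?complementary_ge0 ?lee_fin ?w0.
- by move=> x Ix; rewrite mule_ge0 ?complementary_ge0 ?lee_fin ?w0.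
apply: (@filterS _ _ aeF) rearr_level_function => x H Ix.
rewrite rearr_scale ?invr_gt0// H// -EFinM inver gt_eqF ?w_pos ?inE//.
by rewrite -EFinM mulrA mulfK// gt_eqF// w_pos// inE.
Qed.

Lemma Mmod_level_weight_le t : (0 < t)%R ->
  Mmod a phi weight (escale t^-1 f) <= Mmod a phi w (escale t^-1 (level_function a w f)).
Proof.
move=> t0; rewrite Mmod_level_function//.
have mv : measurable_fun (itv0 a : set T) ((EFin \o weight) : T -> \bar R).
  by apply/measurable_EFinP; apply: measurable_decreasing; exact: vdecr.
have E x : itv0 a x -> rearr a (escale t^-1 f) x / (weight x)%:E = (t^-1 * slope x)%:E.
  move=> Ix; rewrite rearr_scale ?invr_gt0//.
  rewrite -(slope_weight w_pos w_decr w_int f_int C_ge0 growth Ix).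
  by rewrite -EFinM inver gt_eqF ?vpos ?inE// -EFinM mulrA mulfK// gt_eqF// vpos// inE.
have EI : Mmod a phi weight (escale t^-1 f) =
    \int[leb]_(x in itv0 a) ((weight x)%:E * complementary phi (t^-1 * slope x)%:E).
  by apply: eq_integral => x; rewrite inE => Ix; rewrite E// muleC.
rewrite EI.
rewrite (@eq_integral _ T R leb _ (fun x => (w x)%:E * complementary phi (t^-1 * slope x)%:E)
  (fun x => complementary phi (t^-1 * slope x)%:E * (w x)%:E)); last first.
  by move=> x _; rewrite muleC.
apply: (@hardy_le_ae R a _ N countable_N).
- move=> x y Ix Iy Nx Ny xy; apply: complementary_nd => //.
  by rewrite lee_fin ler_wpM2l ?invr_ge0 ?(ltW t0)//; exact: slope_decr.
- by move=> x Ix; exact: complementary_ge0.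
- exact: a_ge0.
- exact: mv.
- exact: mw.
- apply: (@eq_measurable_fun _ _ T _ _ (fun x => complementary phi
    (rearr a (escale t^-1 f) x / (weight x)%:E) * (weight x)%:E)).
    by move=> x; rewrite inE => Ix; rewrite E// muleC.
  apply: (measurable_Mmod phi vpos vdecr); exact: measurable_rearr.
- apply: (@eq_measurable_fun _ _ T _ _
    (fun x => complementary phi (t^-1 * slope x)%:E * (w x)%:E)); last exact: measurable_complementary_slope.
  by move=> x _; rewrite muleC.
- by move=> x Ix; rewrite lee_fin ltW// vpos// inE.
- by move=> x Ix; rewrite lee_fin w0.
- exact: (weight_submaj a_gt0 w_pos w_decr w_int f_int C_ge0 growth).
Qed.

End modulars.

Lemma admissible_level_weight : admissible_weight a w weight.
Proof.
split; [|exact: vpos|exact: vdecr].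
move=> x Ix; rewrite !integral_rearr_weight//.
exact: (weight_submaj a_gt0 w_pos w_decr w_int f_int C_ge0 growth).
Qed.

Lemma submaj_level_function : submaj a f (level_function a w f).
Proof.
move=> x Ix; have sub : `]0%R, x[ `<=` itv0 a.
  by apply: itvoo_sub_itv0 => //; exact/ltW/Ix.2.
apply: le_trans (rearr_le_slope a_gt0 w_pos w_decr w_int f_int C_ge0 growth Ix) _.
rewrite le_eqVlt; apply/orP; left; apply/eqP; apply: ge0_ae_eq_integral.
- exact: measurable_itv_leb.
- exact: (measurable_funS mI sub mslope).
- apply: (measurable_funS mI sub); exact: measurable_rearr.
- by move=> y /sub Iy; rewrite lee_fin mulr_ge0 ?slope0 ?w0.
- by move=> y _; exact: rearr_ge0.
apply: (@filterS _ _ aeF) rearr_level_function => y H /sub Iy.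
by rewrite H.
Qed.

End level_modular.

Section separable_sup.
Context {R : realType} (D : set R) (g : nat -> R -> R).

(** The points [b i] vary independently, so a bound on all sums is a bound on the sum of the
    suprema. Induction removes the last summand, whose supremum is finite because the other points
    can be fixed. *)
Lemma separable_sup N M : D !=set0 ->
  (forall b : nat -> R, (forall i, D (b i)) -> (\sum_(i < N) g i (b i) <= M)%R) ->
  exists S : nat -> R, (forall i x, (i < N)%N -> D x -> (g i x <= S i)%R) /\
                       (\sum_(i < N) S i <= M)%R.
Proof.
move=> [x0 Dx0]; elim: N M => [|N IH] M H.
  exists (fun=> 0%R); split => //.
  by have := H (fun=> x0) (fun=> Dx0); rewrite !big_ord0.
have H' x (b : nat -> R) : D x -> (forall i, D (b i)) ->
    (g N x <= M - \sum_(i < N) g i (b i))%R.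
  move=> Dx Db; have := H (fun i => if i == N then x else b i).
  rewrite big_ord_recr/= eqxx (eq_bigr (fun i : 'I_N => g i (b i))); last first.
    by move=> i _; rewrite (ltn_eqF (ltn_ord i)).
  by rewrite lerBrDl; apply => i; case: ifP.
have ub : has_sup (g N @` D).
  split; first by exists (g N x0); exists x0.
  by exists (M - \sum_(i < N) g i x0)%R => _ [x Dx <-]; exact: (H' x (fun=> x0)).
have [|S [gS SM]] := IH (M - sup (g N @` D))%R.
  move=> b Db; rewrite lerBrDl -lerBrDr; apply: ge_sup; first exact: ub.1.
  by move=> _ [x Dx <-]; exact: H'.
exists (fun i => if i == N then sup (g N @` D) else S i); split.
  move=> i x; rewrite ltnS leq_eqVlt => /predU1P[->|iN] Dx.
    by rewrite eqxx; apply: ub_le_sup; [exact: ub.2|exists x].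
  by rewrite (ltn_eqF iN) gS.
rewrite big_ord_recr/= eqxx -lerBrDr.
rewrite (eq_bigr (fun i : 'I_N => S i)) => // i _.
by rewrite (ltn_eqF (ltn_ord i)).
Qed.

End separable_sup.

(** * Step functions as test functions *)

Section steps.
Context {R : realType} (a : \bar R) (phi w : R -> R).
Local Notation T := (lebesgue_type R).
Hypothesis a_gt0 : 0 < a.
Hypothesis phi_orlicz : orlicz_function phi.
Hypothesis w_pos : positive_on a w.
Hypothesis w_decr : decreasing_on a w.
Hypothesis w_int : forall t, itv0 a t -> \int[leb]_(x in `]0%R, t[) (w x)%:E < +oo.
Local Notation W := (primitive (EFin \o w)).

Let w0 x : itv0 a x -> (0 <= w x)%R.
Proof. by move=> Ix; rewrite ltW// w_pos// inE. Qed.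
Let mI := @measurable_itv0 R a.
Let mw : measurable_fun (itv0 a : set T) ((EFin \o w) : T -> \bar R).
Proof. by apply/measurable_EFinP; apply: measurable_decreasing; exact: w_decr. Qed.

(** The points [b i] are in no particular order, since [separable_sup] chooses them independently;
    [orlicz_count] accepts any pattern of indicators. *)
Definition steps (d : R) (N : nat) (b : nat -> R) (x : R) : R :=
  (d * \sum_(i < N) (x < b i)%R%:R)%R.

Lemma test_fun_step (b : R) : (0 <= b)%R -> b%:E < a ->
  test_fun a (fun x => (x < b)%R%:R).
Proof.
move=> b0 ba; split.
- move=> x y _ _ xy; rewrite ler_nat.
  by case: (ltP y b) => // yb; rewrite (le_lt_trans xy yb).
- by move=> x _; rewrite ler0n.
- by exists b; split => // x _ bx; rewrite ltNge bx.
- by exists 1%R => x _; case: (x < b)%R => //=; rewrite ler01.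
Qed.

Lemma stepsS d N b : steps d N.+1 b =
  (fun x => 1 * steps d N b x + d * (x < b N)%R%:R)%R.
Proof. by apply/funext => x; rewrite /steps big_ord_recr/= mulrDr mul1r. Qed.

Lemma test_fun_steps d N b : (0 <= d)%R -> (forall i, (0 <= b i)%R /\ (b i)%:E < a) ->
  test_fun a (steps d N b).
Proof.
move=> d0 bD; elim: N => [|N IH].
  rewrite (_ : steps _ _ _ = fun=> 0%R); first exact: test_fun0.
  by apply/funext => x; rewrite /steps big_ord0 mulr0.
by rewrite stepsS; apply: test_fun_mix => //; apply: test_fun_step; have [] := bD N.
Qed.

Lemma integral_step (p : R -> \bar R) (b : R) : (0 <= b)%R -> b%:E < a ->
  \int[leb]_(x in itv0 a) (p x * ((x < b)%R%:R : R)%:E) = \int[leb]_(x in `]0%R, b[) p x.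
Proof.
rewrite le_eqVlt => /predU1P[<-|b0] ba.
  rewrite set_itvoo0 integral_set0 integral0_eq// => x [x0 _].
  by rewrite ltNge (ltW x0) mule0.
rewrite (@integral_vanish R a _ b).
- by apply: eq_integral => x; rewrite inE/= in_itv/= => /andP[_ ->]; rewrite mule1.
- by split.
- by move=> x _ bx; rewrite ltNge bx mule0.
Qed.

Lemma pairing_steps (f : R -> R) d N b : (0 <= d)%R ->
  (forall i, (0 <= b i)%R /\ (b i)%:E < a) ->
  pairing a f (steps d N b) =
  \sum_(i < N) d%:E * \int[leb]_(x in `]0%R, b i[) rearr a (EFin \o f) x.
Proof.
move=> d0 bD; elim: N => [|N IH].
  rewrite big_ord0 /pairing integral0_eq// => x _.
  by rewrite /steps big_ord0 mulr0 mule0.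
rewrite stepsS pairing_mix//.
- rewrite mul1e IH big_ord_recr/=; congr (_ + _ * _).
  by have [b0 ba] := bD N; rewrite /pairing integral_step.
- exact: test_fun_steps.
- by have [b0 ba] := bD N; exact: test_fun_step.
Qed.

Lemma modular_steps d N b : (0 <= d)%R -> (forall i, (0 <= b i)%R /\ (b i)%:E < a) ->
  modular a phi w (steps d N b) <= (\sum_(i < N) increment phi d i * W (b i))%:E.
Proof.
move=> d0 bD.
have i0 i : (0 <= increment phi d i)%R by exact: increment_ge0.
have wd : edecreasing_on a (EFin \o w).
  by move=> x y Ix Iy xy; rewrite lee_fin w_decr ?inE.
have w0' x : itv0 a x -> 0 <= (EFin \o w) x by move=> Ix; rewrite lee_fin w0.
pose q i x := (increment phi d i)%:E * ((EFin \o w) x * ((x < b i)%R%:R : R)%:E).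
have mstep i : measurable_fun (itv0 a : set T)
    ((fun x => (EFin \o w) x * ((x < b i)%R%:R : R)%:E) : T -> \bar R).
  apply: emeasurable_funM; first exact: mw.
  apply/measurable_EFinP; apply: measurable_decreasing.
  by have [b0 ba] := bD i; have [] := test_fun_step b0 ba.
have mq i : measurable_fun (itv0 a : set T) (q i : T -> \bar R).
  by apply: emeasurable_funM; [exact: measurable_cst|exact: mstep].
have s0 i x : itv0 a x -> 0 <= (EFin \o w) x * ((x < b i)%R%:R : R)%:E.
  by move=> Ix; rewrite mule_ge0 ?w0'// lee_fin.
have q0 i x : itv0 a x -> 0 <= q i x.
  by move=> Ix; rewrite mule_ge0 ?s0// lee_fin.
apply: (@le_trans _ _ (\int[leb]_(x in itv0 a) \sum_(i < N) q i x)).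
  apply: ge0_le_integral.
  - exact: mI.
  - move=> x Ix; rewrite lee_fin mulr_ge0 ?w0// (orlicz_ge0 phi_orlicz)//.
    by rewrite /steps mulr_ge0// sumr_ge0.
  - exact (measurable_modular phi_orlicz w_pos w_decr (test_fun_steps N d0 bD)).
  - by apply: emeasurable_sum => i; exact: mq.
  - move=> x Ix; rewrite /q /= (eq_bigr (fun i : 'I_N =>
      (increment phi d i * (x < b i)%R%:R * w x)%:E)) => [|i _]; last first.
      by rewrite -!EFinM mulrAC mulrA.
    rewrite sumEFin lee_fin -mulr_suml ler_wpM2r ?w0//.
    exact: (orlicz_count phi_orlicz N (fun i => x < b i)%R).
rewrite (ge0_integral_sum leb mI (f := fun i : 'I_N => q i)).
- rewrite -sumEFin; apply: lee_sum => i _.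
  rewrite (ge0_integralZl_EFin leb mI).
  + have [b0 ba] := bD i; rewrite integral_step// (primitiveE wd w0' w_int)//.
    by split => //; exact: ltW.
  + by move=> x; exact: s0.
  + exact: mstep.
  + exact: i0.
- by move=> i; exact: mq.
- by move=> i x; exact: q0.
Qed.

Section growth.
Variables (f : R -> R) (K : R).
Hypothesis K_ge0 : (0 <= K)%R.
Hypothesis pairing_growth : forall h, test_fun a h ->
  pairing a f h <= K%:E * (1 + modular a phi w h).
Local Notation F := (primitive (rearr a (EFin \o f))).

(** The test function is a single step of height 1 on [(0, t)], whose modular is at most
    [phi 1 * W t]. *)
Let integral_growth t : itv0 a t ->
  \int[leb]_(x in `]0%R, t[) rearr a (EFin \o f) x <= (K * (1 + phi 1 * W t))%:E.
Proof.
move=> [t0 ta].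
have bD (i : nat) : (0 <= (fun=> t) i)%R /\ ((fun=> t) i)%:E < a.
  by split => //; exact: ltW.
have := pairing_growth (test_fun_steps 1 (b := fun=> t) (@ler01 R) bD).
rewrite pairing_steps// big_ord_recr big_ord0/= add0e mul1e => /le_trans; apply.
rewrite EFinM; apply: lee_wpmul2l; first by rewrite lee_fin.
rewrite EFinD; apply: leeD2l.
have := modular_steps 1 (b := fun=> t) (@ler01 R) bD.
rewrite big_ord_recr big_ord0/= add0r /increment mulr1 mul0r (orlicz0 phi_orlicz) subr0.
by [].
Qed.

Lemma rearr_integrable t : itv0 a t ->
  \int[leb]_(x in `]0%R, t[) rearr a (EFin \o f) x < +oo.
Proof. by move=> /integral_growth/le_lt_trans; apply; rewrite ltry. Qed.

(** The bound of [integral_growth], weakened to a multiple of [1 + W t] and extended to a finite end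
    [t = a] by exhaustion. *)
Lemma primitive_growth t : cdom a t -> (F t <= K * (1 + phi 1) * (1 + W t))%R.
Proof.
have kd := @rearr_edecreasing R a (EFin \o f).
have k0 x : itv0 a x -> 0 <= rearr a (EFin \o f) x by move=> _; exact: rearr_ge0.
have wd : edecreasing_on a (EFin \o w).
  by move=> x y Ix Iy xy; rewrite lee_fin w_decr ?inE.
have w0' x : itv0 a x -> 0 <= (EFin \o w) x by move=> Ix; rewrite lee_fin w0.
have p0 : (0 <= phi 1)%R by rewrite (orlicz_ge0 phi_orlicz).
have Wnd := primitive_nd wd w0' w_int.
have D0 : cdom a 0%R by split => //; exact: ltW.
have W0 s : cdom a s -> (0 <= W s)%R.
  by move=> Ds; rewrite -(@primitive0 R (EFin \o w)) Wnd//; case: Ds.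
have le s : cdom a s -> (K * (1 + phi 1 * W s) <= K * (1 + phi 1) * (1 + W s))%R.
  move=> Ds; rewrite -mulrA ler_wpM2l//.
  by have := W0 _ Ds; move: p0; nra.
move=> Dt; have [t0 ta] := Dt.
rewrite -lee_fin -(primitiveE kd k0 rearr_integrable Dt).
have [->|tn0] := eqVneq t 0%R.
  by rewrite set_itvoo0 integral_set0 lee_fin mulr_ge0 ?mulr_ge0 ?addr_ge0 ?W0.
have {tn0}t0 : (0 < t)%R by rewrite lt_neqAle eq_sym tn0.
rewrite -itv0_fin; apply: integral_itv0_le.
- by rewrite lte_fin.
- apply: (measurable_funS mI); last exact: measurable_rearr.
  exact: itv0_le.
- by move=> x _; exact: rearr_ge0.
move=> x [x0 xt]; rewrite lte_fin in xt.
have Ix : itv0 a x by split => //; apply: lt_le_trans ta; rewrite lte_fin.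
have Dx : cdom a x by split; [exact: ltW|exact/ltW/Ix.2].
apply: (le_trans (integral_growth Ix)); rewrite lee_fin.
apply: (le_trans (le _ Dx)); rewrite ler_wpM2l ?mulr_ge0 ?addr_ge0//.
by rewrite lerD2l Wnd// ltW.
Qed.

End growth.

End steps.

Lemma limn_einfMr {R : realType} (u : (\bar R)^nat) (c : R) : (0 < c)%R ->
  limn_einf u * c%:E <= limn_einf (fun n => u n * c%:E).
Proof.
move=> c0; rewrite !limn_einf_lim.
have H : einfs u n * c%:E @[n --> \oo] --> limn (einfs u) * c%:E.
  by apply: cvgeZr => //; exact: is_cvg_einfs.
rewrite -(cvg_lim _ H)//; apply: lee_lim; [exact: cvgP H|exact: is_cvg_einfs|].
apply: nearW => n; apply: le_ereal_inf_tmp => _ [k nk <-].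
apply: lee_wpmul2r; first by rewrite lee_fin ltW.
by apply: ereal_inf_lbound; exists k.
Qed.

(** * Bounding the modular of the level function by test functions *)

Section level_excess.
Context {R : realType} (a : \bar R) (f : R -> R) (phi w : R -> R) (C : R).
Local Notation T := (lebesgue_type R).
Hypothesis a_gt0 : 0 < a.
Hypothesis phi_orlicz : orlicz_function phi.
Hypothesis w_pos : positive_on a w.
Hypothesis w_decr : decreasing_on a w.
Hypothesis w_int : forall t, itv0 a t -> \int[leb]_(x in `]0%R, t[) (w x)%:E < +oo.
Hypothesis f_int : forall t, itv0 a t ->
  \int[leb]_(x in `]0%R, t[) rearr a (EFin \o f) x < +oo.
Local Notation F := (primitive (rearr a (EFin \o f))).
Local Notation W := (primitive (EFin \o w)).
Local Notation fr := (fine \o rearr a (EFin \o f)).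
Hypothesis C_ge0 : (0 <= C)%R.
Hypothesis growth : forall t, cdom a t -> (F t <= C * (1 + W t))%R.
Local Notation slope := (level_slope a F W fr w).
Local Notation N := (jump_set a (rearr a (EFin \o f))).

Let slope0 t : itv0 a t -> (0 <= slope t)%R.
Proof. exact: (slope_ge0 w_pos w_decr w_int f_int C_ge0 growth). Qed.
Let slope_decr t t' : itv0 a t -> itv0 a t' -> ~ N t -> ~ N t' ->
  (t <= t')%R -> (slope t' <= slope t)%R.
Proof. exact: (slope_anti a_gt0 w_pos w_decr w_int f_int C_ge0 growth). Qed.
Let mslope : measurable_fun (itv0 a : set T) ((fun x => (slope x * w x)%:E) : T -> \bar R).
Proof. exact: (measurable_slopeM a_gt0 w_pos w_decr w_int f_int C_ge0 growth). Qed.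
Let mw : measurable_fun (itv0 a : set T) ((EFin \o w) : T -> \bar R).
Proof. by apply/measurable_EFinP; apply: measurable_decreasing; exact: w_decr. Qed.
Let w0 x : itv0 a x -> (0 <= w x)%R.
Proof. by move=> Ix; rewrite ltW// w_pos// inE. Qed.
Let mI := @measurable_itv0 R a.
Let wd : edecreasing_on a (EFin \o w).
Proof. by move=> x y Ix Iy xy; rewrite lee_fin w_decr ?inE. Qed.
Let w0' x : itv0 a x -> 0 <= (EFin \o w) x.
Proof. by move=> Ix; rewrite lee_fin w0. Qed.

Let part c x := (Num.max 0 (slope x - c) * w x)%:E.

Let part_ge0 c x : itv0 a x -> 0 <= part c x.
Proof. by move=> Ix; rewrite lee_fin mulr_ge0 ?w0// le_max lexx. Qed.

Let measurable_part c : measurable_fun (itv0 a : set T) (part c : T -> \bar R).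
Proof.
apply: (@eq_measurable_fun _ _ T _ _
  (fun x => maxe 0 ((slope x * w x)%:E - c%:E * (EFin \o w) x))).
  move=> x; rewrite inE => Ix; rewrite /part -EFinM -EFinB -mulrBl.
  by rewrite -[0%E]/(0%:E) -EFin_max maxr_pMl ?w0// mul0r.
apply: measurable_maxe; first exact: measurable_cst.
apply: emeasurable_funB; first exact: mslope.
by apply: emeasurable_funM; [exact: measurable_cst|exact: mw].
Qed.

(** Where the slope exceeds [c] at [x], it exceeds [c] almost everywhere before [x]. The positive
    part is then [slope - c] on [(0, x)], and its integral is the primitive of the level function
    minus [c * W x]. *)
Let integral_part_good (c B x : R) : (0 <= c)%R -> itv0 a x -> ~ N x -> (c < slope x)%R ->
  (forall t, (0 <= t)%R -> t%:E < a -> (tilt F W c t <= B)%R) ->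
  \int[leb]_(y in `]0%R, x[) part c y <= B%:E.
Proof.
move=> c0 Ix Nx cx HB.
have Dx : cdom a x by split; [exact/ltW/Ix.1|exact/ltW/Ix.2].
have sub := cdom_sub (lexx _) Dx.
have mJ := measurable_itv_leb `]0%R, x[.
have Hc p : covers a F W p x -> (c <= p.2)%R.
  move=> cov; apply: ltW; apply: lt_le_trans cx _.
  by rewrite (slope_covered w_pos w_decr w_int f_int C_ge0 growth cov).
have E : \int[leb]_(y in `]0%R, x[) part c y + (c * W x)%:E =
    \int[leb]_(y in `]0%R, x[) (slope y * w y)%:E.
  have mcw : measurable_fun (itv0 a : set T) ((fun y => c%:E * (EFin \o w) y) : T -> \bar R).
    by apply: emeasurable_funM; [exact: measurable_cst|exact: mw].
  rewrite EFinM -(primitiveE wd w0' w_int Dx) -(ge0_integralZl_EFin leb mJ); last first.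
  - exact: c0.
  - exact: (measurable_funS mI sub mw).
  - by move=> y /sub; exact: w0'.
  rewrite -(ge0_integralD leb mJ); last first.
  - exact: (measurable_funS mI sub mcw).
  - by move=> y /sub Iy; rewrite mule_ge0 ?w0'// lee_fin.
  - exact: (measurable_funS mI sub (measurable_part c)).
  - by move=> y /sub; exact: part_ge0.
  apply: ge0_ae_eq_integral.
  - exact: mJ.
  - apply: emeasurable_funD; [exact: (measurable_funS mI sub (measurable_part c))|].
    exact: (measurable_funS mI sub mcw).
  - exact: (measurable_funS mI sub mslope).
  - by move=> y /sub Iy; rewrite adde_ge0 ?part_ge0// mule_ge0 ?w0'// lee_fin.
  - by move=> y /sub Iy; rewrite lee_fin mulr_ge0 ?slope0 ?w0.
  apply: (ae_notin_countable (countable_jump_set a (rearr a (EFin \o f)))) => y Ny yJ.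
  have Iy := sub y yJ; move: yJ; rewrite /= in_itv/= => /andP[_ yx].
  have cy : (c <= slope y)%R.
    by apply: (le_trans (ltW cx)); apply: slope_decr => //; exact: ltW.
  rewrite /part max_r ?subr_ge0// -EFinM -EFinD; congr EFin; ring.
have := integral_slope_bound a_gt0 w_pos w_decr w_int f_int C_ge0 growth Ix HB Hc.
by rewrite -E EFinD leeD2rE.
Qed.

(** Outside a countable set the slope exceeds [c] only on the initial interval [(0, b)], as it
    decreases there; this interval is exhausted by points to which [integral_part_good] applies. *)
Lemma integral_slope_excess (c B : R) : (0 <= c)%R ->
  (forall t, (0 <= t)%R -> t%:E < a -> (tilt F W c t <= B)%R) ->
  \int[leb]_(x in itv0 a) part c x <= B%:E.
Proof.
move=> c0 HB.
have B0 : 0 <= B%:E.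
  by have := HB 0%R (lexx _) a_gt0; rewrite /tilt !primitive0 mulr0 subr0 lee_fin.
pose good := [set x | [/\ itv0 a x, ~ N x & (c < slope x)%R]].
pose b := ereal_sup [set x%:E | x in good].
have ba : b <= a by apply: ge_ereal_sup => _ [x [[_ xa] _ _] <-]; exact: ltW.
have subb := itv0_le ba.
have mb := @measurable_itv0 R b.
have -> : \int[leb]_(x in itv0 a) part c x = \int[leb]_(x in itv0 b) part c x.
  have -> : itv0 b = itv0 a `&` itv0 b by apply/esym/setIidr.
  rewrite [RHS]integral_mkcondr; apply: ge0_ae_eq_integral.
  - exact: mI.
  - exact: measurable_part.
  - apply: (measurable_restrict _ mb mI).1.
    apply: (measurable_funS mI _ (measurable_part c)); exact: subIsetl.
  - by move=> x; exact: part_ge0.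
  - by move=> x Ix; rewrite patchE; case: ifP => // _; exact: part_ge0.
  have cN' : countable (N `|` [set fine b]).
    rewrite -bigcup2E; apply: bigcup_countable => // -[|[|n]] _ //=.
    exact: countable_jump_set.
  apply: (ae_notin_countable cN') => x /not_orP[Nx xb] Ix.
  rewrite patchE; case: ifPn => // /negP; rewrite inE => nbx.
  rewrite /part max_l ?mul0r// subr_le0 leNgt; apply/negP => cx.
  have xleb : x%:E <= b by apply: ereal_sup_ubound; exists x.
  have xltb : x%:E < b.
    rewrite lt_neqAle xleb andbT; apply/eqP => xE; apply: xb.
    by rewrite /= -xE.
  by apply: nbx; split => //; case: Ix.
have [b0|b0] := ltP 0 b; last first.
  rewrite (_ : itv0 b = set0) ?integral_set0// -subset0 => x [x0 xb].
  by have := lt_le_trans xb b0; rewrite lte_fin ltNge ltW.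
apply: integral_itv0_le => //.
- exact: (measurable_funS mI subb (measurable_part c)).
- by move=> x /subb; exact: part_ge0.
move=> x [x0 xb].
have [_ [x' [Ix' Nx' cx'] <-]] := ereal_sup_gt xb; rewrite lte_fin => xx'.
have sub' := cdom_sub (lexx 0%R) (conj (ltW Ix'.1) (ltW Ix'.2)).
apply: le_trans (integral_part_good c0 Ix' Nx' cx' HB).
apply: ge0_subset_integral.
- exact: measurable_itv_leb.
- exact: measurable_itv_leb.
- exact: (measurable_funS mI sub' (measurable_part c)).
- by move=> y /sub'; exact: part_ge0.
move=> y; rewrite /= !in_itv/= => /andP[-> yx]; exact: lt_trans xx'.
Qed.

Lemma integral_excess_le (t B d : R) M : (0 < t)%R -> (0 < d)%R ->
  (forall h, test_fun a h -> pairing a f h <= t%:E * (modular a phi w h + B%:E)) ->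
  \int[leb]_(x in itv0 a) (excess phi d M (t^-1 * slope x) * w x)%:E <= B%:E.
Proof.
move=> t0 d0 HB.
pose D := [set b : R | (0 <= b)%R /\ b%:E < a].
pose g i b := (d * F b - t * (increment phi d i * W b))%R.
have Dcdom b : D b -> cdom a b by move=> [b0 ba]; split => //; exact: ltW.
have F_E := primitiveE (@rearr_edecreasing R a (EFin \o f))
    (fun y _ => rearr_ge0 a (EFin \o f) y) f_int.
have [||S [gS SM]] := @separable_sup R D g M (t * B)%R.
- by exists 0%R; split.
- move=> b Db; have := HB _ (test_fun_steps a_gt0 M (ltW d0) Db).
  have mod_le := modular_steps a_gt0 phi_orlicz w_pos w_decr w_int M (ltW d0) Db.
  rewrite (pairing_steps a_gt0 f M (ltW d0) Db).
  rewrite (eq_bigr (fun i : 'I_M => (d * F (b i))%:E)) => [|i _]; last first.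
    by rewrite F_E ?EFinM//; exact/Dcdom/Db.
  rewrite sumEFin => pair_le.
  have {pair_le} := le_trans pair_le (lee_wpmul2l (ltW t0 : 0 <= t%:E) (leeD2r B%:E mod_le)).
  rewrite -EFinD -EFinM lee_fin mulrDr mulr_sumr /g sumrB; clear.
  by rewrite lerBlDl.
have i0 i : (0 <= increment phi d i)%R := increment_ge0 phi_orlicz i (ltW d0).
(* The value of [slope] at which the [i]-th term of the excess becomes positive; [g i] is [d] times
   [tilt F W (c i)]. *)
pose c i := (increment phi d i * t / d)%R.
have c0 i : (0 <= c i)%R by rewrite !mulr_ge0 ?invr_ge0// ltW.
have dt : (0 <= d / t)%R by rewrite divr_ge0// ltW.
have partE i x : ((Num.max 0 (d * (t^-1 * slope x) - increment phi d i)) * w x)%:E =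
    (d / t)%:E * part (c i) x.
  rewrite /part -EFinM [in RHS]mulrA; congr (_ * _)%:E; rewrite maxr_pMr// mulr0; congr Num.max.
  rewrite mulrBr mulrA; congr (_ - _)%R.
  by rewrite /c; field; rewrite !gt_eqF.
have -> : \int[leb]_(x in itv0 a) (excess phi d M (t^-1 * slope x) * w x)%:E =
    \int[leb]_(x in itv0 a) \sum_(i < M) (d / t)%:E * part (c i) x.
  apply: eq_integral => x _; rewrite /excess mulr_suml -sumEFin.
  by apply: eq_bigr => i _; rewrite partE.
rewrite (ge0_integral_sum leb mI (f := fun i : 'I_M => fun x => (d / t)%:E * part (c i) x)).
- apply: (@le_trans _ _ (\sum_(i < M) (t^-1 * S i)%:E)); last first.
    by rewrite sumEFin lee_fin -mulr_sumr ler_pdivrMl.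
  apply: lee_sum => i _; rewrite (ge0_integralZl_EFin leb mI).
  + apply: (@le_trans _ _ ((d / t)%:E * (d^-1 * S i)%:E)); last first.
      by rewrite -EFinM lee_fin le_eqVlt; apply/orP; left; apply/eqP; field; rewrite !gt_eqF.
    apply: lee_wpmul2l; first by rewrite lee_fin.
    apply: integral_slope_excess => // b b0 ba.
    rewrite ler_pdivlMl//; apply: le_trans (gS i b (ltn_ord i) _); last by split.
    by rewrite /tilt /g /c le_eqVlt; apply/orP; left; apply/eqP; field; rewrite gt_eqF.
  + by move=> x; exact: part_ge0.
  + exact: measurable_part.
  + exact: dt.
- by move=> i; apply: emeasurable_funM; [exact: measurable_cst|exact: measurable_part].
- by move=> i x Ix; rewrite mule_ge0 ?part_ge0// lee_fin.
Qed.

Lemma Mmod_level_function_le (t B : R) : (0 < t)%R ->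
  (forall h, test_fun a h -> pairing a f h <= t%:E * (modular a phi w h + B%:E)) ->
  Mmod a phi w (escale t^-1 (level_function a w (EFin \o f))) <= B%:E.
Proof.
move=> t0 HB.
rewrite (Mmod_level_function a_gt0 w_pos w_decr w_int f_int C_ge0 growth)//.
pose e n x := (excess phi n.+1%:R^-1 (n.+1 ^ 2) (t^-1 * slope x) * w x)%:E.
have exc0 d M x : (0 <= excess phi d M x)%R.
  by apply: sumr_ge0 => i _; rewrite le_max lexx.
have e0 n x : itv0 a x -> 0 <= e n x.
  by move=> Ix; rewrite lee_fin mulr_ge0 ?w0.
have me n : measurable_fun (itv0 a : set T) (e n : T -> \bar R).
  pose d : R := (n.+1%:R^-1)%R.
  apply: (@eq_measurable_fun _ _ T _ _ (fun x =>
     \sum_(i < n.+1 ^ 2) maxe 0 ((d * t^-1)%:E * (slope x * w x)%:E -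
        (increment phi d i)%:E * (EFin \o w) x))).
    move=> x; rewrite inE => Ix; rewrite /e -/d /excess mulr_suml -sumEFin.
    apply: eq_bigr => i _; rewrite -!EFinM -EFinB -[0%E]/(0%:E) -EFin_max.
    by rewrite maxr_pMl ?w0// mul0r; congr (Num.max _ _)%:E; rewrite /=; ring.
  apply: emeasurable_sum => i; apply: measurable_maxe; first exact: measurable_cst.
  apply: emeasurable_funB.
    by apply: emeasurable_funM; [exact: measurable_cst|exact: mslope].
  by apply: emeasurable_funM; [exact: measurable_cst|exact: mw].
apply: (@le_trans _ _ (\int[leb]_(x in itv0 a) limn_einf (e^~ x))).
  apply: ge0_le_integral.
  - exact: mI.
  - by move=> x Ix; rewrite mule_ge0 ?complementary_ge0 ?lee_fin ?w0.
  - exact: (measurable_complementary_slope a_gt0 w_pos w_decr w_int f_int C_ge0 growth).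
  - apply: (@emeasurable_fun_cvg _ T R _ (fun n x => einfs (e^~ x) n)
      (fun x => limn_einf (e^~ x))).
      by move=> n; apply: measurable_fun_einfs => m; exact: me.
    by move=> x _; rewrite limn_einf_lim; exact: is_cvg_einfs.
  - move=> x Ix; have wx : (0 < w x)%R by rewrite w_pos ?inE.
    have s0 : (0 <= t^-1 * slope x)%R by rewrite mulr_ge0 ?invr_ge0 ?slope0// ltW.
    apply: le_trans (lee_wpmul2r (ltW wx : 0 <= (w x)%:E) (complementary_liminf phi_orlicz s0)) _.
    apply: le_trans (limn_einfMr _ wx) _.
    by under eq_fun do rewrite -EFinM.
apply: (le_trans (fatou leb mI me e0)); apply: limn_einf_le => n.
by apply: integral_excess_le.
Qed.

End level_excess.

(** * The Koethe duals *)

Lemma le_luxemburg {R : realType} (rho rho' : (R -> \bar R) -> \bar R) (f f' : R -> \bar R) :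
  (forall t : R, (0 < t)%R -> rho (escale t^-1 f) <= rho' (escale t^-1 f')) ->
  luxemburg rho f <= luxemburg rho' f'.
Proof.
move=> H; apply: le_ereal_inf_tmp => _ [t [t0 Ht] <-].
by apply: ereal_inf_lbound; exists t => //; split => //; exact: le_trans (H t t0) Ht.
Qed.

Lemma le_amemiya {R : realType} (rho rho' : (R -> \bar R) -> \bar R) (f f' : R -> \bar R) :
  (forall t : R, (0 < t)%R -> rho (escale t^-1 f) <= rho' (escale t^-1 f')) ->
  amemiya rho f <= amemiya rho' f'.
Proof.
move=> H; apply: le_ereal_inf_tmp => _ [t t0 <-].
apply: (@le_trans _ _ (t%:E * (1 + rho (escale t^-1 f)))).
  by apply: ereal_inf_lbound; exists t.
by apply: lee_wpmul2l; [rewrite lee_fin ltW|apply: leeD2l; exact: H].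
Qed.

Section kothe_dual.
Context {R : realType} (a : \bar R) (phi w : R -> R).
Local Notation T := (lebesgue_type R).
Hypothesis a_gt0 : 0 < a.
Hypothesis phi_orlicz : orlicz_function phi.
Hypothesis w_pos : positive_on a w.
Hypothesis w_decr : decreasing_on a w.
Hypothesis w_int : forall t, itv0 a t -> \int[leb]_(x in `]0%R, t[) (w x)%:E < +oo.
Local Notation kothe_lux := (kothe_norm a (Lambda a phi w) (Lambda_norm a phi w)).
Local Notation kothe_ame := (kothe_norm a (Lambda a phi w) (Lambda_norm0 a phi w)).

Let measurable_L0 g : L0 a g -> measurable_fun (itv0 a : set T) (EFin \o g : T -> \bar R).
Proof. by move=> mg; apply/measurable_EFinP. Qed.

Section upper_bounds.
Variables (f v : R -> R) (f' : R -> \bar R).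
Hypothesis mf : L0 a f.
Hypothesis v_adm : admissible_weight a w v.
Hypothesis ff' : submaj a (EFin \o f) f'.

Let pair g s t : L0 a g -> (0 < s)%R -> (0 < t)%R ->
  \int[leb]_(x in itv0 a) (`|f x * g x|%R)%:E <=
  (s * t)%:E * (Phi a phi w (escale s^-1 (EFin \o g)) + Mmod a phi v (escale t^-1 f')).
Proof.
move=> mg s0 t0; have [vw vp vd] := v_adm.
under eq_integral do rewrite normrM EFinM.
apply: (pairing_le (ltW a_gt0) phi_orlicz w_pos w_decr vp vd _ (measurable_L0 mf)
  (measurable_L0 mg) ff' s0 t0).
by move=> x Ix; have := vw x Ix; rewrite !integral_rearr_weight.
Qed.

Let m0 t : 0 <= Mmod a phi v (escale t^-1 f').
Proof. by have [_ vp _] := v_adm; exact: Mmod_ge0. Qed.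

Lemma kothe_lux_upper : kothe_lux f <= amemiya (Mmod a phi v) f'.
Proof. by apply: le_ereal_inf_tmp => _ [t t0 <-]; apply: (kothe_lux_le m0 pair). Qed.

Lemma kothe_ame_upper : kothe_ame f <= luxemburg (Mmod a phi v) f'.
Proof.
apply: le_ereal_inf_tmp => _ [t [t0 mt] <-].
by have := kothe_ame_le phi_orlicz w_pos pair t0 (lexx 1%R) mt; rewrite mulr1.
Qed.

Lemma kothe_ame_lty t : (0 < t)%R -> Mmod a phi v (escale t^-1 f') < +oo ->
  kothe_ame f < +oo.
Proof.
move=> t0 mt; have mE : (fine (Mmod a phi v (escale t^-1 f')))%:E = Mmod a phi v (escale t^-1 f').
  by rewrite fineK// ge0_fin_numE.
have c1 : (1 <= Num.max 1 (fine (Mmod a phi v (escale t^-1 f'))))%R by rewrite le_max lexx.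
apply: le_lt_trans (kothe_ame_le phi_orlicz w_pos pair t0 c1 _) _; last by rewrite ltry.
by rewrite -mE lee_fin le_max lexx orbT.
Qed.

End upper_bounds.

Lemma admissible_weight_refl : admissible_weight a w w.
Proof. by split. Qed.

Lemma submaj_refl (f : R -> \bar R) : submaj a f f.
Proof. by []. Qed.

Lemma Phi_zero : Phi a phi w (EFin \o (fun=> 0%R)) <= 0.
Proof.
have H := @Phi_le_modular R a phi w phi_orlicz w_pos w_decr (fun=> 0%R) (fun=> 0%R)
  (test_fun0 a_gt0).
apply: le_trans (H _) _.
  move=> t [t0 _]; apply: distribution_le => //.
  rewrite /Defs.distribution (_ : [set x | _] = set0) ?measure0 ?lee_fin ?(ltW t0)//.
  by rewrite -subset0 => x [_]; rewrite /= normr0 ltxx.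
by rewrite /modular integral0_eq// => x _; rewrite (orlicz0 phi_orlicz) mul0r.
Qed.

Section lower_bounds.
Variable f : R -> R.
Hypothesis mf : L0 a f.
Local Notation f0 := (level_function a w (EFin \o f)).

Section growth.
Variable K : R.
Hypothesis K_ge0 : (0 <= K)%R.
Hypothesis pairing_growth : forall h, test_fun a h ->
  pairing a f h <= K%:E * (1 + modular a phi w h).

Let f_int := rearr_integrable a_gt0 phi_orlicz w_pos w_decr w_int K_ge0 pairing_growth.
Let growth := primitive_growth a_gt0 phi_orlicz w_pos w_decr w_int K_ge0 pairing_growth.
Let C_ge0 : (0 <= K * (1 + phi 1))%R.
Proof. by rewrite mulr_ge0// addr_ge0// (orlicz_ge0 phi_orlicz). Qed.

Lemma Mmod_level_le (t B : R) : (0 < t)%R ->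
  (forall h, test_fun a h -> pairing a f h <= t%:E * (modular a phi w h + B%:E)) ->
  Mmod a phi w (escale t^-1 f0) <= B%:E.
Proof. exact: (Mmod_level_function_le a_gt0 phi_orlicz w_pos w_decr w_int f_int C_ge0 growth). Qed.

Lemma level_weight_exists : exists2 v, admissible_weight a w v &
  forall t, (0 < t)%R -> Mmod a phi v (escale t^-1 (EFin \o f)) <= Mmod a phi w (escale t^-1 f0).
Proof.
exists (level_weight a (primitive (rearr a (EFin \o f))) (primitive (EFin \o w))
  (fine \o rearr a (EFin \o f)) w).
  exact: (admissible_level_weight a_gt0 w_pos w_decr w_int f_int C_ge0 growth).
by move=> t t0; apply: (Mmod_level_weight_le a_gt0 w_pos w_decr w_int f_int C_ge0 growth).
Qed.

(** The infimum over majorants ranges over real-valued functions, while the level function is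
    extended-valued. It is finite on [(0, a)], so its real part is a competitor with the same
    modular. *)
Lemma level_function_realized : exists g : R -> R, [/\ L0 a g,
  submaj a (EFin \o f) (EFin \o g) &
  forall c, Mmod a phi w (escale c (EFin \o g)) = Mmod a phi w (escale c f0)].
Proof.
have gE x : itv0 a x -> (EFin \o (fine \o f0)) x = f0 x.
  move=> Ix /=.
  by rewrite (level_functionE a_gt0 w_pos w_decr w_int f_int C_ge0 growth Ix).
exists (fine \o f0); split.
- apply/measurable_EFinP; apply: (@eq_measurable_fun _ _ T _ _ f0).
    by move=> x; rewrite inE => Ix; rewrite gE.
  exact: (measurable_level_function a_gt0 w_pos w_decr w_int f_int C_ge0 growth).
- move=> x Ix; rewrite (_ : rearr a (EFin \o (fine \o f0)) = rearr a f0).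
    exact: (submaj_level_function a_gt0 w_pos w_decr w_int f_int C_ge0 growth).
  apply: ae_eq_rearr; apply: (ae_notin_countable (countable0 R)) => y _; exact: gE.
- move=> c; rewrite /Mmod (_ : rearr a (escale c (EFin \o (fine \o f0))) = rearr a (escale c f0))//.
  apply: ae_eq_rearr; apply: (ae_notin_countable (countable0 R)) => y _ Iy.
  by rewrite /escale gE.
Qed.

End growth.

Lemma kothe_norm_ge0 N : N (EFin \o (fun=> 0%R)) <= 1 ->
  0 <= kothe_norm a (Lambda a phi w) N f.
Proof.
move=> N0; apply: ereal_sup_ubound; exists (fun=> 0%R); last first.
  by rewrite integral0_eq// => x _; rewrite mulr0 normr0.
split=> //; split; first exact: measurable_cst.
by exists 1%R => //; rewrite escale1 (le_lt_trans Phi_zero)// ltry.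
Qed.

Lemma kothe_lux_ge0 : 0 <= kothe_lux f.
Proof.
apply: kothe_norm_ge0; apply: ereal_inf_lbound; exists 1%R => //; split => //.
by rewrite invr1 escale1 (le_trans Phi_zero)// lee_fin.
Qed.

Lemma kothe_ame_ge0 : 0 <= kothe_ame f.
Proof.
apply: kothe_norm_ge0; apply: (@le_trans _ _ (1%:E * (1 + Phi a phi w (EFin \o (fun=> 0%R))))).
  by apply: ereal_inf_lbound; exists 1%R; [exact: ltr01|rewrite invr1 escale1].
by rewrite mul1e -[leRHS]adde0; apply: leeD2l; exact: Phi_zero.
Qed.

Section finite_ame.
Hypothesis f_lty : kothe_ame f < +oo.
Let K := fine (kothe_ame f).
Let KE : K%:E = kothe_ame f.
Proof. by rewrite fineK// ge0_fin_numE// kothe_ame_ge0. Qed.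
Let K_ge0 : (0 <= K)%R. Proof. by rewrite -lee_fin KE kothe_ame_ge0. Qed.
Let pairing_growth h : test_fun a h -> pairing a f h <= K%:E * (1 + modular a phi w h).
Proof.
move=> th; apply: (pairing_le_ame a_gt0 phi_orlicz w_pos w_decr mf th) => //; last by rewrite KE.
exact: modular_lty.
Qed.

(** The growth of the pairing already has the required form with [B = 1], so the Amemiya norm of the
    primal space needs no multiplier; [e] makes the scale positive when the norm is 0. *)
Let Mmod_le1 e : (0 < e)%R -> Mmod a phi w (escale (K + e)^-1 f0) <= 1.
Proof.
move=> e0; apply: (Mmod_level_le K_ge0 pairing_growth); first by rewrite ltr_wpDl.
move=> h th; apply: (le_trans (pairing_growth th)); rewrite addeC.
apply: lee_wpmul2r; last by rewrite lee_fin lerDl ltW.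
by rewrite adde_ge0 ?lee_fin// (modular_ge0 phi_orlicz).
Qed.

Lemma luxemburg_level_le : luxemburg (Mmod a phi w) f0 <= kothe_ame f.
Proof.
rewrite -KE; apply/lee_addgt0Pr => e e0; apply: ereal_inf_lbound.
by exists (K + e)%R => //; split; [rewrite /= ltr_wpDl|exact: Mmod_le1].
Qed.

(** The upper bounds put the Koethe norm below both infima, [level_weight_exists] and
    [level_function_realized] put these below the norm of the level function, and
    [luxemburg_level_le] closes the cycle. *)
Lemma kothe_ame_norms :
  [/\ kothe_ame f = luxemburg (Mmod a phi w) f0,
      kothe_ame f = Mspace_norm a phi w (EFin \o f),
      kothe_ame f = ereal_inf [set luxemburg (Mmod a phi w) (EFin \o g)
        | g in [set g : R -> R | L0 a g /\ submaj a (EFin \o f) (EFin \o g)]] &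
      Mspace a phi w f].
Proof.
have [v v_adm Mv] := level_weight_exists K_ge0 pairing_growth.
have [g [mg fg Mg]] := level_function_realized K_ge0 pairing_growth.
have upper_v : kothe_ame f <= Mspace_norm a phi w (EFin \o f).
  by apply: le_ereal_inf_tmp => _ [u u_adm <-]; exact: (kothe_ame_upper mf u_adm (submaj_refl _)).
have lower_v : Mspace_norm a phi w (EFin \o f) <= luxemburg (Mmod a phi w) f0.
  apply: le_trans (le_luxemburg Mv); apply: ereal_inf_lbound; by exists v.
have upper_g : kothe_ame f <= ereal_inf [set luxemburg (Mmod a phi w) (EFin \o g)
    | g in [set g : R -> R | L0 a g /\ submaj a (EFin \o f) (EFin \o g)]].
  apply: le_ereal_inf_tmp => _ [u [mu fu] <-].
  exact: (kothe_ame_upper mf admissible_weight_refl).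
have lower_g : ereal_inf [set luxemburg (Mmod a phi w) (EFin \o g)
    | g in [set g : R -> R | L0 a g /\ submaj a (EFin \o f) (EFin \o g)]] <=
    luxemburg (Mmod a phi w) f0.
  apply: (@le_trans _ _ (luxemburg (Mmod a phi w) (EFin \o g))).
    by apply: ereal_inf_lbound; exists g.
  by apply: le_luxemburg => t _; rewrite Mg.
have f0_le := luxemburg_level_le.
split.
- by apply/le_anti; rewrite f0_le andbT (le_trans upper_v lower_v).
- by apply/le_anti; rewrite upper_v (le_trans lower_v f0_le).
- by apply/le_anti; rewrite upper_g (le_trans lower_g f0_le).
split=> //; exists g => //; split=> //; exists (K + 1)^-1%R.
  by rewrite invr_gt0 ltr_wpDl.
by rewrite Mg (le_lt_trans (Mmod_le1 ltr01))// ltry.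
Qed.

End finite_ame.

Section finite_lux.
Hypothesis f_lty : kothe_lux f < +oo.
Let K := fine (kothe_lux f).
Let KE : K%:E = kothe_lux f.
Proof. by rewrite fineK// ge0_fin_numE// kothe_lux_ge0. Qed.
Let K_ge0 : (0 <= K)%R. Proof. by rewrite -lee_fin KE kothe_lux_ge0. Qed.
Let fK : kothe_lux f <= K%:E. Proof. by rewrite KE. Qed.
Let pairing_growth h : test_fun a h -> pairing a f h <= K%:E * (1 + modular a phi w h).
Proof. by move=> th; exact: pairing_growth_lux. Qed.

(** The multiplier inequality solved for the pairing reads [t * (modular + B)] with this [B], which
    is chosen by [t * (1 + B) = K + e]; hence the scale [t] nearly attains the Amemiya norm. *)
Let Mmod_lagrange e : (0 < e)%R -> exists2 t : R, (0 < t)%R &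
  Mmod a phi w (escale t^-1 f0) <= ((K + e) / t - 1)%:E.
Proof.
move=> e0; have [t t0 Ht] :=
  pairing_lagrange a_gt0 phi_orlicz w_pos w_decr w_int mf K_ge0 fK e0.
exists t => //; apply: (Mmod_level_le K_ge0 pairing_growth t0) => h th.
have mE := modular_fin phi_orlicz w_pos w_decr w_int th; have H := Ht h th.
rewrite mE -EFinM -EFinD -leeBrDr// -EFinB in H; apply: (le_trans H).
rewrite mE -EFinD -EFinM lee_fin le_eqVlt; apply/orP; left; apply/eqP; field; exact: lt0r_neq0.
Qed.

Lemma amemiya_level_le : amemiya (Mmod a phi w) f0 <= kothe_lux f.
Proof.
rewrite -KE; apply/lee_addgt0Pr => e e0; have [t t0 Ht] := Mmod_lagrange e0.
apply: (@le_trans _ _ (t%:E * (1 + Mmod a phi w (escale t^-1 f0)))).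
  by apply: ereal_inf_lbound; exists t.
apply: (@le_trans _ _ (t%:E * (1 + ((K + e) / t - 1)%:E))).
  by apply: lee_wpmul2l; [rewrite lee_fin ltW|exact: leeD2l].
rewrite -EFinD -EFinM -EFinD lee_fin le_eqVlt; apply/orP; left; apply/eqP; field.
exact: lt0r_neq0.
Qed.

Lemma kothe_lux_norms :
  [/\ kothe_lux f = amemiya (Mmod a phi w) f0,
      kothe_lux f = Mspace_norm0 a phi w (EFin \o f),
      kothe_lux f = ereal_inf [set amemiya (Mmod a phi w) (EFin \o g)
        | g in [set g : R -> R | L0 a g /\ submaj a (EFin \o f) (EFin \o g)]] &
      Mspace a phi w f].
Proof.
have [v v_adm Mv] := level_weight_exists K_ge0 pairing_growth.
have [g [mg fg Mg]] := level_function_realized K_ge0 pairing_growth.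
have upper_v : kothe_lux f <= Mspace_norm0 a phi w (EFin \o f).
  by apply: le_ereal_inf_tmp => _ [u u_adm <-]; exact: (kothe_lux_upper mf u_adm (submaj_refl _)).
have lower_v : Mspace_norm0 a phi w (EFin \o f) <= amemiya (Mmod a phi w) f0.
  apply: le_trans (le_amemiya Mv); apply: ereal_inf_lbound; by exists v.
have upper_g : kothe_lux f <= ereal_inf [set amemiya (Mmod a phi w) (EFin \o g)
    | g in [set g : R -> R | L0 a g /\ submaj a (EFin \o f) (EFin \o g)]].
  apply: le_ereal_inf_tmp => _ [u [mu fu] <-].
  exact: (kothe_lux_upper mf admissible_weight_refl).
have lower_g : ereal_inf [set amemiya (Mmod a phi w) (EFin \o g)
    | g in [set g : R -> R | L0 a g /\ submaj a (EFin \o f) (EFin \o g)]] <=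
    amemiya (Mmod a phi w) f0.
  apply: (@le_trans _ _ (amemiya (Mmod a phi w) (EFin \o g))).
    by apply: ereal_inf_lbound; exists g.
  by apply: le_amemiya => t _; rewrite Mg.
have f0_le := amemiya_level_le.
split.
- by apply/le_anti; rewrite f0_le andbT (le_trans upper_v lower_v).
- by apply/le_anti; rewrite upper_v (le_trans lower_v f0_le).
- by apply/le_anti; rewrite upper_g (le_trans lower_g f0_le).
have [t t0 Mt] := Mmod_lagrange ltr01.
split=> //; exists g => //; split=> //; exists t^-1%R; first by rewrite invr_gt0.
by rewrite Mg (le_lt_trans Mt)// ltry.
Qed.

End finite_lux.

End lower_bounds.

(** The upper bounds are applied with the weight [w], the majorant [g] and the single scale [l^-1],
    at which the modular is finite but may exceed 1. *)
Lemma Mspace_kothe_lty f : Mspace a phi w f ->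
  [/\ L0 a f, kothe_lux f < +oo & kothe_ame f < +oo].
Proof.
move=> [mf [g [mg [l l0 Ml]] fg]]; have il0 : (0 < l^-1)%R by rewrite invr_gt0.
rewrite -[l]invrK in Ml.
split=> //; last exact: (kothe_ame_lty mf admissible_weight_refl fg il0 Ml).
have m0 : 0 <= Mmod a phi w (escale l^-1^-1 (EFin \o g)) by exact: Mmod_ge0.
apply: le_lt_trans (kothe_lux_upper mf admissible_weight_refl fg) _.
apply: (@le_lt_trans _ _ (l^-1%:E * (1 + Mmod a phi w (escale l^-1^-1 (EFin \o g))))).
  by apply: ereal_inf_lbound; exists l^-1%R.
by rewrite -(fineK (_ : Mmod _ _ _ _ \is a fin_num)) ?ge0_fin_numE// -EFinD -EFinM ltry.
Qed.

End kothe_dual.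

Theorem theorem8p10 (R : realType) (phi w : R -> R) (a : \bar R)
    (a_gt0 : 0 < a)
    (phi_orlicz : orlicz_function phi)
    (w_pos : positive_on a w)
    (w_decr : decreasing_on a w)
    (w_int : forall t : R, itv0 a t ->
       \int[completed_lebesgue_measure]_(x in `]0%R, t[) (w x)%:E < +oo) :
  [/\ kothe_dual a (Lambda a phi w) (Lambda_norm a phi w) = Mspace a phi w,
      kothe_dual a (Lambda a phi w) (Lambda_norm0 a phi w) = Mspace a phi w &
      forall f : R -> R, Mspace a phi w f ->
        [/\ kothe_norm a (Lambda a phi w) (Lambda_norm a phi w) f
              = Mspace_norm0 a phi w (EFin \o f),
            kothe_norm a (Lambda a phi w) (Lambda_norm0 a phi w) f
              = Mspace_norm a phi w (EFin \o f),
            [/\ Mspace_norm a phi w (EFin \o f)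
                  = ereal_inf [set luxemburg (Mmod a phi w) (EFin \o g)
                              | g in [set g : R -> R | L0 a g /\
                                        submaj a (EFin \o f) (EFin \o g)]] &
                Mspace_norm a phi w (EFin \o f)
                  = luxemburg (Mmod a phi w)
                      (level_function a w (EFin \o f))] &
            [/\ Mspace_norm0 a phi w (EFin \o f)
                  = ereal_inf [set amemiya (Mmod a phi w) (EFin \o g)
                              | g in [set g : R -> R | L0 a g /\
                                        submaj a (EFin \o f) (EFin \o g)]] &
                Mspace_norm0 a phi w (EFin \o f)
                  = amemiya (Mmod a phi w)
                      (level_function a w (EFin \o f))]]].
Proof.
split.
- apply/seteqP; split=> f; first by move=> [mf fK]; have [] := kothe_lux_norms a_gt0
    phi_orlicz w_pos w_decr w_int mf fK.
  by move=> Mf; have [mf ? _] := Mspace_kothe_lty a_gt0 phi_orlicz w_pos w_decr Mf.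
- apply/seteqP; split=> f; first by move=> [mf fK]; have [] := kothe_ame_norms a_gt0
    phi_orlicz w_pos w_decr w_int mf fK.
  by move=> Mf; have [mf _ ?] := Mspace_kothe_lty a_gt0 phi_orlicz w_pos w_decr Mf.
move=> f Mf; have [mf lux ame] := Mspace_kothe_lty a_gt0 phi_orlicz w_pos w_decr Mf.
have [l1 l2 l3 _] := kothe_lux_norms a_gt0 phi_orlicz w_pos w_decr w_int mf lux.
have [a1 a2 a3 _] := kothe_ame_norms a_gt0 phi_orlicz w_pos w_decr w_int mf ame.
split; [exact: l2|exact: a2| |].
- by split; rewrite -a2.
- by split; rewrite -l2.
Qed.
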